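(* (Stochastic Noether theorem.) Let $$X=Q^\alpha\frac{\partial}{\partial z^\alpha}+Q^\alpha_{,i}\frac{\partial}{\partial z^\alpha_{,i}}+P^\alpha\frac{\partial}{\partial\eta^\alpha}+\widetilde P^\alpha\frac{\partial}{\partial\widetilde\eta^\alpha},$$ where $Q^\alpha,P^\alpha,\widetilde P^\alpha$ are functions of $(x,t,[z],[\eta],[\widetilde\eta])$, generate a (divergence) variational symmetry, i.e. there are functions $B^i,\widetilde B^i$ of $(x,t,[z],[\eta],[\widetilde\eta])$, $i=1,\dots,n$, with $$X L=B^i_{,i}\qquad\text{and}\qquad X\widetilde L=\widetilde B^i_{,i},$$ where $$L=L^0_\alpha(z)\eta^\alpha+L^i_\alpha(z)z^\alpha_{,i}-H(z),\qquad \widetilde L=L^0_\alpha(z)\widetilde\eta^\alpha+\widetilde L^i_\alpha(z)z^\alpha_{,i}-\widetilde H(z).$$ Let $z$, with $dz^\alpha=\eta^\alpha\,dt+\widetilde\eta^\alpha\circ dW_t$, be a solution of the stochastic multisymplectic system $$M_{\alpha\beta}(z)\,dz^\beta+K^i_{\alpha\beta}(z)z^\beta_{,i}\,dt+\widetilde K^i_{\alpha\beta}(z)z^\beta_{,i}\circ dW_t=\frac{\partial H}{\partial z^\alpha}\,dt+\frac{\partial \widetilde H}{\partial z^\alpha}\circ dW_t,\qquad \alpha=1,\dots,m,$$ and suppose that the compatibility relation $$dQ^\alpha=P^\alpha\,dt+\widetilde P^\alpha\circ dW_t$$ holds. Then $z$ satisfies the conservation law $$d\big(L^0_\alpha Q^\alpha\big)+\big(L^i_\alpha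 Q^\alpha\,dt+\widetilde L^i_\alpha Q^\alpha\circ dW_t-B^i\,dt-\widetilde B^i\circ dW_t\big)_{,i}=0 .$$
   Context: Let $x=(x^1,\dots,x^n)\in\mathbb R^n$ be spatial coordinates and $t$ time; a subscript ${}_{,i}$ denotes the total derivative with respect to $x^i$, and $[f]$ denotes $f$ together with finitely many of its spatial derivatives. Repeated spatial indices $i$ are summed over $1,\dots,n$ and repeated Greek indices over $1,\dots,m$. Let $W$ be a one-dimensional Brownian motion on a probability space; all fields are adapted to the filtration generated by $W$. The symbol $d$ is the stochastic time increment and $\circ\,dW_t$ is Stratonovich integration, so the ordinary product and chain rules hold. Equalities between stochastic differentials mean equality of the corresponding time-integrated expressions, almost surely, for each $x$. Data: smooth functions $L^0_\alpha,\ L^i_\alpha,\ \widetilde L^i_\alpha,\ H,\ \widetilde H:\mathbb R^m\to\mathbb R$ of $z=(z^1,\dots,z^m)$ ($i=1,\dots,n$, $\alpha=1,\dots,m$), and the skew-symmetric matrices $$M_{\alpha\beta}=\frac{\partial L^0_\beta}{\partial z^\alpha}-\frac{\partial L^0_\alpha}{\partial z^\beta},\quad K^i_{\alpha\beta}=\frac{\partial L^i_\beta}{\partial z^\alpha}-\frac{\partial L^i_\alpha}{\partial z^\beta},\quad \widetilde K^i_{\alpha\beta}=\frac{\partial \widetilde L^i_\beta}{\partial z^\alpha}-\frac{\partial \widetilde L^i_\alpha}{\partial z^\beta}.$$ The random field $z(x,t)$ is assumed to have the semimartingale decomposition $dz^\alpha=\eta^\alpha\,dt+\widetilde\eta^\alpha\circ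 dW_t$ with $\eta^\alpha,\widetilde\eta^\alpha$ adapted random fields. In computing the action of $X$ on $L,\widetilde L$, the quantities $z^\alpha,z^\alpha_{,i},\eta^\alpha,\widetilde\eta^\alpha$ are treated as independent jet coordinates, so for example $XL=Q^\alpha\partial L/\partial z^\alpha+Q^\alpha_{,i}\,\partial L/\partial z^\alpha_{,i}+P^\alpha\partial L/\partial\eta^\alpha+\widetilde P^\alpha\partial L/\partial\widetilde\eta^\alpha$. In the compatibility relation and the conclusion, $Q^\alpha,P^\alpha,\widetilde P^\alpha,B^i,\widetilde B^i$ are evaluated along $z$. All fields are assumed smooth in $x$ and regular enough in $t$ (adapted, continuous, with semimartingale integrands) that all Stratonovich integrals written are defined and that spatial derivatives commute with $d$ and with time integration. *)

(* Defs.v *)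
From HB Require Import structures.
From mathcomp Require Export all_boot all_order all_algebra.
From mathcomp Require Export all_classical all_reals all_analysis.

Set Implicit Arguments.
Unset Strict Implicit.
Unset Printing Implicit Defensive.
Import Order.TTheory GRing.Theory Num.Theory numFieldNormedType.Exports.
Local Open Scope classical_set_scope.
Local Open Scope ring_scope.

(* Calculus in coordinates.  A point is a family of reals indexed by a type C
   of coordinates: C = 'I_k gives R^k, and C = coord n m (below) gives the
   infinite jet space.  Continuity is for the product topology, which is the
   usual one when C is finite. *)
Section Calculus.
Context {R : realType} {C : eqType}.
Implicit Types (F : (C -> R) -> R) (u : C -> R).

Definition pd (c : C) F : (C -> R) -> R :=
  fun u => derive1 (fun r : R => F [eta u with c |-> r]) (u c).

(* C^infinity in the coordinates satisfying S, all these partial derivatives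
   being jointly continuous in all the coordinates *)
Definition smooth_in (S : pred C) F : Prop :=
  forall s : seq C, all S s ->
    continuous (foldr pd F s : {ptws C -> R} -> R) /\
    forall (c : C) u, S c ->
      derivable (fun r : R => foldr pd F s [eta u with c |-> r]) (u c) 1.

Definition smooth F : Prop := smooth_in xpredT F.

End Calculus.

Section MultiIndex.
Context {n : nat}.

Definition mindex := {ffun 'I_n -> nat}.
Definition mindex0 : mindex := [ffun => 0%N].
Definition mindexS (i : 'I_n) (J : mindex) : mindex :=
  [ffun k => (J k + (k == i))%N].

Definition pdn {R : realType} (J : mindex) (f : ('I_n -> R) -> R) :
    ('I_n -> R) -> R :=
  foldr (fun i g => iter (J i) (pd i) g) f (enum 'I_n).

End MultiIndex.
Arguments mindex n : clear implicits.

(* Coordinates x^i, t, z^a_J, eta^a_J, etat^a_J of the jet space; etat is the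
   coefficient of dW in dz. *)
Inductive coord (n m : nat) :=
  | Space of 'I_n
  | Time
  | JetZ of 'I_m & mindex n
  | JetEta of 'I_m & mindex n
  | JetEtat of 'I_m & mindex n.
Arguments Space {n m} i.
Arguments Time {n m}.
Arguments JetZ {n m} a J.
Arguments JetEta {n m} a J.
Arguments JetEtat {n m} a J.

Section CoordChoice.
Context {n m : nat}.
Local Notation code := (option 'I_n +
  ('I_m * mindex n + ('I_m * mindex n + 'I_m * mindex n)))%type.

Definition coord_code (c : coord n m) : code :=
  match c with
  | Space i => inl (Some i)
  | Time => inl None
  | JetZ a J => inr (inl (a, J))
  | JetEta a J => inr (inr (inl (a, J)))
  | JetEtat a J => inr (inr (inr (a, J)))
  end.

Definition coord_decode (c : code) : coord n m :=
  match c with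
  | inl (Some i) => Space i
  | inl None => Time
  | inr (inl (a, J)) => JetZ a J
  | inr (inr (inl (a, J))) => JetEta a J
  | inr (inr (inr (a, J))) => JetEtat a J
  end.

Lemma coord_codeK : cancel coord_code coord_decode.
Proof. by case. Qed.

HB.instance Definition _ :=
  Choice.copy (coord n m) (can_type coord_codeK).

End CoordChoice.

Section DifferentialFunctions.
Context {R : realType} {n m : nat}.
Local Notation jet := (coord n m -> R).
Implicit Types (F : jet -> R) (u : jet).

Definition finite_order F : Prop :=
  exists s : seq (coord n m),
    forall u v : jet, (forall c, c \in s -> u c = v c) -> F u = F v.

(* a smooth function of (x, t, [z], [eta], [etat]); no differentiability in t
   is required *)
Definition dfun F : Prop := finite_order F /\ smooth_in (predC1 Time) F.

(* derivative of each coordinate along the total derivative D_i *)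
Definition dcoord (i : 'I_n) u (c : coord n m) : R :=
  match c with
  | Space j => (j == i)%:R
  | Time => 0
  | JetZ a J => u (JetZ a (mindexS i J))
  | JetEta a J => u (JetEta a (mindexS i J))
  | JetEtat a J => u (JetEtat a (mindexS i J))
  end.

(* For F of finite order the sum has finite support. *)
Definition tder (i : 'I_n) F : jet -> R :=
  fun u => \sum_(c \in [set: coord n m]) dcoord i u c * pd c F u.

Definition jz u : 'I_m -> R := fun a => u (JetZ a mindex0).

(* JetZ a (e_i) is the coordinate z^a_{,i}. *)
Definition Zx (i : 'I_n) (a : 'I_m) : coord n m := JetZ a (mindexS i mindex0).

(* L and tilde L, according to whether the velocity coordinates v are those
   of eta or of etat *)
Definition lagrangian (v : 'I_m -> coord n m)
    (L0 : 'I_m -> ('I_m -> R) -> R) (L1 : 'I_n -> 'I_m -> ('I_m -> R) -> R)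
    (H : ('I_m -> R) -> R) : jet -> R :=
  fun u => \sum_a L0 a (jz u) * u (v a)
         + \sum_i \sum_a L1 i a (jz u) * u (Zx i a)
         - H (jz u).

Definition Xact (Q P Pt : 'I_m -> jet -> R) (F : jet -> R) : jet -> R :=
  fun u => \sum_a Q a u * pd (JetZ a mindex0) F u
         + \sum_i \sum_a tder i (Q a) u * pd (Zx i a) F u
         + \sum_a P a u * pd (JetEta a mindex0) F u
         + \sum_a Pt a u * pd (JetEtat a mindex0) F u.

Definition div_symmetry (Q P Pt : 'I_m -> jet -> R) (L : jet -> R)
    (B : 'I_n -> jet -> R) : Prop :=
  forall u, Xact Q P Pt L u = \sum_i tder i (B i) u.

(* the matrices M, K^i and tilde K^i, from L^0, L^i and tilde L^i *)
Definition curl (L : 'I_m -> ('I_m -> R) -> R) (a b : 'I_m) :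
    ('I_m -> R) -> R :=
  fun z => pd a (L b) z - pd b (L a) z.

End DifferentialFunctions.

Section StochasticCalculus.
Context {R : realType} {d : measure_display} {Omega : measurableType d}.
Variables (P : probability Omega R) (W : R -> Omega -> R) (T : R).
Implicit Types (X Y a b : R -> Omega -> R).

Definition past (t : R) : set (set Omega) :=
  <<s [set A | exists (r : R) (B : set R),
        [/\ 0 <= r <= t, measurable B & A = W r @^-1` B]] >>.

Definition brownian : Prop :=
  [/\ forall t, 0 <= t -> measurable_fun setT (W t),
      {ae P, forall w, W 0 w = 0},
      {ae P, forall w, {within `[0, +oo[, continuous (W ^~ w)}},
      forall (s t : R) (B : set R), 0 <= s < t -> measurable B ->
        P [set w | B (W t w - W s w)] = normal_prob 0 (Num.sqrt (t - s)) B
    & forall (s t : R) (A : set Omega) (B : set R),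
        0 <= s < t -> past s A -> measurable B ->
        P (A `&` [set w | B (W t w - W s w)])
        = (P A * P [set w | B (W t w - W s w)%R])%E].

(* filtration generated by W, augmented by the P-null sets *)
Definition filtration (t : R) : set (set Omega) :=
  [set A | measurable A /\
           exists2 B, past t B & P.-negligible ((A `\` B) `|` (B `\` A))].

Definition adapted X : Prop :=
  forall t (B : set R), 0 <= t <= T -> measurable B ->
    filtration t (X t @^-1` B).

Definition continuous_paths X : Prop :=
  forall w, {within `[0, T], continuous (X ^~ w)}.

Definition martingale X : Prop :=
  [/\ adapted X,
      forall t, 0 <= t <= T -> P.-integrable setT (EFin \o X t)
    & forall s t A, 0 <= s -> s <= t -> t <= T -> filtration s A ->
        (\int[P]_(w in A) (X t w)%:E = \int[P]_(w in A) (X s w)%:E)%E].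

Definition stopping_time (tau : Omega -> R) : Prop :=
  (forall w, 0 <= tau w) /\
  forall t, 0 <= t <= T -> filtration t [set w | tau w <= t].

Definition local_martingale X : Prop :=
  adapted X /\
  exists tau : nat -> Omega -> R,
    [/\ forall k, stopping_time (tau k),
        forall k w, tau k w <= tau k.+1 w,
        {ae P, forall w, exists k, T <= tau k w}
      & forall k, martingale (fun t w => X (Num.min t (tau k w)) w - X 0 w)].

Definition semimartingale X : Prop :=
  exists M A : R -> Omega -> R,
    [/\ local_martingale M /\ continuous_paths M,
        adapted A /\ continuous_paths A,
        forall w, bounded_variation 0 T (A ^~ w)
      & forall t w, 0 <= t <= T -> X t w = M t w + A t w].

Definition trapezoid X Y (s : seq R) (w : Omega) : R :=
  \sum_(0 <= k < size s)
     (X (nth 0 (0 :: s) k) w + X (nth 0 s k) w) / 2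
     * (Y (nth 0 s k) w - Y (nth 0 (0 :: s) k) w).

Definition mesh_lt (s : seq R) (delta : R) : Prop :=
  forall k, (k < size s)%N -> nth 0 s k - nth 0 (0 :: s) k < delta.

(* I is the Stratonovich integral of X with respect to Y over [0, t]: the
   limit in probability of the trapezoidal sums over the partitions
   0 = s_0 < ... < s_N = t, as the mesh tends to 0. *)
Definition stratonovich X Y (t : R) (I : Omega -> R) : Prop :=
  measurable_fun setT I /\
  forall eps eps' : R, 0 < eps -> 0 < eps' ->
    exists2 delta : R, 0 < delta &
      forall s : seq R, itv_partition 0 t s -> mesh_lt s delta ->
        (P [set w | (eps <= `|trapezoid X Y s w - I w|)%R] <= eps'%:E)%E.

Definition time_integral a (t : R) (w : Omega) : R :=
  \int[lebesgue_measure]_(s in `[0, t]) a s w.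

(* dY = a dt + b o dW on [0, T] *)
Definition sdiff Y a b : Prop :=
  forall t, 0 <= t <= T -> exists2 I : Omega -> R, stratonovich b W t I &
    {ae P, forall w, Y t w - Y 0 w = time_integral a t w + I w}.

End StochasticCalculus.

Section RandomFields.
Context {R : realType} {d : measure_display} {Omega : measurableType d}.
Context {n m : nat}.
(* f t w x is the value at (x, t) for the outcome w *)
Implicit Types f : R -> Omega -> ('I_n -> R) -> R.

Definition regular_field (P : probability Omega R) (W : R -> Omega -> R)
    (T : R) f : Prop :=
  [/\ forall x, adapted P W T (fun t w => f t w x),
      forall t w, 0 <= t <= T -> smooth (f t w)
    & forall (J : mindex n) x,
        continuous_paths T (fun t w => pdn J (f t w) x)].

Definition prolong (z eta etat : 'I_m -> R -> Omega -> ('I_n -> R) -> R)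
    (t : R) (w : Omega) (x : 'I_n -> R) : coord n m -> R :=
  fun c => match c with
  | Space i => x i
  | Time => t
  | JetZ a J => pdn J (z a t w) x
  | JetEta a J => pdn J (eta a t w) x
  | JetEtat a J => pdn J (etat a t w) x
  end.

(* M_{ab} dz^b is a Stratonovich differential with integrator z^b; IM b, IK
   and IH are the Stratonovich integrals occurring in the a-th equation,
   integrated over [0, t]. *)
Definition multisymplectic (P : probability Omega R) (W : R -> Omega -> R)
    (T : R) (L0 : 'I_m -> ('I_m -> R) -> R)
    (L1 Lt1 : 'I_n -> 'I_m -> ('I_m -> R) -> R) (H Ht : ('I_m -> R) -> R)
    (z : 'I_m -> R -> Omega -> ('I_n -> R) -> R) : Prop :=
  let zat x t w := fun a => z a t w x in
  forall (x : 'I_n -> R) (a : 'I_m) (t : R), 0 <= t <= T ->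
  exists (IM : 'I_m -> Omega -> R) (IK IH : Omega -> R),
    [/\ forall b, stratonovich P (fun s w => curl L0 a b (zat x s w))
                    (fun s w => z b s w x) t (IM b),
        stratonovich P (fun s w => \sum_i \sum_b
            curl (Lt1 i) a b (zat x s w) * pd i (z b s w) x) W t IK,
        stratonovich P (fun s w => pd a Ht (zat x s w)) W t IH
      & {ae P, forall w,
          \sum_b IM b w
          + time_integral (fun s w => \sum_i \sum_b
              curl (L1 i) a b (zat x s w) * pd i (z b s w) x) t w
          + IK w
          = time_integral (fun s w => pd a H (zat x s w)) t w + IH w}].

(* the integrands of the Stratonovich integrals in the system, in the
   decomposition of z and in the compatibility relation *)
Definition semimartingale_integrands (P : probability Omega R)
    (W : R -> Omega -> R) (T : R) (L0 : 'I_m -> ('I_m -> R) -> R)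
    (Lt1 : 'I_n -> 'I_m -> ('I_m -> R) -> R) (Ht : ('I_m -> R) -> R)
    (Pt : 'I_m -> (coord n m -> R) -> R)
    (z eta etat : 'I_m -> R -> Omega -> ('I_n -> R) -> R) : Prop :=
  let zat x t w := fun a => z a t w x in
  forall (x : 'I_n -> R) (a : 'I_m),
    [/\ semimartingale P W T (fun t w => etat a t w x),
        semimartingale P W T (fun t w => Pt a (prolong z eta etat t w x)),
        forall b, semimartingale P W T (fun t w => curl L0 a b (zat x t w)),
        semimartingale P W T (fun t w => \sum_i \sum_b
          curl (Lt1 i) a b (zat x t w) * pd i (z b t w) x)
      & semimartingale P W T (fun t w => pd a Ht (zat x t w))].

End RandomFields.

(* Main.v *)
From mathcomp Require Import ring lra measurable_realfun.
Require Import Defs.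
Set Implicit Arguments.
Unset Strict Implicit.
Unset Printing Implicit Defensive.
Import Order.TTheory GRing.Theory Num.Theory numFieldNormedType.Exports.
Local Open Scope classical_set_scope.
Local Open Scope ring_scope.

(** All the identities are read on trapezoidal sums, up to terms which tend to
0 in probability with the mesh.  Semimartingales are good integrators: the
transforms by small adapted weights are uniformly small in probability.  For
martingales this follows by comparing a transform with the martingale through
the convex function sqrt (1 + x^2), without square integrability.  Good
integrators have tight quadratic variation, and the error made by replacing
[avg Y * dS] by the increment of the Stratonovich integral of Y over the same
step is a Levy area, small enough to be summed against a second integrand.
Hence [V o (Y o dS) = (V Y) o dS], and the trapezoidal Taylor formula, whose
error is o(|dz|^2), gives the Stratonovich chain rule for f(z).

By the chain rule in the jets and the symmetry of the Lagrangians, the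
divergence of the flux is, for the dW part (and likewise for the dt part),
[- Q^a (d_a L0_b etat^b + Kt^i_ab z^b_i - d_a Ht) - L0_a PPt^a].  Inserting the
decomposition of z, the equations of motion and the compatibility relation
turns its integral into that of [- Q^a d_b L0_a o dz^b - L0_a o dQ^a], which
is [- d (L0_a Q^a)]. *)

(** * Events of high probability and the filtration *)

(** Stratonovich integrals are given only as limits in probability at each fixed time, and each
    stochastic equation holds off a null set that may depend on the time. Hence only values at the
    finitely many points of a grid are compared, no regular version of an integral process is
    chosen, and every estimate has constants that do not depend on the grid; pathwise bounds reach
    this uniformity through Egorov's theorem. The semimartingale hypotheses concern the integrands,
    not z or Q. Up to a time integral, z and Q are Stratonovich integrals of such integrands against
    W, and [strat_good] makes them good integrators. The weights Q d_a L0_b and L0_a(z) are not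
    shown to be good integrators. Associativity asks of the outer factor only continuous adapted
    paths and tight quadratic variation, which pass to products and to smooth functions of z. To
    reach an integral over a coarse step, the step is cut into n equal parts with n as large as the
    grid demands; this is affordable because the Levy area is estimated uniformly in n. *)

Section MeasurableComparison.
Context {R : realType} {d : measure_display} {Omega : measurableType d}.
Implicit Types f g : Omega -> R.

Lemma measurable_set_le f g : measurable_fun setT f -> measurable_fun setT g ->
  measurable [set w | f w <= g w].
Proof.
by move=> mf mg; rewrite -[X in measurable X]setTI; exact: measurable_fun_le.
Qed.

Lemma measurable_set_lt f g : measurable_fun setT f -> measurable_fun setT g ->
  measurable [set w | f w < g w].
Proof.
move=> mf mg; rewrite (_ : [set _ | _] = ~` [set w | g w <= f w]).
  by apply: measurableC; exact: measurable_set_le.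
by apply/seteqP; split => w /=; rewrite ltNge => /negP.
Qed.

End MeasurableComparison.

Section HighProbability.
Context {R : realType} {d : measure_display} {Omega : measurableType d}.
Variable P : probability Omega R.
Implicit Types (e : R) (Phi Psi : Omega -> Prop).

(** The exceptional outcomes are only covered by a measurable set, so that [Phi] itself need not be
    measurable. *)
Definition whp e Phi : Prop := exists A : set Omega,
  [/\ measurable A, (P A <= e%:E)%E & forall w, ~ A w -> Phi w].

Lemma whpS e e' Phi Psi : e <= e' -> (forall w, Phi w -> Psi w) ->
  whp e Phi -> whp e' Psi.
Proof.
move=> ee' sub [A [mA PA AP]]; exists A; split => // [|w /AP/sub//].
by rewrite (le_trans PA)// lee_fin.
Qed.

Lemma whp_and e e' Phi Psi : whp e Phi -> whp e' Psi ->
  whp (e + e') (fun w => Phi w /\ Psi w).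
Proof.
move=> [A [mA PA AP]] [B [mB PB BP]]; exists (A `|` B); split.
- exact: measurableU.
- by rewrite (le_trans (measureU2 _ mA mB))// EFinD leeD.
- by move=> w /not_orP[/AP ? /BP ?].
Qed.

Lemma whp_ae e Phi : 0 <= e -> {ae P, forall w, Phi w} -> whp e Phi.
Proof.
move=> e0 [A [mA PA0 sA]]; exists A; split => //.
  by rewrite PA0 lee_fin.
by move=> w nA; apply: contrapT => nP; apply: nA; apply: sA.
Qed.

Lemma whp_true e Phi : 0 <= e -> (forall w, Phi w) -> whp e Phi.
Proof. by move=> e0 h; apply: whp_ae => //; apply: aeW. Qed.

Lemma whp_forall_lt e N (Phi : nat -> Omega -> Prop) : 0 <= e ->
  (forall j, (j < N)%N -> whp e (Phi j)) ->
  whp (e *+ N) (fun w => forall j, (j < N)%N -> Phi j w).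
Proof.
move=> e0; elim: N => [|N IH] h; first by apply: whp_true.
have h1 := IH (fun j jN => h j (ltnW jN)).
apply: whpS (whp_and h1 (h N (ltnSn N))); first by rewrite mulrSr.
move=> w [h2 h3] j; rewrite ltnS leq_eqVlt => /orP[/eqP->//|]; exact: h2.
Qed.

Lemma whp_bound e Phi : measurable [set w | ~ Phi w] -> whp e Phi ->
  (P [set w | ~ Phi w] <= e%:E)%E.
Proof.
move=> mP [A [mA PA AP]]; apply: le_trans PA; apply: le_measure; rewrite ?inE//.
by move=> w /= nP; apply: contrapT => /AP.
Qed.

(* Egorov: a condition which, for almost every outcome, holds for all indices
   far enough, holds with high probability uniformly in the index. *)
Lemma whp_uniform (J : Type) (D : nat -> set J) (Phi : J -> Omega -> Prop) :
  (forall k, D k.+1 `<=` D k) ->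
  (forall i, D 0%N i -> measurable [set w | ~ Phi i w]) ->
  {ae P, forall w, exists k, forall i, D k i -> Phi i w} ->
  forall e, 0 < e -> exists k, forall i, D k i -> whp e (Phi i).
Proof.
move=> decD mPhi aePhi e e0; apply: contrapT => nex.
have monoD k k' : (k <= k')%N -> D k' `<=` D k.
  move=> /subnK <-; elim: (k' - k)%N => [|l IH]//.
  by rewrite addSn; apply: subset_trans IH.
(* One bad index per level: the argument then involves countably many events, although [J] may be
   uncountable. *)
have [f fP] : exists f : nat -> J, forall k, D k (f k) /\ ~ whp e (Phi (f k)).
  have h k : exists i, D k i /\ ~ whp e (Phi i).
    apply: contrapT => nh; apply: nex; exists k => i Dki.
    by apply: contrapT => nw; apply: nh; exists i.
  by exists (fun k => projT1 (cid (h k))) => k; case: cid.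
pose E k := [set w | ~ Phi (f k) w].
have mE k : measurable (E k).
  by apply: mPhi; apply: (monoD 0%N k) => //; case: (fP k).
(* The sets [F k] decrease to the upper limit of the bad events. Each has probability above [e],
   while an outcome in all of them violates the almost sure hypothesis. *)
pose F k := \bigcup_(j in [set j | (k <= j)%N]) E j.
have mF k : measurable (F k) by apply: bigcup_measurable => j _; exact: mE.
have PF k : (e%:E < P (F k))%E.
  rewrite ltNge; apply/negP => PFe; have [_ nw] := fP k; apply: nw.
  exists (F k); split => // w nF; apply: contrapT => nP.
  by apply: nF; exists k => /=.
have F0 : P (\bigcap_k F k) = 0%E.
  apply/eqP; rewrite eq_le measure_ge0 andbT.
  have [A [mA PA0 sA]] := aePhi.
  rewrite -PA0; apply: le_measure; rewrite ?inE//; first exact: bigcapT_measurable.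
  move=> w /= Fw; apply: sA => /= -[k hk].
  have [j /= kj] := Fw k I; apply; apply: hk.
  by apply: (monoD k j) => //; case: (fP j).
have cF : (P \o F) x @[x --> \oo] --> P (\bigcap_k F k).
  apply: nonincreasing_cvg_mu => //.
  - by rewrite (le_lt_trans (probability_le1 _ _))// ltry.
  - exact: bigcapT_measurable.
  - move=> j k jk; apply/subsetPset; apply: bigcup_sub => l /= kl.
    by apply: bigcup_sup => /=; exact: leq_trans kl.
have : (e%:E <= P (\bigcap_k F k))%E.
  rewrite -(cvg_lim _ cF)//; apply: lime_ge.
    by apply/cvg_ex; eexists; exact: cF.
  by apply: nearW => k; apply/ltW/PF.
by rewrite F0 lee_fin leNgt e0.
Qed.

End HighProbability.

Section Filtration.
Context {R : realType} {d : measure_display} {Omega : measurableType d}.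
Variables (P : probability Omega R) (W : R -> Omega -> R).
Local Notation FF := (filtration P W).

Lemma past_sigma_algebra t : sigma_algebra setT (past W t).
Proof. exact: smallest_sigma_algebra. Qed.

Lemma past_mono s t : s <= t -> past W s `<=` past W t.
Proof.
move=> st; apply: sub_sigma_algebra2.
move=> A [r [B [/andP[r0 rs] mB ->]]]; exists r, B.
by rewrite r0 (le_trans rs).
Qed.

Lemma past_measurable t A : brownian P W -> past W t A -> measurable A.
Proof.
move=> hW; apply: smallest_sub.
  split => //.
  - by move=> B mB; rewrite setTD; exact: measurableC.
  - by move=> F mF; exact: bigcupT_measurable.
move=> _ [r [B [/andP[r0 rs] mB ->]]].
by have [mW _ _ _ _] := hW; rewrite -[X in measurable X]setTI; exact: mW.
Qed.

Lemma filtration_sigma_algebra t : sigma_algebra setT (FF t).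
Proof.
have [p0 pC pU] := past_sigma_algebra t.
split.
- split => //; exists set0 => //; rewrite setDv setU0; exact: negligible_set0.
- move=> A [mA [B pB nB]]; rewrite setTD; split; first exact: measurableC.
  exists (~` B); first by rewrite -setTD; exact: pC.
  apply: negligibleS nB => w [[nA nB]|[nB nA]].
    by right; split => //; apply: contrapT.
  by left; split => //; apply: contrapT.
- move=> A hA; split.
    by apply: bigcupT_measurable => k; case: (hA k).
  pose B k := sval (cid2 (hA k).2).
  have [pB nB] : (forall k, past W t (B k)) /\
     forall k, P.-negligible ((A k `\` B k) `|` (B k `\` A k)).
    by split => k; rewrite /B; case: cid2.
  exists (\bigcup_k B k); first exact: pU.
  apply: negligibleS (negligible_bigcup nB) => w [] [[k _ h] nh].
    by exists k => //; left; split => // h'; apply: nh; exists k.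
  by exists k => //; right; split => // h'; apply: nh; exists k.
Qed.

Lemma filtration_mono s t : s <= t -> FF s `<=` FF t.
Proof.
move=> st A [mA [B pB nB]]; split => //; exists B => //; exact: past_mono pB.
Qed.

Definition fmeas (t : R) (X : Omega -> R) : Prop :=
  forall B : set R, measurable B -> FF t (X @^-1` B).

(** The filtration is already a sigma-algebra, so generating one from it changes nothing; closure of
    [fmeas] under the usual operations is transported along this equivalence. *)
Lemma fmeasP t X :
  fmeas t X <-> measurable_fun setT (X : g_sigma_algebraType (FF t) -> R).
Proof.
have E : @measurable _ (g_sigma_algebraType (FF t)) = FF t.
  exact: (sigma_algebra_id (filtration_sigma_algebra t)).
split=> h.
  by move=> _ B mB; rewrite setTI E; exact: h.
by move=> B mB; rewrite -E -[X in measurable X]setTI; apply: h.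
Qed.

Lemma fmeas_mono s t X : s <= t -> fmeas s X -> fmeas t X.
Proof. by move=> st h B /h; exact: filtration_mono. Qed.

Lemma fmeas_measurable t X : fmeas t X -> measurable_fun setT X.
Proof. by move=> h _ B mB; rewrite setTI; case: (h B mB). Qed.

Lemma fmeas_cst t c : fmeas t (fun=> c).
Proof. by apply/fmeasP; exact: measurable_cst. Qed.

Lemma fmeasD t X Y : fmeas t X -> fmeas t Y -> fmeas t (fun w => X w + Y w).
Proof. by move=> /fmeasP hX /fmeasP hY; apply/fmeasP; exact: measurable_funD. Qed.

Lemma fmeasM t X Y : fmeas t X -> fmeas t Y -> fmeas t (fun w => X w * Y w).
Proof. by move=> /fmeasP hX /fmeasP hY; apply/fmeasP; exact: measurable_funM. Qed.

Lemma fmeasB t X Y : fmeas t X -> fmeas t Y -> fmeas t (fun w => X w - Y w).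
Proof. by move=> /fmeasP hX /fmeasP hY; apply/fmeasP; exact: measurable_funB. Qed.

Lemma fmeas_sum t (I : Type) (r : seq I) (p : pred I) (X : I -> Omega -> R) :
  (forall i, p i -> fmeas t (X i)) -> fmeas t (fun w => \sum_(i <- r | p i) X i w).
Proof.
move=> h; elim: r => [|i r IH].
  rewrite [X in fmeas _ X](_ : _ = fun=> 0); first exact: fmeas_cst.
  by apply/funext => w; rewrite big_nil.
case: (boolP (p i)) => pi.
  rewrite [X in fmeas _ X](_ : _ = fun w => X i w + \sum_(i <- r | p i) X i w).
    exact: fmeasD (h _ pi) IH.
  by apply/funext => w; rewrite big_cons pi.
rewrite [X in fmeas _ X](_ : _ = fun w => \sum_(i <- r | p i) X i w)//.
by apply/funext => w; rewrite big_cons (negbTE pi).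
Qed.

Lemma fmeas_comp t (f : R -> R) X : measurable_fun setT f -> fmeas t X ->
  fmeas t (fun w => f (X w)).
Proof. by move=> mf /fmeasP hX; apply/fmeasP; exact: measurableT_comp. Qed.

Lemma fmeas_lim t (X : nat -> Omega -> R) (Y : Omega -> R) :
  (forall k, fmeas t (X k)) -> (forall w, X k w @[k --> \oo] --> Y w) ->
  fmeas t Y.
Proof.
move=> mX cX; apply/fmeasP.
apply: (measurable_fun_cvg (T := g_sigma_algebraType (FF t)) (h := X)) => [k|w _]; last exact: cX.
exact/fmeasP/mX.
Qed.

End Filtration.

(** * Good integrators *)

Section ConvexTestFunction.
Context {R : realType}.
Implicit Types (x y s m h c C : R).

(** Linear growth makes [psi X] integrable as soon as [X] is, while convexity and the quadratic
    behaviour near 0 give a nonnegative remainder of second order. *)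
Definition psi x : R := Num.sqrt (1 + x ^+ 2).

Lemma psi_sqr x : psi x ^+ 2 = 1 + x ^+ 2.
Proof. by rewrite sqr_sqrtr// addr_ge0// sqr_ge0. Qed.

Lemma psi_ge1 x : 1 <= psi x.
Proof. by rewrite -{1}sqrtr1 ler_wsqrtr// lerDl sqr_ge0. Qed.

Lemma psi_gt0 x : 0 < psi x.
Proof. exact: lt_le_trans (psi_ge1 x). Qed.

Lemma psi0 : psi 0 = 1.
Proof. by rewrite /psi expr0n addr0 sqrtr1. Qed.

Lemma psi_ge_norm x : `|x| <= psi x.
Proof. by rewrite -sqrtr_sqr ler_wsqrtr// lerDr. Qed.

Lemma psi_le x : psi x <= 1 + `|x|.
Proof.
rewrite -(@ler_pXn2r _ 2) ?nnegrE ?(ltW (psi_gt0 _)) ?addr_ge0//.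
by rewrite psi_sqr -(real_normK (num_real x)); have := normr_ge0 x; nra.
Qed.

Lemma psi_mono x y : `|x| <= `|y| -> psi x <= psi y.
Proof.
move=> xy; rewrite /psi ler_wsqrtr// lerD2l -(real_normK (num_real x)).
by rewrite -(real_normK (num_real y)) lerXn2r.
Qed.

Lemma psi_continuous : continuous psi.
Proof.
move=> x; apply: continuous_comp; last exact: sqrt_continuous.
by apply: cvgD; [exact: cvg_cst|exact: exprn_continuous].
Qed.

Lemma psi_lip x y : psi (x + y) <= psi x + `|y|.
Proof.
rewrite -(@ler_pXn2r _ 2) ?nnegrE ?(ltW (psi_gt0 _)) ?addr_ge0 ?(ltW (psi_gt0 _))//.
rewrite psi_sqr [leRHS]sqrrD psi_sqr real_normK ?num_real//.
have h : x * y <= psi x * `|y|.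
  by rewrite (le_trans (ler_norm _))// normrM ler_wpM2r// psi_ge_norm.
rewrite sqrrD; move: h; lra.
Qed.

Definition psi_slope x : R := x / psi x.

Lemma psi_slope_continuous : continuous psi_slope.
Proof.
move=> x; apply: cvgM; first exact: cvg_id.
by apply: cvgV; [rewrite gt_eqF// psi_gt0|exact: psi_continuous].
Qed.

Lemma psi_slope_le1 x : `|psi_slope x| <= 1.
Proof.
rewrite normrM normfV (gtr0_norm (psi_gt0 x)) ler_pdivrMr ?psi_gt0// mul1r.
exact: psi_ge_norm.
Qed.

Definition psi_rem m y : R := psi (m + y) - psi m - psi_slope m * y.

Lemma psi_rem0 m : psi_rem m 0 = 0.
Proof. by rewrite /psi_rem addr0 subrr mulr0 subr0. Qed.

(** Rationalisation: [psi_rem m y] is [(psi m * psi (m + y) - (1 + m * (m + y))) / psi m], and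
    multiplying by the conjugate factor leaves exactly [y ^+ 2]. *)
Let den m y := psi m * (psi m * psi (m + y) + 1 + m * (m + y)).

Let den_ge1 m y : 1 <= den m y.
Proof.
have h : `|m * (m + y)| <= psi m * psi (m + y).
  by rewrite normrM ler_pM// psi_ge_norm.
have h2 := psi_ge1 m; have h3 : - (m * (m + y)) <= `|m * (m + y)|.
  by rewrite -normrN ler_norm.
rewrite /den -[leLHS]mulr1 ler_pM//; move: h h3; lra.
Qed.

Let psi_remE m y : psi_rem m y * den m y = y ^+ 2.
Proof.
have -> : psi_rem m y * den m y = (psi m * psi (m + y) - psi m ^+ 2 - m * y)
    * (psi m * psi (m + y) + 1 + m * (m + y)).
  rewrite /psi_rem /psi_slope /den; have : psi m != 0 by rewrite gt_eqF ?psi_gt0.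
  by move=> ?; field.
have -> : psi m ^+ 2 = 1 + m ^+ 2 by rewrite psi_sqr.
have -> : (psi m * psi (m + y) - (1 + m ^+ 2) - m * y) *
    (psi m * psi (m + y) + 1 + m * (m + y)) =
   psi m ^+ 2 * psi (m + y) ^+ 2 - (1 + m * (m + y)) ^+ 2 by ring.
rewrite !psi_sqr; ring.
Qed.

Lemma psi_rem_ge0 m y : 0 <= psi_rem m y.
Proof.
have d0 : 0 < den m y by exact: lt_le_trans (den_ge1 m y).
by rewrite -(pmulr_lge0 _ d0) psi_remE sqr_ge0.
Qed.

Lemma psi_rem_le_sqr m y : psi_rem m y <= y ^+ 2.
Proof. by rewrite -(psi_remE m) ler_peMr ?psi_rem_ge0. Qed.

Lemma psi_rem_le_norm m y : psi_rem m y <= 2 * `|y|.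
Proof.
have h1 := psi_lip m y.
have h2 : - (psi_slope m * y) <= `|y|.
  rewrite -[leRHS]mul1r (le_trans (ler_norm _))// normrN normrM.
  by rewrite ler_wpM2r// psi_slope_le1.
by rewrite /psi_rem; lra.
Qed.

(** Up to constants [y ^+ 2 / (1 + |y|)] is the smaller of y^2 and |y|. It bounds the remainder from
    above at any base point and, as shown here, from below at bounded ones, so it links remainders
    at two unrelated base points. *)
Let psi_rem_ge m y C : `|m| <= C ->
  y ^+ 2 / (1 + `|y|) <= 2 * (1 + C) ^+ 3 * psi_rem m y.
Proof.
move=> mC; have C0 : 0 <= C := le_trans (normr_ge0 _) mC.
have d0 : 0 < den m y by exact: lt_le_trans (den_ge1 m y).
have y1 : 0 < 1 + `|y| by rewrite ltr_pwDl.
rewrite ler_pdivrMr// -(psi_remE m) mulrC.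
rewrite [leRHS](_ : _ = (2 * (1 + C) ^+ 3 * (1 + `|y|)) * psi_rem m y); last by ring.
rewrite ler_wpM2r ?psi_rem_ge0//.
have a1 : psi m <= 1 + C by rewrite (le_trans (psi_le m))// lerD2l.
have b1 : psi (m + y) <= (1 + C) * (1 + `|y|).
  rewrite (le_trans (psi_lip m y))// mulrDr mulr1.
  by rewrite (le_trans (lerD a1 (lexx _)))// lerD2l ler_peMl// lerDl.
have ab : 1 + m * (m + y) <= psi m * psi (m + y).
  rewrite (le_trans (ler_norm _))// -(@ler_pXn2r _ 2) ?nnegrE ?mulr_ge0 ?(ltW (psi_gt0 _))//.
  rewrite real_normK ?num_real// exprMn !psi_sqr -subr_ge0.
  rewrite (_ : _ - _ = y ^+ 2) ?sqr_ge0//; ring.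
have p0 := ltW (psi_gt0 m); have p1 := ltW (psi_gt0 (m + y)).
rewrite /den (@le_trans _ _ (psi m * (2 * (psi m * psi (m + y)))))//.
  by rewrite ler_wpM2l//; move: ab; lra.
have -> : 2 * (1 + C) ^+ 3 * (1 + `|y|) =
  (1 + C) * (2 * ((1 + C) * ((1 + C) * (1 + `|y|)))) by ring.
by rewrite ler_pM ?mulr_ge0// ler_wpM2l// ler_pM.
Qed.

(* The Taylor remainder of psi at a transform is dominated, uniformly in s, by
   the remainder at the martingale itself: this replaces the isometry for
   martingales which need not be square integrable. *)
Lemma psi_rem_transform s m y h c C : `|m| <= C -> `|h| <= c -> c <= 1 ->
  psi_rem s (h * y) <= 8 * c * (1 + C) ^+ 3 * psi_rem m y.
Proof.
move=> mC hc c1; have c0 : 0 <= c := le_trans (normr_ge0 _) hc.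
have h1 : psi_rem s (h * y) <= 4 * c * (y ^+ 2 / (1 + `|y|)).
  have y1 : 0 < 1 + `|y| by rewrite ltr_pwDl.
  (* Small steps use the quadratic bound together with c^2 <= c, large ones the linear bound; both
     are linear in [c]. *)
  rewrite mulrA ler_pdivlMr//; have [yle|ygt] := leP `|y| 1.
    have h2 : psi_rem s (h * y) <= c * y ^+ 2.
      rewrite (le_trans (psi_rem_le_sqr _ _))// exprMn ler_wpM2r ?sqr_ge0//.
      rewrite -real_normK ?num_real// expr2 (@le_trans _ _ (c * 1))//.
        by rewrite ler_pM// (le_trans hc).
      by rewrite mulr1.
    have h3 := psi_rem_ge0 s (h * y).
    have h4 : 0 <= c * y ^+ 2 by rewrite mulr_ge0// sqr_ge0.
    rewrite (@le_trans _ _ (psi_rem s (h * y) * 2))//; last by move: h2 h4; lra.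
    by rewrite ler_wpM2l//; move: yle; lra.
  have h2 : psi_rem s (h * y) <= 2 * (c * `|y|).
    rewrite (le_trans (psi_rem_le_norm _ _))// ler_wpM2l// normrM.
    by rewrite ler_wpM2r.
  rewrite -(real_normK (num_real y)).
  rewrite (@le_trans _ _ (2 * (c * `|y|) * (2 * `|y|)))//.
    by rewrite ler_pM ?psi_rem_ge0 ?(ltW y1)//; move: ygt; lra.
  rewrite [leLHS](_ : _ = 4 * c * `|y| ^+ 2)//; ring.
apply: le_trans h1 _.
have -> : 8 * c * (1 + C) ^+ 3 * psi_rem m y =
  4 * c * (2 * (1 + C) ^+ 3 * psi_rem m y) by ring.
by rewrite ler_wpM2l ?mulr_ge0// psi_rem_ge.
Qed.

End ConvexTestFunction.

Section Expectation.
Context {R : realType} {d : measure_display} {Omega : measurableType d}.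
Variable P : probability Omega R.
Implicit Types X Y : Omega -> R.

Local Notation itg X := (P.-integrable setT (EFin \o (X : Omega -> R))).
Local Notation E X := (\int[P]_w (X w : R)).

Lemma itg_measurable X : itg X -> measurable_fun setT X.
Proof. by move=> /measurable_int /measurable_EFinP. Qed.

Lemma itgD X Y : itg X -> itg Y -> itg (fun w => X w + Y w).
Proof. by move=> iX iY; apply: (integrableD measurableT iX iY). Qed.

Lemma itgB X Y : itg X -> itg Y -> itg (fun w => X w - Y w).
Proof. by move=> iX iY; apply: (integrableB measurableT iX iY). Qed.

Lemma itg_le X Y : measurable_fun setT X -> (forall w, `|X w| <= `|Y w|) ->
  itg Y -> itg X.
Proof.
move=> mX XY iY; apply: (le_integrable measurableT _ _ iY).
  exact/measurable_EFinP.
by move=> w _ /=; rewrite lee_fin.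
Qed.

Lemma itg_cst c : itg (fun=> c).
Proof. exact: finite_measure_integrable_cst. Qed.

Lemma itg_bdM c X Y : measurable_fun setT X -> (forall w, `|X w| <= c) ->
  itg Y -> itg (fun w => X w * Y w).
Proof.
move=> mX Xc iY; apply: (@itg_le _ (fun w => c * Y w)).
- by apply: measurable_funM => //; exact: itg_measurable.
- move=> w; rewrite !normrM ler_wpM2r// (le_trans (Xc w))//; exact: ler_norm.
- have := integrableZl measurableT c iY.
  by rewrite (_ : (fun x => _) = EFin \o (fun w => c * Y w))//.
Qed.

Lemma E_D X Y : itg X -> itg Y -> E (fun w => X w + Y w) = E X + E Y.
Proof. by move=> *; exact: RintegralD. Qed.

Lemma E_B X Y : itg X -> itg Y -> E (fun w => X w - Y w) = E X - E Y.
Proof. by move=> *; exact: RintegralB. Qed.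

Lemma E_le X Y : itg X -> itg Y -> (forall w, X w <= Y w) -> E X <= E Y.
Proof. by move=> *; apply: le_Rintegral. Qed.

Lemma E_cst c : E (fun=> c) = c.
Proof. by rewrite Rintegral_cst//= [X in fine X](_ : _ = 1%E) ?mulr1//; exact: probability_setT. Qed.

Lemma E_Z c X : itg X -> E (fun w => c * X w) = c * E X.
Proof. by move=> *; exact: RintegralZl. Qed.

Lemma itgZ c X : itg X -> itg (fun w => c * X w).
Proof.
by move=> iX; apply: (@itg_bdM `|c|) => //; exact: measurable_cst.
Qed.

Lemma whp_markov X e lam : itg X -> (forall w, 0 <= X w) -> 0 < lam ->
  E X <= lam * e -> whp P e (fun w => X w < lam).
Proof.
move=> iX X0 l0 EX; have mX := itg_measurable iX.
exists [set w | lam <= X w]; split.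
- exact: measurable_set_le.
- have := @le_integral_comp_abse _ _ _ P setT measurableT (EFin \o X) lam id
    (@measurable_id _ _ _) (fun r h => h) (fun x y _ _ h => h).
  move=> /(_ ((measurable_EFinP _ _).2 mX) l0).
  have -> : ([set: Omega] `&` [set x | (lam%:E <= `|(EFin \o X) x|)%E]) = [set w | lam <= X w].
    by rewrite setTI; apply/seteqP; split => w /=; rewrite ger0_norm.
  have -> : (\int[P]_(x in setT) `|(EFin \o X) x| = (E X)%:E)%E.
    rewrite /Rintegral fineK.
      by apply: eq_integral => w _ /=; rewrite ger0_norm.
    exact: integrable_fin_num.
  move=> h; rewrite -(@lee_pmul2l _ lam%:E)//; apply: (le_trans h).
  by rewrite -EFinM lee_fin.
- by move=> w /= /negP; rewrite -ltNge.
Qed.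

End Expectation.

(** * Orthogonality of martingale increments to bounded weights from the past *)

Section Orthogonality.
Context {R : realType} {d : measure_display} {Omega : measurableType d}.
Variables (P : probability Omega R) (W : R -> Omega -> R) (T : R).
Local Notation itg X := (P.-integrable setT (EFin \o (X : Omega -> R))).
Local Notation E X := (\int[P]_w (X w : R)).
Local Notation fm := (fmeas P W).

Lemma fmeas_indic t A : filtration P W t A -> fm t (\1_A : Omega -> R).
Proof.
move=> FA; apply/fmeasP; apply: measurable_indic.
apply: sub_sigma_algebra; exact: FA.
Qed.

Lemma filtration_setT t : filtration P W t setT.
Proof.
have [f0 fC _] := filtration_sigma_algebra P W t.
by have := fC _ f0; rewrite setTD setC0.
Qed.

Section Increment.
Variables (X : R -> Omega -> R) (s t : R).
Hypotheses (mX : martingale P W T X) (s0 : 0 <= s) (st : s <= t) (tT : t <= T).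
Let D w := X t w - X s w.

Lemma martingale_increment_itg : itg D.
Proof.
have [_ iX _] := mX; apply: itgB; apply: iX.
  by rewrite tT (le_trans s0 st).
by rewrite s0 (le_trans st).
Qed.

Lemma martingale_orth_indic A : filtration P W s A ->
  E (fun w => \1_A w * D w) = 0.
Proof.
move=> FA; have [_ iX eX] := mX; have [mA _] := FA.
have it : itg (X t) by apply: iX; rewrite tT (le_trans s0 st).
have is_ : itg (X s) by apply: iX; rewrite s0 (le_trans st).
have -> : E (fun w => \1_A w * D w) = \int[P]_(w in A) D w.
  rewrite [RHS]Rintegral_mkcond; apply: eq_Rintegral => w _.
  rewrite patchE indicE; case: ifP => _; rewrite ?mul1r ?mul0r//.
rewrite RintegralB//; first last.
- by apply: (integrableS measurableT).
- by apply: (integrableS measurableT).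
by rewrite /Rintegral (eX s t A)// subrr.
Qed.

(** The definition of [martingale] tests events only. So [xi + c], which is nonnegative, is rounded
    down to multiples of [1 / k]; the resulting step function is a combination of indicators of past
    events, and [k] tends to infinity. *)
Lemma martingale_orth c (xi : Omega -> R) : fm s xi ->
  (forall w, `|xi w| <= c) -> E (fun w => xi w * D w) = 0.
Proof.
move=> mxi xic; have iD := martingale_increment_itg.
have mxi' : measurable_fun setT xi by exact: fmeas_measurable mxi.
have c0 : 0 <= c by exact: le_trans (normr_ge0 _) (xic point).
pose K := E (fun w => `|D w|).
have iN : itg (fun w => `|D w|).
  apply: (@itg_le _ _ _ _ _ D) => //.
    by apply: measurableT_comp => //; exact: itg_measurable iD.
  by move=> w; rewrite normr_id.
have key k : (0 < k)%N -> `|E (fun w => xi w * D w)| <= k%:R^-1 * K.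
  move=> k0; have k0' : (0 : R) < k%:R by rewrite ltr0n.
  pose A v := [set w | v%:R <= k%:R * (xi w + c) < v.+1%:R].
  have FA v : filtration P W s (A v).
    have -> : A v = (fun w => k%:R * (xi w + c)) @^-1` `[v%:R, v.+1%:R[%classic.
      by apply/seteqP; split => w /=; rewrite in_itv.
    have h : fm s (fun w => k%:R * (xi w + c)).
      apply: fmeasM => //; first exact: fmeas_cst.
      by apply: fmeasD => //; exact: fmeas_cst.
    by apply: h; exact: measurable_itv.
  pose m n w : R := \sum_(v < n) v%:R * \1_(A v) w.
  have mm n : measurable_fun setT (m n).
    apply: (@fmeas_measurable _ _ _ P W s).
    apply: fmeas_sum => // v _; apply: fmeasM => //; first exact: fmeas_cst.
    exact: fmeas_indic.
  have mb n w : `|m n w| <= \sum_(v < n) v%:R.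
    rewrite (le_trans (ler_norm_sum _ _ _))// ler_sum// => v _.
    rewrite normrM indicE; case: (_ \in _); rewrite ?normr1 ?normr0 ?mulr1 ?mulr0//.
    by rewrite normr_nat.
  have Em n : E (fun w => m n w * D w) = 0.
    elim: n => [|n IH].
      rewrite -[RHS](E_cst P); apply: eq_Rintegral => w _.
      by rewrite /m big_ord0 mul0r.
    have -> : E (fun w => m n.+1 w * D w) =
              E (fun w => m n w * D w + n%:R * (\1_(A n) w * D w)).
      apply: eq_Rintegral => w _; rewrite /m big_ord_recr/=; ring.
    have iA : itg (fun w => \1_(A n) w * D w).
      apply: (@itg_bdM _ _ _ _ 1) => //.
        by apply: (@fmeas_measurable _ _ _ P W s); apply: fmeas_indic.
      by move=> w; rewrite indicE; case: (_ \in _); rewrite ?normr1 ?normr0.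
    rewrite E_D ?E_Z//; first by rewrite IH martingale_orth_indic// mulr0 addr0.
      exact: itg_bdM (mm n) (mb n) iD.
    exact: itgZ.
  (* Since [xi + c] is at most [2 c], this number of levels covers all its values. *)
  pose n := (Num.truncn (k%:R * (c + c))).+1.
  have mE w : `|k%:R^-1 * m n w - (xi w + c)| <= k%:R^-1.
    have [x1 x2] : - c <= xi w /\ xi w <= c.
      by have := xic w; rewrite ler_norml => /andP[].
    set y := k%:R * (xi w + c).
    have y0 : 0 <= y by rewrite mulr_ge0//; lra.
    pose u := Num.truncn y.
    have uy : u%:R <= y < u.+1%:R by exact: truncn_itv.
    have un : (u < n)%N by rewrite ltnS le_truncn// ler_wpM2l//; lra.
    have -> : m n w = u%:R.
      rewrite /m (bigD1 (Ordinal un))//= indicE mem_set// mulr1 big1 ?addr0//.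
      move=> v vu; rewrite indicE memNset ?mulr0// => /= /andP[v1 v2].
      case/andP: uy => u1 u2; case/negP: vu; apply/eqP/val_inj => /=.
      apply/eqP; rewrite eqn_leq -[(v <= u)%N]ltnS -[(u <= v)%N]ltnS -!(ltr_nat R).
      by rewrite (le_lt_trans v1 u2) (le_lt_trans u1 v2).
    have -> : k%:R^-1 * u%:R - (xi w + c) = k%:R^-1 * (u%:R - y).
      by rewrite mulrBr /y mulrA mulVf ?mul1r// gt_eqF.
    rewrite normrM gtr0_norm ?invr_gt0// ler_piMr ?invr_ge0 ?ler0n//.
    by case/andP: uy; rewrite -natr1 ler_norml => *; apply/andP; split; lra.
  have i1 : itg (fun w => xi w * D w) by exact: itg_bdM mxi' xic iD.
  have i2 : itg (fun w => m n w * D w) by exact: itg_bdM (mm n) (mb n) iD.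
  (* The shift of [xi] by [c] costs nothing because the increment has mean zero. *)
  have ED : E D = 0.
    rewrite -[RHS](@martingale_orth_indic setT); last exact: filtration_setT.
    by apply: eq_Rintegral => w _; rewrite indicT mul1r.
  have -> : E (fun w => xi w * D w) =
     E (fun w => - (k%:R^-1 * m n w - (xi w + c)) * D w).
    have -> : E (fun w => - (k%:R^-1 * m n w - (xi w + c)) * D w) =
       E (fun w => (xi w * D w + c * D w) - k%:R^-1 * (m n w * D w)).
      apply: eq_Rintegral => w _; ring.
    rewrite E_B ?E_D ?E_Z ?Em ?ED ?mulr0 ?subr0 ?addr0//; try exact: itgZ.
    by apply: itgD => //; exact: itgZ.
  have i3 : itg (fun w => - (k%:R^-1 * m n w - (xi w + c)) * D w).
    apply: (@itg_bdM _ _ _ _ k%:R^-1) => //; last by move=> w; rewrite normrN.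
    apply: measurable_funN; apply: measurable_funB.
      by apply: measurable_funM => //; exact: mm.
    exact: measurable_funD.
  rewrite (le_trans (le_normr_Rintegral measurableT i3))// -E_Z//.
  apply: E_le => //; last by move=> w; rewrite normrM normrN ler_wpM2r.
    apply: (itg_le _ _ i3); last by move=> w; rewrite normr_id.
    by apply: measurableT_comp => //; exact: itg_measurable i3.
  exact: itgZ.
apply/eqP; rewrite -normr_le0; apply/ler_addgt0Pr => e e0; rewrite add0r.
have K0 : 0 <= K by apply: Rintegral_ge0.
pose k := (Num.truncn (K / e)).+1.
apply: le_trans (key k _) _ => //.
rewrite ler_pdivrMl ?ltr0n// -ler_pdivrMr// ltW//.
by have /andP[] : (Num.truncn (K / e))%:R <= K / e < k%:R by apply: truncn_itv; rewrite divr_ge0// ltW.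
Qed.

End Increment.

End Orthogonality.

(** * Transforms along grids, and martingales as good integrators *)

Section GoodIntegrators.
Context {R : realType} {d : measure_display} {Omega : measurableType d}.
Variables (P : probability Omega R) (W : R -> Omega -> R) (T : R).
Local Notation itg X := (P.-integrable setT (EFin \o (X : Omega -> R))).
Local Notation E X := (\int[P]_w (X w : R)).
Local Notation fm := (fmeas P W).
Implicit Types (S X Y : R -> Omega -> R) (p : nat -> R) (h : nat -> Omega -> R).

Definition grid (t : R) (N : nat) p : Prop :=
  [/\ p 0%N = 0, p N = t & forall j, (j < N)%N -> p j < p j.+1].

Lemma grid_le t N p i j : grid t N p -> (i <= j <= N)%N -> p i <= p j.
Proof.
move=> [_ _ inc] /andP[/subnK <-]; elim: (j - i)%N => [|k IH]//=.
by rewrite addSn => kN; apply: le_trans (IH (ltnW kN)) _; exact/ltW/inc.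
Qed.

Lemma grid_itv t N p j : grid t N p -> (j <= N)%N -> 0 <= p j <= t.
Proof.
move=> g jN; have [p0 pN _] := g; apply/andP; split.
  by rewrite -[leLHS]p0; apply: (grid_le g).
by rewrite -[leRHS]pN; apply: (grid_le g); rewrite jN leqnn.
Qed.

Lemma grid_itvT t N p j : grid t N p -> t <= T -> (j <= N)%N -> 0 <= p j <= T.
Proof.
by move=> g tT jN; case/andP: (grid_itv g jN) => -> h; rewrite (le_trans h).
Qed.

Definition transform h S p (M : nat) (w : Omega) : R :=
  \sum_(j < M) h j w * (S (p j.+1) w - S (p j) w).

(* a quantitative form of the good integrators of Bichteler and Dellacherie *)
Definition good S : Prop := forall e e' : R, 0 < e -> 0 < e' ->
  exists2 c : R, 0 < c & forall t N p h, t <= T -> grid t N p ->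
    (forall j, (j < N)%N -> fm (p j) (h j)) ->
    (forall j w, (j < N)%N -> `|h j w| <= c) ->
    whp P e' (fun w => forall M, (M <= N)%N -> `|transform h S p M w| < e).

Lemma adapted_fm X s : adapted P W T X -> 0 <= s <= T -> fm s (X s).
Proof. by move=> aX sT B; exact: aX. Qed.

Lemma fmeas_transform h S t N p M j : adapted P W T S -> t <= T -> grid t N p ->
  (forall i, (i < N)%N -> fm (p i) (h i)) -> (M <= j <= N)%N ->
  fm (p j) (transform h S p M).
Proof.
move=> aS tT g ah /andP[Mj jN]; apply: fmeas_sum => i _.
have iN : (i < N)%N by rewrite (leq_trans (ltn_ord i))// (leq_trans Mj).
have ij : (i < j)%N by rewrite (leq_trans (ltn_ord i)).
apply: fmeasM.
  by apply: fmeas_mono (ah _ iN); rewrite (grid_le g)// (ltnW ij).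
apply: fmeasB; [apply: (@fmeas_mono _ _ _ _ _ (p i.+1))|
                apply: (@fmeas_mono _ _ _ _ _ (p i))].
- by rewrite (grid_le g)// ij.
- by apply: adapted_fm => //; exact: (grid_itvT g).
- by rewrite (grid_le g)// (ltnW ij).
- by apply: adapted_fm => //; apply: (grid_itvT g) => //; exact: ltnW.
Qed.

Lemma fmeas_prod t (n : nat) (X : nat -> Omega -> R) :
  (forall i, (i < n)%N -> fm t (X i)) -> fm t (fun w => \prod_(i < n) X i w).
Proof.
elim: n => [|n IH] h.
  rewrite [X in fm _ X](_ : _ = fun=> 1); first exact: fmeas_cst.
  by apply/funext => w; rewrite big_ord0.
rewrite [X in fm _ X](_ : _ = fun w => (\prod_(i < n) X i w) * X n w).
  by apply: fmeasM; [apply: IH => i ni; apply: h; exact: ltnW|exact: h].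
by apply/funext => w; rewrite big_ord_recr.
Qed.

Lemma measurable_lt_indicator (e : R) :
  measurable_fun setT (fun x : R => (`|x| < e)%R%:R : R).
Proof.
rewrite (_ : (fun x => _) = \1_[set y : R | (`|y| < e)%R]).
  by apply: measurable_indic; apply: measurable_set_lt => //; exact: normr_measurable.
apply/funext => x; rewrite indicE; case: (ltP `|x| e) => h.
  by rewrite mem_set.
by rewrite memNset//=; apply/negP; rewrite -leNgt.
Qed.

Lemma measurable_le_indicator (e : R) :
  measurable_fun setT (fun x : R => (`|x| <= e)%R%:R : R).
Proof.
rewrite (_ : (fun x => _) = \1_[set y : R | (`|y| <= e)%R]).
  by apply: measurable_indic; apply: measurable_set_le => //; exact: normr_measurable.
apply/funext => x; rewrite indicE; case: (leP `|x| e) => h.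
  by rewrite mem_set.
by rewrite memNset//=; apply/negP; rewrite -ltNge.
Qed.

(* Stopping the weights when the running sum first exceeds e gives the
   maximal inequality from the bound on the terminal sum. *)
Lemma good_terminal S : adapted P W T S ->
  (forall e e' : R, 0 < e -> 0 < e' ->
  exists2 c : R, 0 < c & forall t N p h, t <= T -> grid t N p ->
    (forall j, (j < N)%N -> fm (p j) (h j)) ->
    (forall j w, (j < N)%N -> `|h j w| <= c) ->
    whp P e' (fun w => `|transform h S p N w| < e)) -> good S.
Proof.
move=> aS gS e e' e0 e'0; have [c c0 gc] := gS e e' e0 e'0.
exists c => // t N p h tT g ah bh.
pose G M w := transform h S p M w.
(* The product runs over [i <= j]: these [G i] are known at time [p j], so [k j] is adapted, and it
   vanishes from the first index whose sum reaches [e], that index included. *)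
pose k j w : R := h j w * \prod_(i < j.+1) (`|G i w| < e)%R%:R.
have prod01 n w : \prod_(i < n) (`|G i w| < e)%R%:R =
    [forall i : 'I_n, (`|G i w| < e)%R]%:R :> R.
  case: (boolP [forall _, _]) => [/forallP hh|/forallPn[i /negbTE hi]].
    by rewrite big1// => i _; rewrite hh.
  by rewrite (bigD1 i)//= hi mul0r.
have wk : whp P e' (fun w => `|transform k S p N w| < e).
  apply: (gc t N p k tT g) => [j jN|j w jN].
    apply: fmeasM; first exact: ah.
    apply: (fmeas_prod (n := j.+1)(X := fun i w => (`|G i w| < e)%R%:R)) => i ij.
    apply: (fmeas_comp (f := fun x => (`|x| < e)%R%:R)).
      exact: measurable_lt_indicator.
    by apply: (fmeas_transform (t := t) (N := N) (M := i)) => //; rewrite -ltnS ij ltnW.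
  rewrite /k prod01 normrM; case: [forall _, _]; rewrite ?normr1 ?mulr1 ?bh//.
  by rewrite normr0 mulr0 (le_trans _ (bh j w jN)).
apply: whpS (lexx _) _ wk => w kw M MN; rewrite ltNge; apply/negP => eG.
have ex : exists M, (e <= `|G M w|) by exists M.
have [m em mmin] := ex_minnP ex.
have mM : (m <= N)%N by rewrite (leq_trans _ MN)// mmin.
have hl i : (i < m)%N -> `|G i w| < e.
  by move=> im; rewrite ltNge; apply/negP => /mmin; rewrite leqNgt im.
suff E' : transform k S p N w = G m w by move: kw; rewrite E' ltNge em.
rewrite /transform -(subnKC mM) big_split_ord/= [X in _ + X]big1 ?addr0.
  apply: eq_bigr => i _; congr (_ * _).
  rewrite /k prod01 (_ : [forall _, _] = true) ?mulr1//.
  by apply/forallP => l; rewrite hl// (leq_ltn_trans _ (ltn_ord i))// -ltnS.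
move=> i _; rewrite /k prod01 (_ : [forall _, _] = false) ?mulr0 ?mul0r//.
apply/negbTE/forallPn; have mi : (m < (m + i).+1)%N by rewrite ltnS leq_addr.
by exists (Ordinal mi); rewrite -leNgt.
Qed.

Definition as_bounded X : Prop :=
  {ae P, forall w, exists C : R, forall s, 0 <= s <= T -> `|X s w| <= C}.

(** [whp_uniform] is applied to pairs of an integer bound and a grid, so that one bound serves all
    grids. Finiteness of a grid makes each event measurable. *)
Lemma as_bounded_whp X : (forall s, 0 <= s <= T -> measurable_fun setT (X s)) ->
  as_bounded X -> forall e, 0 < e -> exists2 C : R, 0 < C &
    forall t N p, t <= T -> grid t N p ->
      whp P e (fun w => forall j, (j <= N)%N -> `|X (p j) w| <= C).
Proof.
move=> mX bX e e0.
pose J := (nat * (R * nat * (nat -> R)))%type.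
pose D (k : nat) : set J := [set i | (k <= i.1)%N /\
   (i.2.1.1 <= T /\ grid i.2.1.1 i.2.1.2 i.2.2)].
pose Phi (i : J) w := forall j, (j <= i.2.1.2)%N ->
   `|X (i.2.2 j) w| <= i.1%:R.
have [k kP] : exists k, forall i, D k i -> whp P e (Phi i).
  apply: whp_uniform => //.
  - by move=> k [l i] [kl h]; split => //; exact: ltnW.
  - move=> [l [[t N] p]] [_ /= [tT g]].
    have -> : [set w | ~ Phi (l, (t, N, p)) w] =
        \bigcup_(j in `I_N.+1) [set w | l%:R < `|X (p j) w|].
      apply/seteqP; split => w /=.
        move=> /existsNP[j /not_implyP[jN /negP]]; rewrite -ltNge => h.
        by exists j.
      by move=> [j jN /= h] /(_ j jN); rewrite leNgt h.
    apply: bigcup_measurable => j /= jN; apply: measurable_set_lt => //; apply: measurableT_comp => //.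
    by apply: mX; exact: (grid_itvT g).
  - case: bX => A [mA PA0 sA]; exists A; split => // w /= nh.
    apply: sA => /= -[C hC]; apply: nh.
    exists (Num.truncn C).+1 => -[l [[t N] p]] [/= kl [tT g]] j jN.
    rewrite (le_trans (hC _ (grid_itvT g tT jN)))//.
    rewrite (@le_trans _ _ (Num.truncn C).+1%:R) ?ler_nat//.
    by rewrite ltW// truncnS_gt.
exists k.+1%:R => [|t N p tT g]; first by rewrite ltr0n.
by apply: (kP (k.+1, (t, N, p))); split => //=; exact: leqnSn.
Qed.

(** First-order terms are orthogonal, so the expectations of [psi (G M)] and of [psi (X (p M))] grow
    exactly by expected remainders. By [psi_rem_transform] the growth for the transform is at most
    [kap] times that for [X], which the expectation of [psi (X T)] bounds. As [kap] is proportional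
    to [c], Markov's inequality for [psi (G N) - 1] concludes. *)
Lemma martingale_good X : 0 <= T -> martingale P W T X -> as_bounded X -> good X.
Proof.
move=> T0 mX bX; have [aX iX _] := mX; apply: good_terminal => // e e' e0 e'0.
have mXs s : 0 <= s <= T -> measurable_fun setT (X s).
  by move=> sT; apply: fmeas_measurable (adapted_fm aX sT).
have [C C0 hC] := as_bounded_whp mXs bX (divr_gt0 e'0 (ltr0n R 2)).
have psi_m : measurable_fun setT (psi : R -> R).
  by apply: continuous_measurable_fun; exact: psi_continuous.
have slope_m : measurable_fun setT (psi_slope : R -> R).
  by apply: continuous_measurable_fun; exact: psi_slope_continuous.
have ipsi (Y : Omega -> R) : itg Y -> itg (fun w => psi (Y w)).
  move=> iY; apply: (@itg_le _ _ _ _ _ (fun w => 1 + `|Y w|)).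
  - by apply: measurableT_comp => //; exact: itg_measurable iY.
  - move=> w; rewrite gtr0_norm ?psi_gt0// (le_trans (psi_le _))//.
    exact: ler_norm.
  - apply: itgD; first exact: itg_cst.
    apply: (itg_le _ _ iY); last by move=> w; rewrite normr_id.
    by apply: measurableT_comp => //; exact: itg_measurable iY.
pose K := E (fun w => psi (X T w)).
have TT : 0 <= T <= T by rewrite T0 lexx.
have K1 : 1 <= K.
  rewrite -{1}(E_cst P 1); apply: E_le; [exact: itg_cst|exact/ipsi/iX|].
  by move=> w; exact: psi_ge1.
have K0 : 0 < K by exact: lt_le_trans K1.
(* [psi] increases with the absolute value, so [|x| >= e] forces [psi x - 1 >= lam]. *)
pose lam : R := psi e - 1.
have lam0 : 0 < lam.
  rewrite subr_gt0 -(@ltr_pXn2r _ 2) ?nnegrE ?(ltW (psi_gt0 _))//.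
  by rewrite psi_sqr expr1n ltrDl exprn_gt0.
pose q := 8 * (1 + C) ^+ 3 * K.
have C13 : 0 < (1 + C) ^+ 3 by rewrite exprn_gt0// addr_gt0.
have q0 : 0 < q by rewrite mulr_gt0// mulr_gt0.
(* The bound 1 is demanded by [psi_rem_transform]. The other one gives
   [kap * K = c * q <= lam * (e' / 2)], the input of Markov's inequality. *)
pose c := Num.min 1 (lam * (e' / 2) / q).
have c0 : 0 < c by rewrite lt_min ltr01 divr_gt0// mulr_gt0// divr_gt0.
exists c => // t N p h tT g ah bh.
have pT j : (j <= N)%N -> 0 <= p j <= T by exact: (grid_itvT g).
pose N' j := X (p j); pose dN j w := X (p j.+1) w - X (p j) w.
have idN j : (j < N)%N -> itg (dN j).
  move=> jN; apply: itgB; apply: iX; apply: pT => //; exact: ltnW.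
(* The comparison of remainders needs a bounded base point, so steps starting outside [[-C, C]] are
   dropped; with high probability there are none. *)
pose k j w : R := h j w * (`|X (p j) w| <= C)%R%:R.
have fk j : (j < N)%N -> fm (p j) (k j).
  move=> jN; apply: fmeasM; first exact: ah.
  apply: (fmeas_comp (f := fun x => (`|x| <= C)%R%:R)).
    exact: measurable_le_indicator.
  by apply: adapted_fm => //; apply: pT; exact: ltnW.
have bk j w : (j < N)%N -> `|k j w| <= c.
  move=> jN; rewrite normrM; case: (_ <= C); rewrite ?normr1 ?mulr1 ?bh//.
  by rewrite normr0 mulr0 ltW.
pose G M w := transform k X p M w.
have fG M : (M <= N)%N -> fm (p M) (G M).
  by move=> MN; apply: (fmeas_transform (t := t) (N := N)) => //; rewrite leqnn.
have itk j : (j < N)%N -> itg (fun w => k j w * dN j w).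
  move=> jN; apply: (@itg_bdM _ _ _ _ c) => //; last exact: idN.
    exact: fmeas_measurable (fk j jN).
  by move=> w; exact: bk.
have iG M : (M <= N)%N -> itg (G M).
  elim: M => [|M IH] MN.
    rewrite (_ : G 0%N = fun=> 0); first exact: itg_cst.
    by apply/funext => w; rewrite /G /transform big_ord0.
  rewrite (_ : G M.+1 = fun w => G M w + k M w * dN M w).
    by apply: itgD; [apply: IH; exact: ltnW|exact: itk].
  by apply/funext => w; rewrite /G /transform big_ord_recr.
have slope_b x : `|psi_slope x| <= 1 :> R by exact: psi_slope_le1.
have irem (Y : Omega -> R) i : (i < N)%N -> itg Y ->
    itg (fun w => psi_slope (Y w) * dN i w).
  move=> iN iY; apply: (@itg_bdM _ _ _ _ 1) => //; last exact: idN.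
  by apply: measurableT_comp => //; exact: itg_measurable iY.
have orth M (xi : Omega -> R) b : (M < N)%N -> fm (p M) xi ->
    (forall w, `|xi w| <= b) -> E (fun w => xi w * dN M w) = 0.
  move=> MN fxi bxi.
  have /andP[s0 _] := pT M (ltnW MN); have /andP[_ sT] := pT M.+1 MN.
  apply: (martingale_orth mX s0 _ sT fxi bxi).
  by have [_ _ inc] := g; exact/ltW/inc.
pose kap := 8 * c * (1 + C) ^+ 3.
have kap0 : 0 <= kap by apply/ltW; rewrite mulr_gt0// mulr_gt0.
have step M : (M <= N)%N ->
    E (fun w => psi (G M w)) <=
    1 + kap * (E (fun w => psi (X (p M) w)) - E (fun w => psi (X (p 0%N) w))).
  elim: M => [|M IH] MN.
    rewrite subrr mulr0 addr0 -[leRHS](E_cst P 1); apply: E_le.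
    - exact/ipsi/iG.
    - exact: itg_cst.
    - by move=> w; rewrite /G /transform big_ord0 psi0.
  have MN' := ltnW MN.
  have iXM : itg (X (p M)) by apply: iX; exact: pT.
  have iXM1 : itg (X (p M.+1)) by apply: iX; exact: pT.
  pose r w := psi_rem (X (p M) w) (dN M w).
  have rE w : r w = psi (X (p M.+1) w) - psi (X (p M) w)
     - psi_slope (X (p M) w) * dN M w.
    by rewrite /r /psi_rem [X (p M) w + _]addrC subrK.
  have ir : itg r.
    rewrite (_ : r = fun w => psi (X (p M.+1) w) - psi (X (p M) w)
     - psi_slope (X (p M) w) * dN M w); last by apply/funext.
    apply: itgB; last exact: irem.
    by apply: itgB; exact: ipsi.
  have Er : E r = E (fun w => psi (X (p M.+1) w)) - E (fun w => psi (X (p M) w)).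
    rewrite (_ : r = fun w => psi (X (p M.+1) w) - psi (X (p M) w)
     - psi_slope (X (p M) w) * dN M w); last by apply/funext.
    rewrite E_B ?E_B; try exact: ipsi; last 2 first.
    - by apply: itgB; exact: ipsi.
    - exact: irem.
    rewrite (orth M (fun w => psi_slope (X (p M) w)) 1) ?subr0//.
    by apply: fmeas_comp => //; apply: adapted_fm => //; exact: pT.
  have le w : psi (G M.+1 w) <=
      psi (G M w) + ((psi_slope (G M w) * k M w) * dN M w + kap * r w).
    have -> : G M.+1 w = G M w + k M w * dN M w.
      by rewrite /G /transform big_ord_recr.
    rewrite -lerBlDl -lerBlDl -mulrA -/(psi_rem (G M w) (k M w * dN M w)).
    rewrite /k; case: (leP `|X (p M) w| C) => XC; last first.
      rewrite mulr0 mul0r psi_rem0 mulr_ge0//; exact: psi_rem_ge0.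
    rewrite mulr1; apply: psi_rem_transform => //; first exact: bh.
    by rewrite ge_min lexx.
  have fxi : fm (p M) (fun w => psi_slope (G M w) * k M w).
    by apply: fmeasM; [apply: fmeas_comp => //; exact: fG|exact: fk].
  have bxi w : `|psi_slope (G M w) * k M w| <= c.
    by rewrite normrM -[leRHS]mul1r ler_pM// bk.
  have i1 : itg (fun w => (psi_slope (G M w) * k M w) * dN M w).
    apply: (@itg_bdM _ _ _ _ c) => //; last exact: idN.
    exact: fmeas_measurable fxi.
  have i2 : itg (fun w => psi_slope (G M w) * k M w * dN M w + kap * r w).
    by apply: itgD => //; exact: itgZ.
  have := E_le (ipsi _ (iG _ MN)) (itgD (ipsi _ (iG _ MN')) i2) le.
  rewrite E_D//; last exact/ipsi/iG.
  rewrite E_D ?E_Z//; last exact: itgZ.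
  rewrite (orth M _ c MN fxi bxi) add0r Er => h1.
  apply: le_trans h1 _; have := IH MN'; lra.
(* [psi X] is a submartingale: the remainder between [p N] and [T] is nonnegative and its linear
   term has mean zero. *)
have EXT : E (fun w => psi (X (p N) w)) <= K.
  have /andP[pN0 pNT] := pT N (leqnn N).
  have iXN : itg (X (p N)) by apply: iX; rewrite pN0.
  have iXT : itg (X T) by exact: iX.
  have iD : itg (fun w => X T w - X (p N) w) by exact: itgB.
  have i1 : itg (fun w => psi_slope (X (p N) w) * (X T w - X (p N) w)).
    apply: (@itg_bdM _ _ _ _ 1) => //.
    by apply: measurableT_comp => //; exact: itg_measurable iXN.
  have o1 : E (fun w => psi_slope (X (p N) w) * (X T w - X (p N) w)) = 0.
    apply: (martingale_orth mX pN0 pNT (lexx T) _ (c := 1)) => //.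
    by apply: fmeas_comp => //; apply: adapted_fm => //; rewrite pN0.
  rewrite -[leLHS]addr0 -o1 -E_D//; last exact: ipsi.
  apply: E_le; [|exact: ipsi|].
    by apply: itgD => //; exact: ipsi.
  move=> w; have := psi_rem_ge0 (X (p N) w) (X T w - X (p N) w).
  by rewrite /psi_rem [X (p N) w + _]addrC subrK; lra.
have EG : E (fun w => psi (G N w) - 1) <= lam * (e' / 2).
  rewrite E_B ?E_cst; [|exact/ipsi/iG|exact: itg_cst].
  have h0 : 1 <= E (fun w => psi (X (p 0%N) w)).
    rewrite -{1}(E_cst P 1); apply: E_le; [exact: itg_cst| |].
      by apply: ipsi; apply: iX; exact: pT.
    by move=> w; exact: psi_ge1.
  rewrite lerBlDl (le_trans (step N (leqnn N)))// lerD2l.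
  rewrite (@le_trans _ _ (kap * K))//; first by rewrite ler_wpM2l//; lra.
  have -> : kap * K = c * q by rewrite /kap /q; ring.
  by rewrite -ler_pdivlMr// ge_min lexx orbT.
have w1 : whp P (e' / 2) (fun w => psi (G N w) - 1 < lam).
  apply: whp_markov EG => //.
    by apply: itgB; [exact/ipsi/iG|exact: itg_cst].
  by move=> w; rewrite subr_ge0 psi_ge1.
have := whp_and w1 (hC t N p tT g); apply: whpS.
  by rewrite -splitr.
move=> w [h1 h2].
have -> : transform h X p N w = G N w.
  apply: eq_bigr => j _; congr (_ * _); rewrite /k.
  by rewrite h2 ?mulr1// ltnW.
rewrite ltNge; apply/negP => eG; move: h1; rewrite ltNge => /negP; apply.
by rewrite /lam lerD2r; apply: psi_mono; rewrite gtr0_norm.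
Qed.

End GoodIntegrators.

(** * Semimartingales as good integrators *)

Section GoodIntegratorExamples.
Context {R : realType} {d : measure_display} {Omega : measurableType d}.
Variables (P : probability Omega R) (W : R -> Omega -> R) (T : R).
Hypothesis T0 : 0 < T.
Local Notation fm := (fmeas P W).
Local Notation good := (good P W T).
Implicit Types (S X Y A M : R -> Omega -> R) (p : nat -> R) (h : nat -> Omega -> R).

Lemma transformD h X Y p N w : transform h (fun t w => X t w + Y t w) p N w =
  transform h X p N w + transform h Y p N w.
Proof. by rewrite /transform -big_split/=; apply: eq_bigr => j _; ring. Qed.

Lemma transformZl (c : R) h X p N w :
  transform (fun j w => c * h j w) X p N w = c * transform h X p N w.
Proof. by rewrite /transform big_distrr/=; apply: eq_bigr => j _; ring. Qed.

Lemma good_add X Y : good X -> good Y -> good (fun t w => X t w + Y t w).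
Proof.
move=> gX gY e e' e0 e'0.
have e20 : 0 < e / 2 by rewrite divr_gt0.
have e'20 : 0 < e' / 2 by rewrite divr_gt0.
have [c1 c10 h1] := gX _ _ e20 e'20; have [c2 c20 h2] := gY _ _ e20 e'20.
exists (Num.min c1 c2) => [|t N p h tT g ah bh].
  by rewrite lt_min c10.
have w1 := h1 t N p h tT g ah _; have w2 := h2 t N p h tT g ah _.
apply: whpS (whp_and (w1 _) (w2 _)).
- by rewrite -splitr.
- move=> w [k1 k2] m mN; rewrite transformD (le_lt_trans (ler_normD _ _))//.
  by rewrite (splitr e) ltrD ?k1 ?k2.
- by move=> j w jN; rewrite (le_trans (bh j w jN))// ge_min lexx.
- by move=> j w jN; rewrite (le_trans (bh j w jN))// ge_min lexx orbT.
Qed.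

(** The null set may depend on [t]; a grid involves finitely many of them. *)
Lemma good_ae X Y : (forall t, 0 <= t <= T ->
    {ae P, forall w, X t w - X 0 w = Y t w - Y 0 w}) -> good Y -> good X.
Proof.
move=> XY gY e e' e0 e'0; have [c c0 hc] := gY e e' e0 e'0.
exists c => // t N p h tT g ah bh.
have w1 : whp P (0 *+ N.+1) (fun w => forall j, (j < N.+1)%N ->
    X (p j) w - X 0 w = Y (p j) w - Y 0 w).
  apply: whp_forall_lt => // j jN; apply: whp_ae => //.
  by apply: XY; apply: (grid_itvT g).
apply: whpS (whp_and w1 (hc t N p h tT g ah bh)).
  by rewrite mul0rn add0r.
move=> w [h1 h2] m mN; rewrite (_ : transform h X p m w = transform h Y p m w) ?h2//.
apply: eq_bigr => j _; congr (_ * _).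
have jN : (j < N)%N by rewrite (leq_trans (ltn_ord j)).
have e1 := h1 j.+1 jN; have e2 := h1 j (leqW jN).
by move: e1 e2; lra.
Qed.

Definition as_bv X : Prop := {ae P, forall w, exists C : R, forall t N p,
  t <= T -> grid t N p -> \sum_(j < N) `|X (p j.+1) w - X (p j) w| <= C}.

(** Weights of size [c] give a transform of size at most [c] times the variation along the grid, and
    [whp_uniform] bounds that variation for all grids at once. *)
Lemma bv_good X : (forall s, 0 <= s <= T -> measurable_fun setT (X s)) ->
  as_bv X -> good X.
Proof.
move=> mX bX e e' e0 e'0.
pose J := (nat * (R * nat * (nat -> R)))%type.
pose D (k : nat) : set J := [set i | (k <= i.1)%N /\
   (i.2.1.1 <= T /\ grid i.2.1.1 i.2.1.2 i.2.2)].
pose S (p : nat -> R) N w := \sum_(j < N) `|X (p j.+1) w - X (p j) w|.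
pose Phi (i : J) w := S i.2.2 i.2.1.2 w <= i.1%:R.
have [k kP] : exists k, forall i, D k i -> whp P e' (Phi i).
  apply: whp_uniform => //.
  - by move=> k [l i] [kl h]; split => //; exact: ltnW.
  - move=> [l [[t N] p]] [_ /= [tT g]].
    have -> : [set w | ~ Phi (l, (t, N, p)) w] = [set w | l%:R < S p N w].
      by apply/seteqP; split => w /=; rewrite ltNge => /negP.
    apply: measurable_set_lt => //; apply: measurable_sum => j.
    apply: measurableT_comp => //; apply: measurable_funB; apply: mX.
      by apply: (grid_itvT g).
    by apply: (grid_itvT g) => //; apply: ltnW.
  - case: bX => A [mA PA0 sA]; exists A; split => // w /= nh.
    apply: sA => /= -[C hC]; apply: nh.
    exists (Num.truncn C).+1 => -[l [[t N] p]] [/= kl [tT g]].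
    rewrite /Phi/= (le_trans (hC _ _ _ tT g))//.
    rewrite (@le_trans _ _ (Num.truncn C).+1%:R) ?ler_nat//.
    by rewrite ltW// truncnS_gt.
have k20 : 0 < k%:R + 1 :> R by rewrite ltr_wpDl.
exists (e / (k%:R + 1)) => [|t N p h tT g ah bh]; first by rewrite divr_gt0.
apply: whpS (lexx _) _ (kP (k, (t, N, p)) _) => //= w; rewrite /Phi/= => kw m mN.
have h1 : `|transform h X p m w| <= e / (k%:R + 1) * S p N w.
  rewrite (le_trans (ler_norm_sum _ _ _))// /S big_distrr/=.
  rewrite -(subnKC mN) big_split_ord/= -[leLHS]addr0 lerD//.
    apply: ler_sum => j _; rewrite normrM ler_wpM2r// bh//.
    by rewrite (leq_trans (ltn_ord j)).
  by apply: sumr_ge0 => j _; rewrite mulr_ge0// ltW// divr_gt0.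
apply: le_lt_trans h1 _; rewrite mulrAC ltr_pdivrMr// ltr_pM2l//.
by rewrite (le_lt_trans kw)// ltrDl.
Qed.

Lemma bounded_variation_as_bv X :
  (forall w, bounded_variation 0 T (X ^~ w)) -> as_bv X.
Proof.
move=> bX; apply: aeW => w; have TT := ltW T0.
have fT := (bounded_variationP (X ^~ w) TT).1 (bX w).
exists (fine (total_variation 0 T (X ^~ w))) => t N p tT g.
rewrite -lee_fin fineK//.
have /andP[t0 tt] := grid_itv g (leqnn N).
apply: (@le_trans _ _ (total_variation 0 t (X ^~ w))); last first.
  have [_ pN _] := g; have t0' : 0 <= t by rewrite -pN.
  rewrite (total_variationD (X ^~ w) t0' tT).
  by rewrite leeDl// total_variation_ge0.
have [p0 pN inc] := g.
have step m : (m <= N)%N -> ((\sum_(j < m) `|X (p j.+1) w - X (p j) w|)%:E <=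
    total_variation 0%R (p m) (X ^~ w))%E.
  elim: m => [|m IH] mN; first by rewrite big_ord0 p0 total_variationxx.
  have pm0 : 0 <= p m by case/andP: (grid_itv g (ltnW mN)).
  rewrite big_ord_recr/= EFinD (total_variationD (X ^~ w) pm0 (ltW (inc m mN))).
  by rewrite leeD ?IH ?(ltnW mN)// (total_variation_ge (X ^~ w))// ltW// inc.
by have := step N (leqnn N); rewrite pN.
Qed.

Definition as_continuous X : Prop :=
  {ae P, forall w, {within `[0, T], continuous (X ^~ w)}}.

Lemma within_continuous_bounded (f : R -> R) :
  {within `[0, T], continuous f} ->
  exists C : R, forall s, 0 <= s <= T -> `|f s| <= C.
Proof.
move=> cf; have [a _ ha] := EVT_max (ltW T0) cf.
have [b _ hb] := EVT_min (ltW T0) cf.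
exists (Num.max `|f a| `|f b|) => s sT; rewrite le_max; apply/orP.
have sT' : s \in `[0, T] by rewrite in_itv.
have [f0|f0] := leP 0 (f s).
  by left; rewrite ger0_norm// (le_trans (ha s sT'))// ler_norm.
by right; rewrite ltr0_norm// -[leRHS]normrN (le_trans _ (ler_norm _))// lerN2 hb.
Qed.

Lemma as_continuous_bounded X : as_continuous X -> as_bounded P T X.
Proof.
by case=> A [mA PA sA]; exists A; split => // w nh; apply: sA => /= /within_continuous_bounded.
Qed.

Lemma continuous_paths_as X : continuous_paths T X -> as_continuous X.
Proof. by move=> h; exact: aeW. Qed.

(** The definition speaks only of the events [tau <= s] with [s] in [[0, T]]; the levels
    [T - T / k.+1] stay in this interval and tend to [T]. *)
Lemma stopping_time_measurable_lt tau : stopping_time P W T tau ->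
  measurable [set w | tau w < T].
Proof.
move=> [tau0 ftau].
have -> : [set w | tau w < T] =
    \bigcup_k [set w | tau w <= T - T / k.+1%:R].
  apply/seteqP; split => w /=.
    move=> tw; pose k := Num.truncn (T / (T - tau w)).
    have D0 : 0 < T - tau w by rewrite subr_gt0.
    exists k => //=; rewrite lerBrDr -lerBrDl.
    rewrite ler_pdivrMr ?ltr0n// mulrC -ler_pdivrMr//.
    by rewrite ltW// truncnS_gt.
  move=> [k _] /= /le_lt_trans; apply.
  by rewrite ltrBlDr ltrDl divr_gt0// ltr0n.
apply: bigcup_measurable => k _.
have /ftau[] // : 0 <= T - T / k.+1%:R <= T.
rewrite subr_ge0 ler_pdivrMr ?ltr0n// ler_peMr ?(ltW T0) ?ler1n//=.
by rewrite gerBl divr_ge0// ltW.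
Qed.

(** For [k] large, [T <= tau k] holds with high probability, and then the stopped process, a
    martingale with bounded paths, has the increments of [X]. *)
Lemma local_martingale_good X : local_martingale P W T X ->
  continuous_paths T X -> good X.
Proof.
move=> [aX [tau [stau tau_mono tau_T mtau]]] cX e e' e0 e'0.
have e'20 : 0 < e' / 2 by rewrite divr_gt0.
have [k kP] : exists k, forall l, [set l | (k <= l)%N] l ->
    whp P (e' / 2) (fun w => T <= tau l w).
  apply: (whp_uniform (D := fun k => [set l | (k <= l)%N])) => //.
  - by move=> k l /= /ltnW.
  - move=> l _; rewrite (_ : [set w | _] = [set w | tau l w < T]).
      exact: stopping_time_measurable_lt.
    by apply/seteqP; split => w /=; rewrite ltNge => /negP.
  - case: tau_T => A [mA PA0 sA]; exists A; split => // w /= nh.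
    apply: sA => /= -[l hl]; apply: nh; exists l => i /= /subnK <-.
    elim: (i - l)%N => [|m IH]//; rewrite addSn.
    by rewrite (le_trans IH).
pose Y t w := X (Num.min t (tau k w)) w - X 0 w.
have gY : good Y.
  apply: martingale_good; [exact: ltW|exact: mtau|].
  apply: aeW => w; have [C hC] := within_continuous_bounded (cX w).
  exists (C + C) => s /andP[s0 sT]; rewrite (le_trans (ler_normB _ _))// lerD ?hC//.
    rewrite le_min s0 ge_min sT/= andbT; by have [] := stau k.
  by rewrite lexx ltW.
have [c c0 hc] := gY e (e' / 2) e0 e'20.
exists c => // t N p h tT g ah bh.
apply: whpS (whp_and (kP k (leqnn k)) (hc t N p h tT g ah bh)).
  by rewrite -splitr.
move=> w [h1 h2] m mN; rewrite (_ : transform h X p m w = transform h Y p m w) ?h2//.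
apply: eq_bigr => j _; congr (_ * _).
have jN : (j < N)%N by rewrite (leq_trans (ltn_ord j)).
have /andP[_ b1] := grid_itvT g tT jN.
have /andP[_ b2] := grid_itvT g tT (ltnW jN).
by rewrite /Y !min_l ?(le_trans b1) ?(le_trans b2)//; ring.
Qed.

Lemma good_eq X Y : (forall t w, 0 <= t <= T -> X t w = Y t w) -> good Y -> good X.
Proof.
move=> XY; apply: good_ae => t tT; apply: aeW => w.
by rewrite !XY// lexx ltW.
Qed.

Lemma semimartingale_good X : semimartingale P W T X -> good X.
Proof.
move=> [M [A [[lM cM] [aA cA] bA XE]]]; apply: (good_eq XE); apply: good_add.
  exact: local_martingale_good.
apply: bv_good; last exact: bounded_variation_as_bv.
by move=> s sT; apply: (@fmeas_measurable _ _ _ P W s); apply: (adapted_fm aA sT).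
Qed.

Lemma semimartingale_adapted X : semimartingale P W T X -> adapted P W T X.
Proof.
move=> [M [A [[[aM _] _] [aA _] _ XE]]] t B tT mB.
have -> : X t = (fun w => M t w + A t w) by apply/funext => w; exact: XE.
by apply: (fmeasD _ _ mB); [exact: adapted_fm aM tT|exact: adapted_fm aA tT].
Qed.

Lemma semimartingale_continuous X : semimartingale P W T X -> as_continuous X.
Proof.
move=> [M [A [[_ cM] [_ cA] _ XE]]]; apply: aeW => w.
apply: (@subspace_eq_continuous _ _ _ (fun t => M t w + A t w)).
  by move=> t; rewrite inE /= in_itv/= => tT; rewrite -XE.
exact: within_continuousD (cM w) (cA w).
Qed.

End GoodIntegratorExamples.

(** * Brownian motion *)

Section NormalMoments.
Context {R : realType}.
Local Notation mu := (@lebesgue_measure R).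
Variable sigma : R.
Hypothesis s0 : sigma != 0.

(** The change of variables goes through the Radon-Nikodym derivative, which agrees with the density
    almost everywhere because both have the same integrals over measurable sets. *)
Lemma ge0_integral_normal_prob (f : R -> \bar R) :
  measurable_fun setT f -> (forall x, 0 <= f x)%E ->
  (\int[normal_prob 0 sigma]_x f x =
   \int[mu]_x (f x * (normal_pdf 0 sigma x)%:E))%E.
Proof.
move=> mf f0.
have dom := @normal_prob_dominates R 0 sigma.
rewrite -(Radon_Nikodym_SigmaFinite.change_of_variables dom f0 measurableT mf).
apply: ae_eq_integral => //.
- apply: emeasurable_funM => //; apply: (measurable_int mu).
  exact: Radon_Nikodym_SigmaFinite.f_integrable.
- apply: emeasurable_funM => //=; apply/measurable_EFinP.
  exact: measurable_normal_pdf.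
- apply: ae_eqe_mul2l => /=; apply: integral_ae_eq => //=.
  + exact: Radon_Nikodym_SigmaFinite.f_integrable.
  + by apply/measurable_EFinP; exact: measurable_normal_pdf.
  + by move=> E _ mE; rewrite -Radon_Nikodym_SigmaFinite.f_integral.
Qed.

Lemma ge0_integral_opp (f : R -> \bar R) :
  measurable_fun setT f -> (forall x, 0 <= f x)%E ->
  (\int[mu]_x f (- x)%R = \int[mu]_x f x)%E.
Proof.
move=> mf f0.
have -> : (\int[mu]_x f x =
    \int[pushforward mu (-%R : measurableTypeR R -> measurableTypeR R)]_x f x)%E.
  by apply: eq_measure_integral => A mA _; exact/esym/lebesgue_measureN.
by rewrite ge0_integral_pushforward// preimage_setT.
Qed.

Let pdfE (s x : R) : s != 0 -> normal_pdf 0 s x = normal_peak s * normal_fun 0 s x.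
Proof. by move=> sn0; rewrite normal_pdfE. Qed.

Lemma normal_pdf_even x : normal_pdf 0 sigma (- x) = normal_pdf 0 sigma x.
Proof.
by rewrite !pdfE// /normal_fun !subr0 sqrrN.
Qed.

Lemma normal_prob_pos_neg :
  (\int[normal_prob 0 sigma]_x (EFin ^\+) x =
   \int[normal_prob 0 sigma]_x (EFin ^\-) x :> \bar R)%E.
Proof.
have mE : measurable_fun setT (EFin : R -> \bar R) by [].
rewrite !ge0_integral_normal_prob//; last 2 first.
- exact: measurable_funeneg.
- exact: measurable_funepos.
rewrite -ge0_integral_opp; last 2 first.
- apply: emeasurable_funM; first exact: measurable_funepos.
  by apply/measurable_EFinP; exact: measurable_normal_pdf.
- by move=> x; rewrite mule_ge0// lee_fin normal_pdf_ge0.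
by apply: eq_integral => x _; rewrite normal_pdf_even funeposE funenegE.
Qed.

(** The inequality |x| <= |sigma| exp (x^2 / (4 sigma^2)) dominates |x| times the density of
    variance sigma^2 by a multiple of the density of variance 2 sigma^2, whose integral is known. *)
Lemma normal_prob_norm_lty :
  (\int[normal_prob 0 sigma]_x `|x%:E| < +oo)%E.
Proof.
have mN : measurable_fun setT (fun x : R => `|x%:E|%E).
  by apply: measurableT_comp => //.
rewrite ge0_integral_normal_prob//.
pose tau := Num.sqrt 2 * sigma.
have tau2 : tau ^+ 2 = 2 * sigma ^+ 2 by rewrite exprMn sqr_sqrtr.
have tau0 : tau != 0 by rewrite mulf_neq0// gt_eqF// sqrtr_gt0.
pose K := `|sigma| * normal_peak sigma / normal_peak tau.
have pt := normal_peak_gt0 tau0.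
have K0 : 0 <= K.
  by rewrite divr_ge0 ?mulr_ge0 ?normal_peak_ge0// ltW.
have s20 : 0 < sigma ^+ 2 by rewrite exprn_even_gt0.
apply: (@le_lt_trans _ _ (\int[mu]_x (K%:E * (normal_pdf 0 tau x)%:E))%E).
  apply: ge0_le_integral => //.
  - by move=> x _; rewrite mule_ge0// lee_fin normal_pdf_ge0.
  - apply: emeasurable_funM => //.
    by apply/measurable_EFinP; exact: measurable_normal_pdf.
  - apply: emeasurable_funM => //.
    by apply/measurable_EFinP; exact: measurable_normal_pdf.
  - move=> x _; rewrite -!EFinM lee_fin !pdfE// /K.
    rewrite [leRHS](_ : _ = `|sigma| * normal_peak sigma * normal_fun 0 tau x); last first.
      by field; rewrite gt_eqF.
    rewrite mulrCA [leRHS](_ : _ = normal_peak sigma * (`|sigma| * normal_fun 0 tau x));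
      last by ring.
    rewrite ler_wpM2l ?normal_peak_ge0// /normal_fun subr0.
    set v := x ^+ 2 / (sigma ^+ 2 *+ 4).
    have -> : - x ^+ 2 / (sigma ^+ 2 *+ 2) = - v + - v.
      rewrite /v; by field.
    have -> : - x ^+ 2 / (tau ^+ 2 *+ 2) = - v.
      rewrite tau2 /v; by field.
    rewrite expRD mulrA ler_pM2r ?expR_gt0//.
    have h1 : `|x| <= `|sigma| * expR v.
      have h2 : 1 + v <= expR v by exact: expR_ge1Dx.
      have h3 : `|x| <= `|sigma| * (1 + v).
        have sn0 : 0 < `|sigma| by rewrite normr_gt0.
        rewrite -ler_pdivrMl// /v -subr_ge0.
        have -> : 1 + x ^+ 2 / (sigma ^+ 2 *+ 4) - `|sigma|^-1 * `|x| =
            (1 - `|x| / (2 * `|sigma|)) ^+ 2.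
          rewrite -(real_normK (num_real x)) -(real_normK (num_real sigma)).
          by field; rewrite gt_eqF.
        exact: sqr_ge0.
      by rewrite (le_trans h3)// ler_wpM2l.
    by rewrite expRN ler_pdivrMr ?expR_gt0.
rewrite ge0_integralZl//.
- by rewrite integral_normal_pdf mule1 ltry.
- by apply/measurable_EFinP; exact: measurable_normal_pdf.
- by move=> x _; rewrite lee_fin normal_pdf_ge0.
Qed.

End NormalMoments.

Section BrownianMartingale.
Context {R : realType} {d : measure_display} {Omega : measurableType d}.
Variables (P : probability Omega R) (W : R -> Omega -> R) (T : R).
Hypotheses (hW : brownian P W) (T0 : 0 < T).

Lemma brownian_measurable t : 0 <= t -> measurable_fun setT (W t).
Proof. by case: hW => + _ _ _ _; exact. Qed.

Lemma brownian_adapted : adapted P W T W.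
Proof.
move=> t B /andP[t0 tT] mB; split.
  by rewrite -[X in measurable X]setTI; exact: brownian_measurable.
exists (W t @^-1` B).
  by apply: sub_sigma_algebra; exists t, B; split => //; rewrite t0 lexx.
by rewrite setDv setU0; exact: negligible_set0.
Qed.

Section Increment.
Variables s t : R.
Hypotheses (s0 : 0 <= s) (st : s < t).
Let D w := W t w - W s w.
Let sigma := Num.sqrt (t - s).

Let sigma0 : sigma != 0.
Proof. by rewrite gt_eqF// sqrtr_gt0 subr_gt0. Qed.

Let mD : measurable_fun setT D.
Proof.
apply: measurable_funB; apply: brownian_measurable => //.
exact: le_trans s0 (ltW st).
Qed.

(** Independence means that [P] restricted to [A] has, under [D], the image [P A] times the normal
    law; both sides integrate [g] against this measure. *)
Lemma brownian_increment_integral A (g : R -> \bar R) : past W s A ->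
  measurable_fun setT g -> (forall x, 0 <= g x)%E ->
  (\int[P]_(w in A) g (D w) = P A * \int[normal_prob 0 sigma]_x g x)%E.
Proof.
move=> pA mg g0; have mA := past_measurable hW pA.
have [_ _ _ law indep] := hW.
have mgD : measurable_fun setT (fun w => g (D w)).
  by apply: measurableT_comp => //; exact: mD.
have -> : (\int[P]_(w in A) g (D w) = \int[mrestr P mA]_(w in A) g (D w))%E.
  apply: eq_measure_integral => B mB BA; rewrite /= /mrestr.
  by rewrite (setIidl BA).
have -> : (\int[mrestr P mA]_(w in A) g (D w) = \int[mrestr P mA]_w g (D w))%E.
  rewrite [RHS](@ge0_negligible_integral _ _ _ (mrestr P mA) setT (~` A))//.
  - by rewrite setTD setCK.
  - exact: measurableC.
  - by rewrite /= /mrestr setICl measure0.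
have k0 : 0 <= fine (P A) by rewrite fine_ge0.
have -> : P A = (NngNum k0)%:num%:E by rewrite /= fineK// fin_num_measure.
rewrite -ge0_integral_mscale//.
have -> : (\int[mrestr P mA]_w g (D w) =
   \int[pushforward (mrestr P mA) (D : Omega -> measurableTypeR R)]_x g x)%E.
  by rewrite ge0_integral_pushforward// preimage_setT.
apply: eq_measure_integral => B mB _.
rewrite /= /mscale /pushforward /= /mrestr.
rewrite setIC (indep s t A B)//; last by rewrite s0.
rewrite (law s t B)//; last by rewrite s0.
by rewrite fineK// fin_num_measure.
Qed.

Lemma brownian_increment_itg : P.-integrable setT (EFin \o D).
Proof.
apply/integrableP; split; first exact/measurable_EFinP.
have pT : past W s setT.
  by have [p0 pC _] := past_sigma_algebra W s; have := pC _ p0; rewrite setTD setC0.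
rewrite (brownian_increment_integral (g := fun x => `|x%:E|%E))//.
  by rewrite probability_setT mul1e; exact: normal_prob_norm_lty.
exact: measurableT_comp.
Qed.

(** The normal law is symmetric, so the positive and negative parts contribute equally; both are
    finite, so they may be subtracted. *)
Lemma brownian_increment_mean A : past W s A ->
  (\int[P]_(w in A) (D w)%:E = 0)%E.
Proof.
move=> pA; rewrite integralE.
have mE : measurable_fun setT (EFin : R -> \bar R) by [].
have mp : measurable_fun setT (EFin : R -> \bar R)^\+%E.
  exact: measurable_funepos.
have mn : measurable_fun setT (EFin : R -> \bar R)^\-%E.
  exact: measurable_funeneg.
have e1 := brownian_increment_integral pA mp (funepos_ge0 _).
have e2 := brownian_increment_integral pA mn (funeneg_ge0 _).
transitivity (P A * \int[normal_prob 0 sigma]_x (EFin : R -> \bar R)^\+ x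
  - P A * \int[normal_prob 0 sigma]_x (EFin : R -> \bar R)^\- x)%E.
  by congr (_ - _)%E; [rewrite -e1|rewrite -e2]; apply: eq_integral => w _;
    rewrite ?funeposE ?funenegE.
rewrite normal_prob_pos_neg// subee//.
rewrite fin_numM//; first exact/fin_num_measure/(past_measurable hW pA).
rewrite ge0_fin_numE; last exact: integral_ge0.
apply: le_lt_trans (normal_prob_norm_lty sigma0).
apply: ge0_le_integral => //.
- exact: measurableT_comp.
- move=> x _; rewrite funenegE -[leRHS]abseN.
  by rewrite /maxe; case: ifPn => // _; exact: lee_abs.
Qed.

End Increment.

Lemma brownian_integrable t : 0 <= t -> P.-integrable setT (EFin \o W t).
Proof.
move=> t0; have [_ W0 _ _ _] := hW.
have mWt := brownian_measurable t0.
have mW0 := brownian_measurable (lexx 0).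
have iD : P.-integrable setT (EFin \o (fun w => W t w - W 0 w)).
  have [<-|tn0] := eqVneq 0 t.
    rewrite (_ : _ \o _ = cst 0%E); first exact: integrable0.
    by apply/funext => w /=; rewrite subrr.
  by apply: brownian_increment_itg => //; rewrite lt_neqAle tn0.
case: W0 => N [mN PN sN].
have mD : measurable_fun setT (EFin \o (fun w => W t w - W 0 w)).
  exact: measurable_int iD.
apply/(negligible_integrable mN measurableT _ PN); first exact/measurable_EFinP.
have := (negligible_integrable mN measurableT mD PN).1 iD.
apply: eq_integrable; first exact: measurableD.
move=> w; rewrite inE => -[_ nN] /=; suff -> : W 0 w = 0 by rewrite subr0.
by apply: contrapT => h; apply: nN; apply: sN.
Qed.

Lemma brownian_martingale : martingale P W T W.
Proof.
split.
- exact: brownian_adapted.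
- by move=> t /andP[t0 _]; exact: brownian_integrable.
move=> s t A s0 st tT [mA [B pB [N [mN PN sN]]]].
have mB := past_measurable hW pB.
have [->//|ts] := eqVneq t s.
have {}st : s < t by rewrite lt_neqAle eq_sym ts.
have t0 : 0 <= t := le_trans s0 (ltW st).
have iWt := brownian_integrable t0; have iWs := brownian_integrable s0.
(* An event of the augmented filtration is exchanged for an event of [past], where independence is
   available. *)
have AB : A `\` N = B `\` N.
  apply/seteqP; split => w [h nN]; split => //; apply: contrapT => h'; apply: nN;
    apply: sN; [by left|by right].
have swap X : P.-integrable setT X ->
    (\int[P]_(w in A) X w = \int[P]_(w in B) X w)%E.
  move=> iX; rewrite (negligible_integral mN mA _ PN) ?AB; last first.
    exact: integrableS iX.
  by rewrite -(negligible_integral mN mB _ PN)//; exact: integrableS iX.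
rewrite (swap _ iWt) (swap _ iWs).
have := brownian_increment_mean s0 st pB.
have -> : (\int[P]_(w in B) (W t w - W s w)%:E =
   \int[P]_(w in B) (W t w)%:E - \int[P]_(w in B) (W s w)%:E)%E.
  rewrite -integralB_EFin//; first exact: integrableS iWt.
  exact: integrableS iWs.
move/eqP; rewrite sube_eq ?add0e; first by move/eqP.
- by apply: integrable_fin_num => //; exact: integrableS iWt.
- exact: fin_num_adde_defr.
Qed.

Lemma brownian_continuous : as_continuous P T W.
Proof.
case: hW => _ _ [N [mN PN sN]] _ _; exists N; split => // w nh; apply: sN => h.
apply: nh; apply: continuous_subspaceW h.
by move=> x /=; rewrite !in_itv/= andbT => /andP[].
Qed.

Lemma brownian_good : good P W T W.
Proof.
apply: martingale_good; [exact: ltW|exact: brownian_martingale|].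
apply: as_continuous_bounded => //; exact: brownian_continuous.
Qed.

End BrownianMartingale.

(** * Quadratic variation and trapezoidal sums *)

Section UniformContinuity.
Context {R : realType}.
Variable T : R.

(** Heine's compactness argument for an arbitrary relation, so that it serves moduli of continuity
    as well as Taylor estimates along a path. *)
Lemma segment_uniform (Phi : R -> R -> Prop) :
  (forall s0, 0 <= s0 <= T -> exists2 r : R, 0 < r & forall s u,
    0 <= s <= T -> 0 <= u <= T -> `|s - s0| < r -> `|u - s0| < r -> Phi s u) ->
  exists2 del : R, 0 < del & forall s u, 0 <= s <= T -> 0 <= u <= T ->
    `|s - u| < del -> Phi s u.
Proof.
move=> loc; pose I := `[0, T]%classic : set R.
have /compact_near_coveringP cI : compact I by exact: segment_compact.
have := cI _ (0 : R)^'+ (fun del s => I s -> forall u, I u -> `|s - u| < del ->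
  Phi s u) _.
case => [s0 Is0|r /= r0 hr].
- have [r r0 hr] := loc s0 Is0.
  (* With half the radius, a point of the ball and any point closer to it than [r / 2] both lie
     within [r] of [s0]. *)
  exists (ball s0 (r / 2), [set x | x < r / 2]) => /=.
    split; first by apply: nbhsx_ballx; rewrite divr_gt0.
    by apply: nbhs_right_lt; rewrite divr_gt0.
  move=> [s del] /= [bs dr] Is u Iu su.
  have bs' : `|s - s0| < r / 2 by rewrite distrC.
  apply: hr => //; first by move: bs'; lra.
  rewrite -(subrK s u) -addrA (le_lt_trans (ler_normD _ _))//.
  by rewrite [ltRHS](splitr r) ltrD// distrC (lt_trans su).
exists (r / 2) => [|s u sT uT su]; first by rewrite divr_gt0.
apply: (hr (r / 2)) => //=.
- by rewrite sub0r normrN gtr0_norm ?divr_gt0// ltr_pdivrMr// ltr_pMr// ltr1n.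
- by rewrite divr_gt0.
Qed.

Lemma within_continuous_osc (f : R -> R) (e : R) : 0 < e ->
  {within `[0, T], continuous f} ->
  exists2 del : R, 0 < del & forall s u, 0 <= s <= T -> 0 <= u <= T ->
    `|s - u| < del -> `|f s - f u| < e.
Proof.
move=> e0 cf; apply: segment_uniform => s0 s0T.
move/subspace_continuousP : cf => /(_ s0 s0T) /cvgrPdist_lt.
have e20 : 0 < e / 2 by rewrite divr_gt0.
move=> /(_ _ e20) [r /= r0 hr]; exists r => // s u sT uT ss us.
have h1 : `|f s0 - f s| < e / 2 by apply: hr => //=; rewrite distrC.
have h2 : `|f s0 - f u| < e / 2 by apply: hr => //=; rewrite distrC.
rewrite (splitr e) -(subrK (f s0) (f s)) -addrA (le_lt_trans (ler_normD _ _))//.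
by rewrite ltrD// distrC.
Qed.

End UniformContinuity.

Section UniformEstimates.
Context {R : realType} {d : measure_display} {Omega : measurableType d}.
Variables (P : probability Omega R) (W : R -> Omega -> R) (T : R).
Hypothesis T0 : 0 < T.
Local Notation fm := (fmeas P W).
Local Notation good := (good P W T).
Implicit Types (S X Y Z : R -> Omega -> R) (p : nat -> R) (h : nat -> Omega -> R).

(** Almost every path has a modulus of continuity; [whp_uniform], with [1 / l.+1] as candidate for
    [del], makes it independent of the outcome and of the grid. *)
Lemma as_continuous_osc X : adapted P W T X -> as_continuous P T X ->
  forall e e' : R, 0 < e -> 0 < e' -> exists2 del : R, 0 < del &
    forall t N p, t <= T -> grid t N p -> whp P e' (fun w =>
      forall i j, (i <= N)%N -> (j <= N)%N -> `|p i - p j| < del ->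
        `|X (p i) w - X (p j) w| < e).
Proof.
move=> aX cX e e' e0 e'0.
pose J := (nat * (R * nat * (nat -> R)))%type.
pose D (k : nat) : set J := [set i | (k <= i.1)%N /\
   (i.2.1.1 <= T /\ grid i.2.1.1 i.2.1.2 i.2.2)].
pose Phi (l : J) w := forall i j, (i <= l.2.1.2)%N -> (j <= l.2.1.2)%N ->
  `|l.2.2 i - l.2.2 j| < l.1.+1%:R^-1 -> `|X (l.2.2 i) w - X (l.2.2 j) w| < e.
have [k kP] : exists k, forall i, D k i -> whp P e' (Phi i).
  apply: whp_uniform => //.
  - by move=> k [l i] [kl h]; split => //; exact: ltnW.
  - move=> [l [[t N] p]] [_ /= [tT g]].
    have -> : [set w | ~ Phi (l, (t, N, p)) w] =
        \bigcup_(i in [set i | (i <= N)%N]) \bigcup_(j in [set j | (j <= N)%N /\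
          `|p i - p j| < l.+1%:R^-1]) [set w | e <= `|X (p i) w - X (p j) w|].
      apply/seteqP; split => w /=.
        move=> /existsNP[i /existsNP[j /not_implyP[iN /not_implyP[jN]]]].
        move=> /not_implyP[ij /negP]; rewrite -leNgt => h.
        by exists i => //; exists j.
      move=> [i iN [j [jN ij]]] /= h /(_ i j iN jN ij).
      by rewrite ltNge h.
    apply: bigcup_measurable => i /= iN; apply: bigcup_measurable => j [/= jN _].
    apply: measurable_set_le => //; apply: measurableT_comp => //.
    apply: measurable_funB; apply: (@fmeas_measurable _ _ _ P W);
      by apply: (adapted_fm aX); apply: (grid_itvT g).
  - case: cX => A [mA PA0 sA]; exists A; split => // w /= nh.
    apply: sA => /= cw; apply: nh.
    have [del del0 hdel] := within_continuous_osc e0 cw.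
    exists (Num.truncn del^-1) => -[l [[t N] p]] [/= kl [tT g]] i j /= iN jN ij.
    apply: hdel; [exact: (grid_itvT g)|exact: (grid_itvT g)|].
    rewrite (lt_trans ij)// -(invrK del) ltf_pV2 ?posrE ?invr_gt0 ?ltr0n//.
    by rewrite (lt_le_trans (truncnS_gt _))// ler_nat.
exists k.+1%:R^-1 => [|t N p tT g]; first by rewrite invr_gt0 ltr0n.
by apply: (kP (k, (t, N, p))); split => //=; exact: leqnn.
Qed.

(** Weights that are small only with high probability are set to 0 where they exceed [c], which
    keeps them adapted. *)
Lemma good_whp S : good S -> forall e e' : R, 0 < e -> 0 < e' ->
  exists2 c : R, 0 < c & forall t N p h e1, t <= T -> grid t N p ->
    (forall j, (j < N)%N -> fm (p j) (h j)) ->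
    whp P e1 (fun w => forall j, (j < N)%N -> `|h j w| <= c) ->
    whp P (e1 + e') (fun w => forall M, (M <= N)%N -> `|transform h S p M w| < e).
Proof.
move=> gS e e' e0 e'0; have [c c0 hc] := gS e e' e0 e'0.
exists c => // t N p h e1 tT g ah w1.
pose k j w : R := h j w * (`|h j w| <= c)%R%:R.
have w2 : whp P e' (fun w => forall M, (M <= N)%N -> `|transform k S p M w| < e).
  apply: (hc t N p k tT g) => [j jN|j w jN].
    apply: fmeasM; first exact: ah.
    apply: (fmeas_comp (f := fun x => (`|x| <= c)%R%:R)); last exact: ah.
    exact: measurable_le_indicator.
  rewrite /k; case: (leP `|h j w| c) => hj; first by rewrite mulr1.
  by rewrite mulr0 normr0 ltW.
apply: whpS (lexx _) _ (whp_and w1 w2) => w [h1 h2] M MN.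
rewrite (_ : transform h S p M w = transform k S p M w) ?h2//.
apply: eq_bigr => j _; congr (_ * _); rewrite /k h1 ?mulr1//.
by rewrite (leq_trans (ltn_ord j)).
Qed.

Definition qv_tight X : Prop := forall e' : R, 0 < e' ->
  exists2 C : R, 0 < C & forall t N p, t <= T -> grid t N p ->
    whp P e' (fun w => \sum_(j < N) (X (p j.+1) w - X (p j) w) ^+ 2 <= C).

Lemma sum_sqr_increments (x : nat -> R) N :
  \sum_(j < N) (x j.+1 - x j) ^+ 2 =
  x N ^+ 2 - x 0%N ^+ 2 - 2 * \sum_(j < N) x j * (x j.+1 - x j).
Proof.
elim: N => [|N IH]; first by rewrite !big_ord0 mulr0; ring.
by rewrite !big_ord_recr/= IH; ring.
Qed.

Definition regular X := [/\ adapted P W T X, as_continuous P T X & good X].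

Lemma adapted_whp_bounded X : adapted P W T X -> as_bounded P T X ->
  forall e, 0 < e -> exists2 C : R, 0 < C &
    forall t N p, t <= T -> grid t N p ->
      whp P e (fun w => forall j, (j <= N)%N -> `|X (p j) w| <= C).
Proof.
move=> aX; apply: as_bounded_whp => s sT.
by apply: (@fmeas_measurable _ _ _ P W s); apply: (adapted_fm aX sT).
Qed.

(** By [sum_sqr_increments] the quadratic variation is a bounded boundary term minus twice the
    transform of [X] by itself. The factor [c / C1] brings the weights below [c], and dividing by it
    afterwards only changes the bound. *)
Lemma regular_qv_tight X : regular X -> qv_tight X.
Proof.
move=> [aX cX gX] e' e'0; have e'20 : 0 < e' / 2 by rewrite divr_gt0.
have e'40 : 0 < e' / 2 / 2 by rewrite divr_gt0.
have [C C0 hC] := adapted_whp_bounded aX (as_continuous_bounded T0 cX) e'20.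
have [C1 C10 hC1] := adapted_whp_bounded aX (as_continuous_bounded T0 cX) e'40.
have [c c0 hc] := good_whp gX ltr01 e'40.
exists (C ^+ 2 + 2 * (C1 / c)) => [|t N p tT g].
  by rewrite addr_gt0// ?exprn_gt0// mulr_gt0// divr_gt0.
pose h j w := (c / C1) * X (p j) w.
have w1 : whp P (e' / 2 / 2) (fun w => forall j, (j < N)%N -> `|h j w| <= c).
  apply: whpS (lexx _) _ (hC1 t N p tT g) => w h1 j jN.
  rewrite /h normrM gtr0_norm ?divr_gt0//.
  by rewrite mulrAC ler_pdivrMr// ler_wpM2l ?(ltW c0)// h1// ltnW.
have ah j : (j < N)%N -> fm (p j) (h j).
  move=> jN; apply: fmeasM; first exact: fmeas_cst.
  by apply: (adapted_fm aX); apply: (grid_itvT g) => //; exact: ltnW.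
apply: whpS (whp_and (hC t N p tT g) (hc t N p h _ tT g ah w1)).
  by rewrite -splitr -splitr.
move=> w [h1 h2].
rewrite (sum_sqr_increments (fun j => X (p j) w)) /=.
have := h2 N (leqnn N).
have -> : transform h X p N w =
    (c / C1) * \sum_(j < N) X (p j) w * (X (p j.+1) w - X (p j) w).
  exact: (transformZl (c / C1) (fun j => X (p j))).
set s := (X in _ * X) => hs.
have hs2 : `|s| < C1 / c.
  move: hs; rewrite normrM gtr0_norm ?divr_gt0// mulrAC ltr_pdivrMr// mul1r.
  by rewrite ltr_pdivlMr// mulrC.
have hN : X (p N) w ^+ 2 <= C ^+ 2.
  by rewrite -(real_normK (num_real (X (p N) w))) lerXn2r ?nnegrE ?(ltW C0)// h1.
have h0 := sqr_ge0 (X (p 0%N) w).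
have h3 : - s <= `|s| by rewrite -normrN ler_norm.
by rewrite -/s; move: hN h0 h3 hs2; lra.
Qed.

End UniformEstimates.

(** * Equal subdivision of every step of a grid *)

Section Subgrid.
Context {R : realType}.
Implicit Types (p : nat -> R) (t : R).

Definition subgrid (n : nat) p (j : nat) : R :=
  p (j %/ n)%N + (j %% n)%:R / n%:R * (p (j %/ n).+1 - p (j %/ n)%N).

Lemma subgrid_base n p k : (0 < n)%N -> subgrid n p (k * n) = p k.
Proof. by move=> n0; rewrite /subgrid mulnK// modnMl mul0r mul0r addr0. Qed.

(** The case [i = n] is included: it is the first point of the next block and takes the value
    [p k.+1], so a block can be read with both its endpoints. *)
Lemma subgrid_block n p k i : (i <= n)%N -> (0 < n)%N ->
  subgrid n p (k * n + i) = p k + i%:R / n%:R * (p k.+1 - p k).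
Proof.
move=> + n0; rewrite leq_eqVlt => /predU1P[->|ilt].
  rewrite addnC -mulSn subgrid_base// divff ?mul1r ?pnatr_eq0 -?lt0n//.
  by rewrite addrC subrK.
by rewrite /subgrid divnMDl// divn_small// addn0 modnMDl modn_small.
Qed.

Lemma block_divn n k i : (i < n)%N -> ((k * n + i) %/ n)%N = k.
Proof.
by move=> ilt; rewrite divnMDl ?(leq_ltn_trans _ ilt)// divn_small// addn0.
Qed.

Lemma ltn_block n N j : (j < N * n)%N -> (j %/ n < N)%N.
Proof.
by move=> jN; rewrite ltn_divLR//; case: n jN => //; rewrite muln0.
Qed.

Lemma subgrid_step n p j : (0 < n)%N ->
  subgrid n p j.+1 - subgrid n p j = (p (j %/ n).+1 - p (j %/ n)%N) / n%:R.
Proof.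
move=> n0; have jn := ltn_pmod j n0.
have n0' : n%:R != 0 :> R by rewrite pnatr_eq0 -lt0n.
rewrite {1 2}(divn_eq j n) -addnS !subgrid_block//; last exact: ltnW.
by rewrite -natr1; field.
Qed.

Lemma subgrid_dist n p j : (0 < n)%N -> p (j %/ n)%N < p (j %/ n).+1 ->
  0 <= subgrid n p j - p (j %/ n)%N <= p (j %/ n).+1 - p (j %/ n)%N.
Proof.
move=> n0 pp; have jn := ltn_pmod j n0.
rewrite /subgrid addrC addKr; apply/andP; split.
  by rewrite mulr_ge0 ?divr_ge0// subr_ge0 ltW.
rewrite ler_piMl ?subr_ge0 ?(ltW pp)// ler_pdivrMr ?ltr0n// mul1r ler_nat.
exact: ltnW.
Qed.

Lemma subgrid_grid n t N p : (0 < n)%N -> grid t N p ->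
  grid t (N * n) (subgrid n p).
Proof.
move=> n0 [p0 pN inc]; split.
- by rewrite -(mul0n n) subgrid_base.
- by rewrite subgrid_base.
- move=> j jN; rewrite -subr_gt0 subgrid_step// divr_gt0 ?ltr0n// subr_gt0.
  by rewrite inc// ltn_block.
Qed.

Lemma grid_prefix t N p k : grid t N p -> (k <= N)%N -> grid (p k) k p.
Proof.
by move=> [p0 _ inc] kN; split => // j jk; rewrite inc// (leq_trans jk).
Qed.

Lemma big_block (n N : nat) (f : nat -> R) :
  \sum_(j < N * n) f j = \sum_(k < N) \sum_(i < n) f (k * n + i)%N.
Proof.
elim: N => [|N IH]; first by rewrite mul0n !big_ord0.
by rewrite mulSnr big_split_ord/= IH big_ord_recr.
Qed.

Lemma big_block_dep (n N : nat) (f : nat -> nat -> R) :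
  \sum_(j < N * n) f (j %/ n)%N j = \sum_(k < N) \sum_(i < n) f k (k * n + i)%N.
Proof.
rewrite (big_block n N (fun j => f (j %/ n)%N j)).
by apply: eq_bigr => k _; apply: eq_bigr => i _; rewrite block_divn.
Qed.

End Subgrid.

(** * Trapezoidal sums over grids *)

Section Trapezoid.
Context {R : realType} {d : measure_display} {Omega : measurableType d}.
Variables (P : probability Omega R) (T : R).
Implicit Types (S X Y Z : R -> Omega -> R) (p : nat -> R).

Definition trap Y S p (N : nat) (w : Omega) : R :=
  \sum_(j < N) (Y (p j) w + Y (p j.+1) w) / 2 * (S (p j.+1) w - S (p j) w).

Lemma itv_partition_grid (t : R) s : itv_partition 0 t s ->
  grid t (size s) (fun j => nth 0 (0 :: s) j).
Proof.
move=> [ps /eqP ls]; split => //; first by rewrite -ls (last_nth 0).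
by move=> j js; move/pathP : ps => /(_ 0 j js).
Qed.

Lemma trapezoidE Y S s w :
  trapezoid Y S s w = trap Y S (fun j => nth 0 (0 :: s) j) (size s) w.
Proof. by rewrite /trapezoid big_mkord. Qed.

(** A partition in the sense of [itv_partition] is a list without its starting point 0, hence the
    shift of the index. *)
Let pts p N := [seq p j.+1 | j <- iota 0 N].

Let nth_pts p N j : p 0%N = 0 -> (j <= N)%N -> nth 0 (0 :: pts p N) j = p j.
Proof.
move=> p0; case: j => [|j] jN /=; first by rewrite p0.
by rewrite (nth_map 0%N) ?size_iota// nth_iota.
Qed.

Lemma grid_itv_partition t N p : grid t N p -> itv_partition 0 t (pts p N).
Proof.
move=> [p0 pN inc]; have sN : size (pts p N) = N by rewrite size_map size_iota.
split; last by rewrite (last_nth 0) sN nth_pts// pN.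
apply/(pathP 0) => j; rewrite sN => jN; rewrite nth_pts ?(ltnW jN)//.
by have := nth_pts p0 jN => /= ->; exact: inc.
Qed.

Lemma trapezoid_grid t N p Y S w : grid t N p ->
  trapezoid Y S (pts p N) w = trap Y S p N w.
Proof.
move=> [p0 _ _]; have sN : size (pts p N) = N by rewrite size_map size_iota.
rewrite trapezoidE sN; apply: eq_bigr => j _.
by rewrite !nth_pts// ltnW.
Qed.

Lemma mesh_grid t N p delta : grid t N p ->
  (forall j, (j < N)%N -> p j.+1 - p j < delta) -> mesh_lt (pts p N) delta.
Proof.
move=> [p0 _ _] fine j; have sN : size (pts p N) = N by rewrite size_map size_iota.
rewrite sN => jN; rewrite (nth_pts p0 (ltnW jN)).
by have := nth_pts p0 jN => /= ->; exact: fine.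
Qed.

Lemma measurable_trap Y S t N p : t <= T -> grid t N p ->
  (forall s, 0 <= s <= T -> measurable_fun setT (Y s)) ->
  (forall s, 0 <= s <= T -> measurable_fun setT (S s)) ->
  measurable_fun setT (trap Y S p N).
Proof.
move=> tT g mY mS; apply: measurable_sum => j.
have h1 : 0 <= p j <= T by apply: (grid_itvT g) => //; exact: ltnW.
have h2 : 0 <= p j.+1 <= T by exact: (grid_itvT g).
apply: measurable_funM.
  by apply: measurable_funM => //; apply: measurable_funD; [exact: mY|exact: mY].
by apply: measurable_funB; [exact: mS|exact: mS].
Qed.

Lemma uniform_delta N (Phi : nat -> R -> Prop) :
  (forall k a b, a <= b -> Phi k b -> Phi k a) ->
  (forall k, (k < N)%N -> exists2 b, 0 < b & Phi k b) ->
  exists2 b : R, 0 < b & forall k, (k < N)%N -> Phi k b.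
Proof.
move=> mono; elim: N => [|N IH] h; first by exists 1.
have [b1 b10 h1] := IH (fun k kN => h k (ltnW kN)).
have [b2 b20 h2] := h N (ltnSn N).
exists (Num.min b1 b2) => [|k]; first by rewrite lt_min b10.
rewrite ltnS leq_eqVlt => /predU1P[->|kN].
  by apply: mono h2; rewrite ge_min lexx orbT.
by apply: mono (h1 k kN); rewrite ge_min lexx.
Qed.

(** The definition of the integral provides one mesh for each end time [p k]. There are [N.+1] of
    them, so a common [n] exists, each time being granted probability [e' / N.+1]. *)
Lemma strat_refine Y S Z :
  (forall s, 0 <= s <= T -> measurable_fun setT (Y s)) ->
  (forall s, 0 <= s <= T -> measurable_fun setT (S s)) ->
  (forall u, 0 <= u <= T -> stratonovich P Y S u (Z u)) ->
  forall t N p, t <= T -> grid t N p -> forall e e' : R, 0 < e -> 0 < e' ->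
  exists2 n, (0 < n)%N & whp P e' (fun w => forall k, (k <= N)%N ->
    `|trap Y S (subgrid n p) (k * n) w - Z (p k) w| < e).
Proof.
move=> mY mS hZ t N p tT g e e' e0 e'0.
pose e1 := e' / N.+1%:R; have e10 : 0 < e1 by rewrite divr_gt0// ltr0n.
pose Phi k b := forall s, itv_partition 0 (p k) s -> mesh_lt s b ->
  (P [set w | (e <= `|trapezoid Y S s w - Z (p k) w|)%R] <= e1%:E)%E.
have [b b0 hb] : exists2 b : R, 0 < b & forall k, (k < N.+1)%N -> Phi k b.
  apply: uniform_delta => [k a b ab h s ps ms|k kN].
    by apply: h => // j js; rewrite (lt_le_trans (ms j js)).
  by have [_ /(_ _ _ e0 e10)] := hZ (p k) (grid_itvT g tT kN).
pose n := (Num.truncn (t / b)).+1; exists n => //.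
have t0 : 0 <= t by case/andP: (grid_itv g (leqnn N)); have [_ ->] := g.
have nb : t / n%:R < b.
  by rewrite ltr_pdivrMr ?ltr0n// mulrC -ltr_pdivrMr// truncnS_gt.
have gq := subgrid_grid (ltn0Sn _ : (0 < n)%N) g.
have : whp P (e1 *+ N.+1) (fun w => forall k, (k < N.+1)%N ->
    `|trap Y S (subgrid n p) (k * n) w - Z (p k) w| < e).
  apply: whp_forall_lt => [|k kN]; first exact: ltW.
  have knN : (k * n <= N * n)%N by rewrite leq_mul2r -ltnS kN orbT.
  have gk := grid_prefix gq knN; rewrite subgrid_base// in gk.
  have pkT : 0 <= p k <= T by exact: (grid_itvT g).
  have ms : mesh_lt (pts (subgrid n p) (k * n)) b.
    apply: (mesh_grid gk) => j jk; rewrite subgrid_step//.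
    apply: le_lt_trans nb; rewrite ler_pM2r ?invr_gt0 ?ltr0n//.
    have jN : (j %/ n < N)%N by rewrite (leq_trans (ltn_block jk)).
    have /andP[_ h1] := grid_itv g jN; have /andP[h2 _] := grid_itv g (ltnW jN).
    by move: h1 h2; lra.
  have := hb k kN _ (grid_itv_partition gk) ms => hP.
  exists [set w | e <= `|trap Y S (subgrid n p) (k * n) w - Z (p k) w|]; split.
  - apply: measurable_set_le => //; apply: measurableT_comp => //.
    apply: measurable_funB; last by case: (hZ (p k) pkT).
    apply: (measurable_trap _ gk) => //; by case/andP: pkT.
  - apply: le_trans hP; rewrite le_eqVlt; apply/orP; left; apply/eqP.
    by congr (P _); apply/seteqP; split => w /=; rewrite (trapezoid_grid _ _ _ gk).
  - by move=> w /= /negP; rewrite -ltNge.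
apply: whpS => //; rewrite /e1 -mulr_natr divfK// pnatr_eq0//.
Qed.

End Trapezoid.

(** * Quantities of a grid that vanish or stay bounded in probability *)

Section VanishingSums.
Context {R : realType} {d : measure_display} {Omega : measurableType d}.
Variables (P : probability Omega R) (t : R).
Implicit Types (X Y Z : nat -> (nat -> R) -> Omega -> R) (S : R -> Omega -> R).

(** Convergence to 0 in probability as the mesh tends to 0. *)
Definition vanish X : Prop := forall e e' : R, 0 < e -> 0 < e' ->
  exists2 del : R, 0 < del & forall N p, grid t N p ->
    (forall j, (j < N)%N -> p j.+1 - p j < del) ->
    whp P e' (fun w => `|X N p w| < e).

(** Boundedness in probability for fine meshes. *)
Definition tight X : Prop := forall e' : R, 0 < e' -> exists C : R,
  exists2 del : R, 0 < del & forall N p, grid t N p ->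
    (forall j, (j < N)%N -> p j.+1 - p j < del) ->
    whp P e' (fun w => `|X N p w| <= C).

Definition qvar S (N : nat) (p : nat -> R) (w : Omega) : R :=
  \sum_(k < N) (S (p k.+1) w - S (p k) w) ^+ 2.

Lemma qvar_ge0 S N p w : 0 <= qvar S N p w.
Proof. by apply: sumr_ge0 => k _; exact: sqr_ge0. Qed.

Lemma fine_min (N : nat) (p : nat -> R) (a b : R) :
  (forall j, (j < N)%N -> p j.+1 - p j < Num.min a b) ->
  (forall j, (j < N)%N -> p j.+1 - p j < a) /\
  (forall j, (j < N)%N -> p j.+1 - p j < b).
Proof.
by move=> h; split=> j jN; have := h j jN; rewrite lt_min => /andP[].
Qed.

Lemma vanish0 : vanish (fun _ _ _ => 0).
Proof.
move=> e e' e0 e'0; exists 1 => // N p _ _; apply: whp_true; first exact: ltW.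
by move=> w; rewrite normr0.
Qed.

Lemma vanishD X Y : vanish X -> vanish Y -> vanish (fun N p w => X N p w + Y N p w).
Proof.
move=> vX vY e e' e0 e'0.
have e20 : 0 < e / 2 by rewrite divr_gt0.
have e'20 : 0 < e' / 2 by rewrite divr_gt0.
have [d1 d10 h1] := vX _ _ e20 e'20; have [d2 d20 h2] := vY _ _ e20 e'20.
exists (Num.min d1 d2) => [|N p g /fine_min[f1 f2]]; first by rewrite lt_min d10.
apply: whpS (whp_and (h1 N p g f1) (h2 N p g f2)); first by rewrite -splitr.
move=> w [k1 k2]; rewrite (le_lt_trans (ler_normD _ _))//.
by rewrite (splitr e) ltrD.
Qed.

Lemma vanish_le X Y : vanish Y ->
  (forall N p w, grid t N p -> `|X N p w| <= `|Y N p w|) -> vanish X.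
Proof.
move=> vY XY e e' e0 e'0; have [del del0 h] := vY e e' e0 e'0.
exists del => // N p g f; apply: whpS (lexx _) _ (h N p g f) => w.
exact: le_lt_trans (XY N p w g).
Qed.

Lemma vanish_eq X Y : vanish Y ->
  (forall N p w, grid t N p -> X N p w = Y N p w) -> vanish X.
Proof. by move=> vY XY; apply: vanish_le vY _ => N p w g; rewrite XY. Qed.

Lemma vanishZ (c : R) X : vanish X -> vanish (fun N p w => c * X N p w).
Proof.
move=> vX e e' e0 e'0; have c0 : 0 < `|c| + 1 by rewrite ltr_wpDl.
have [del del0 h] := vX _ e' (divr_gt0 e0 c0) e'0.
exists del => // N p g f; apply: whpS (lexx _) _ (h N p g f) => w.
rewrite ltr_pdivlMr// => hw; rewrite normrM; apply: le_lt_trans hw.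
by rewrite mulrC ler_wpM2l// lerDl.
Qed.

Lemma vanishB X Y : vanish X -> vanish Y -> vanish (fun N p w => X N p w - Y N p w).
Proof.
move=> vX vY; have := vanishD vX (vanishZ (-1) vY).
by move=> v; apply: vanish_eq v _ => N p w _; rewrite mulN1r.
Qed.

Lemma vanish_sum (I : Type) (r : seq I) (X : I -> nat -> (nat -> R) -> Omega -> R) :
  (forall i, vanish (X i)) -> vanish (fun N p w => \sum_(i <- r) X i N p w).
Proof.
move=> h; elim: r => [|i r IH].
  by apply: vanish_eq vanish0 _ => N p w _; rewrite big_nil.
by apply: vanish_eq (vanishD (h i) IH) _ => N p w _; rewrite big_cons.
Qed.

Lemma tight_le X Y : tight Y ->
  (forall N p w, grid t N p -> `|X N p w| <= `|Y N p w|) -> tight X.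
Proof.
move=> tY XY e' e'0; have [C [del del0 h]] := tY e' e'0.
exists C, del => // N p g f; apply: whpS (lexx _) _ (h N p g f) => w.
exact: le_trans (XY N p w g).
Qed.

Lemma tight_cst (c : R) : tight (fun _ _ _ => c).
Proof.
move=> e' e'0; exists `|c|, 1 => // N p _ _.
by apply: whp_true => //; exact: ltW.
Qed.

Lemma tightD X Y : tight X -> tight Y -> tight (fun N p w => X N p w + Y N p w).
Proof.
move=> tX tY e' e'0; have e'20 : 0 < e' / 2 by rewrite divr_gt0.
have [C1 [d1 d10 h1]] := tX _ e'20; have [C2 [d2 d20 h2]] := tY _ e'20.
exists (C1 + C2), (Num.min d1 d2) => [|N p g /fine_min[f1 f2]].
  by rewrite lt_min d10.
apply: whpS (whp_and (h1 N p g f1) (h2 N p g f2)); first by rewrite -splitr.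
by move=> w [k1 k2]; rewrite (le_trans (ler_normD _ _))// lerD.
Qed.

Lemma tightM X Y : tight X -> tight Y -> tight (fun N p w => X N p w * Y N p w).
Proof.
move=> tX tY e' e'0; have e'20 : 0 < e' / 2 by rewrite divr_gt0.
have [C1 [d1 d10 h1]] := tX _ e'20; have [C2 [d2 d20 h2]] := tY _ e'20.
exists (C1 * C2), (Num.min d1 d2) => [|N p g /fine_min[f1 f2]].
  by rewrite lt_min d10.
apply: whpS (whp_and (h1 N p g f1) (h2 N p g f2)); first by rewrite -splitr.
by move=> w [k1 k2]; rewrite normrM ler_pM.
Qed.

Lemma tight_sum (I : Type) (r : seq I) (X : I -> nat -> (nat -> R) -> Omega -> R) :
  (forall i, tight (X i)) -> tight (fun N p w => \sum_(i <- r) X i N p w).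
Proof.
move=> h; elim: r => [|i r IH].
  by apply: tight_le (tight_cst 0) _ => N p w _; rewrite big_nil.
by apply: tight_le (tightD (h i) IH) _ => N p w _; rewrite big_cons.
Qed.

(* A sum bounded, for every r > 0, by r times a tight quantity once the mesh
   is fine enough vanishes. *)
Lemma vanish_small X Y : tight Y ->
  (forall r e' : R, 0 < r -> 0 < e' -> exists2 del : R, 0 < del &
    forall N p, grid t N p -> (forall j, (j < N)%N -> p j.+1 - p j < del) ->
    whp P e' (fun w => `|X N p w| <= r * `|Y N p w|)) -> vanish X.
Proof.
move=> tY hX e e' e0 e'0; have e'20 : 0 < e' / 2 by rewrite divr_gt0.
have [C [d1 d10 h1]] := tY _ e'20.
have C0 : 0 < `|C| + 1 by rewrite ltr_wpDl.
have [d2 d20 h2] := hX _ _ (divr_gt0 e0 C0) e'20.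
exists (Num.min d1 d2) => [|N p g /fine_min[f1 f2]]; first by rewrite lt_min d10.
apply: whpS (whp_and (h1 N p g f1) (h2 N p g f2)); first by rewrite -splitr.
move=> w [k1 k2]; apply: le_lt_trans k2 _; rewrite mulrAC ltr_pdivrMr// ltr_pM2l//.
by rewrite (le_lt_trans k1)// (le_lt_trans (ler_norm _))// ltrDl.
Qed.

End VanishingSums.

(** * Errors of the trapezoidal rule *)

Section StratonovichArea.
Context {R : realType} {d : measure_display} {Omega : measurableType d}.
Variables (P : probability Omega R) (W : R -> Omega -> R) (T : R).
Hypothesis T0 : 0 < T.
Local Notation fm := (fmeas P W).
Local Notation good := (good P W T).
Local Notation regular := (regular P W T).
Implicit Types (S X Y Z V : R -> Omega -> R) (p : nat -> R) (v : nat -> Omega -> R).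

(** The discrete Levy area is exactly the difference between the trapezoidal sum over a block and
    the single trapezoid on its endpoints. *)
Lemma trapezoid_area (y s : nat -> R) n :
  \sum_(i < n) (y i + y i.+1) / 2 * (s i.+1 - s i) =
  (y 0%N + y n) / 2 * (s n - s 0%N) +
  \sum_(i < n) ((y i - y 0%N) * (s i.+1 - s i)
                - (s i - s 0%N) * (y i.+1 - y i)) / 2.
Proof.
elim: n => [|n IH]; first by rewrite !big_ord0 subrr mulr0 addr0.
by rewrite !big_ord_recr/= IH; field.
Qed.

Lemma sqr_sum (x : nat -> R) n : (\sum_(i < n) x i) ^+ 2 =
  \sum_(i < n) (2 * (\sum_(l < i) x l) * x i + x i ^+ 2).
Proof.
elim: n => [|n IH]; first by rewrite !big_ord0 expr0n.
by rewrite !big_ord_recr/= sqrrD IH; ring.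
Qed.

(* increment of the Levy area of (Y, S), restarted at each coarse point p k *)
Definition area_step (n : nat) p Y S (j : nat) (w : Omega) : R :=
  let q := subgrid n p in
  ((Y (q j) w - Y (p (j %/ n)%N) w) * (S (q j.+1) w - S (q j) w)
   - (S (q j) w - S (p (j %/ n)%N) w) * (Y (q j.+1) w - Y (q j) w)) / 2.

Definition block_area (n : nat) p Y S (k : nat) (w : Omega) : R :=
  \sum_(i < n) area_step n p Y S (k * n + i) w.

Lemma trap_block_area n p Y S k w : (0 < n)%N ->
  trap Y S (subgrid n p) (k.+1 * n) w - trap Y S (subgrid n p) (k * n) w =
  (Y (p k) w + Y (p k.+1) w) / 2 * (S (p k.+1) w - S (p k) w)
  + block_area n p Y S k w.
Proof.
move=> n0; rewrite /trap mulSnr big_split_ord/= [LHS]addrC addKr.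
have b0 : subgrid n p (k * n + 0)%N = p k by rewrite addn0 subgrid_base.
have bn : subgrid n p (k * n + n)%N = p k.+1 by rewrite -mulSnr subgrid_base.
have := trapezoid_area (fun i => Y (subgrid n p (k * n + i)%N) w)
  (fun i => S (subgrid n p (k * n + i)%N) w) n.
rewrite /= b0 bn; under eq_bigr do rewrite addnS.
move=> ->; congr (_ + _); apply: eq_bigr => i _.
by rewrite /area_step block_divn//= addnS.
Qed.

Lemma fmeas_base t N p n j Y : adapted P W T Y -> t <= T -> grid t N p ->
  (0 < n)%N -> (j < N * n)%N -> fm (subgrid n p j) (Y (p (j %/ n)%N)).
Proof.
move=> aY tT g n0 jN; have kN := ltn_block jN.
apply: (@fmeas_mono _ _ _ _ _ (p (j %/ n)%N)); last first.
  by apply: (adapted_fm aY); apply: (grid_itvT g) => //; exact: ltnW.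
have [_ _ inc] := g.
by have /andP[] := subgrid_dist n0 (inc _ kN); rewrite subr_ge0.
Qed.

Lemma block_osc t N p n del Y e w : grid t N p -> (0 < n)%N ->
  (forall j, (j < N)%N -> p j.+1 - p j < del) ->
  (forall i j, (i <= N * n)%N -> (j <= N * n)%N ->
     `|subgrid n p i - subgrid n p j| < del ->
     `|Y (subgrid n p i) w - Y (subgrid n p j) w| < e) ->
  forall j, (j < N * n)%N -> `|Y (subgrid n p j) w - Y (p (j %/ n)%N) w| < e.
Proof.
move=> g n0 fine osc j jN; have kN := ltn_block jN.
rewrite -(subgrid_base p (j %/ n) n0); apply: osc.
- exact: ltnW.
- by rewrite (leq_trans (leq_divM _ _))// ltnW.
rewrite subgrid_base//; have [_ _ inc] := g.
have /andP[h1 h2] := subgrid_dist n0 (inc _ kN).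
by rewrite ger0_norm// (le_lt_trans h2)// fine.
Qed.

(** The sum is a difference of two transforms, of [S] and of [Y], whose weights contain the
    increment of the other process since the last coarse point. Continuity makes these weights small
    once the coarse mesh is fine, whatever [n]. *)
Lemma area_transform Y S : regular Y -> regular S ->
  forall C e e' : R, 0 < C -> 0 < e -> 0 < e' ->
  exists2 del : R, 0 < del & forall t N p n v e1, t <= T -> grid t N p ->
    (forall j, (j < N)%N -> p j.+1 - p j < del) -> (0 < n)%N ->
    (forall j, (j < N * n)%N -> fm (subgrid n p j) (v j)) ->
    whp P e1 (fun w => forall j, (j < N * n)%N -> `|v j w| <= C) ->
    whp P (e1 + e1 + e') (fun w => forall M, (M <= N * n)%N ->
      `|\sum_(j < M) v j w * area_step n p Y S j w| < e).
Proof.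
move=> [aY cY gY] [aS cS gS] C e e' C0 e0 e'0.
have e20 : 0 < e / 2 by rewrite divr_gt0.
pose a := e' / 2 / 2; have a0 : 0 < a by rewrite !divr_gt0.
have [c1 c10 hc1] := good_whp gS e20 a0.
have [c2 c20 hc2] := good_whp gY e20 a0.
have [d1 d10 hd1] := as_continuous_osc aY cY (divr_gt0 c10 C0) a0.
have [d2 d20 hd2] := as_continuous_osc aS cS (divr_gt0 c20 C0) a0.
exists (Num.min d1 d2) => [|t N p n v e1 tT g fine n0 av wv].
  by rewrite lt_min d10.
have gq := subgrid_grid n0 g; set q := subgrid n p in gq av *.
have fine1 j : (j < N)%N -> p j.+1 - p j < d1.
  by move=> jN; have := fine j jN; rewrite lt_min => /andP[].
have fine2 j : (j < N)%N -> p j.+1 - p j < d2.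
  by move=> jN; have := fine j jN; rewrite lt_min => /andP[].
pose h1 j w := v j w * (Y (q j) w - Y (p (j %/ n)%N) w) / 2.
pose h2 j w := v j w * (S (q j) w - S (p (j %/ n)%N) w) / 2.
have ah X j : adapted P W T X -> (j < N * n)%N ->
    fm (q j) (fun w => v j w * (X (q j) w - X (p (j %/ n)%N) w) / 2).
  move=> aX jN; apply: fmeasM; last exact: fmeas_cst.
  apply: fmeasM; first exact: av.
  apply: fmeasB; last exact: (fmeas_base aX tT g).
  by apply: (adapted_fm aX); apply: (grid_itvT gq) => //; exact: ltnW.
have bnd (c x y : R) : 0 < c -> `|x| <= C -> `|y| < c / C -> `|x * y / 2| <= c.
  move=> c0 xC yc; rewrite normrM (@ger0_norm _ 2^-1)// normrM.
  have : `|x| * `|y| <= c.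
    rewrite (@le_trans _ _ (C * (c / C)))// ?ler_pM// ?(ltW yc)//.
    by rewrite mulrC divfK// gt_eqF.
  have : 0 <= `|x| * `|y| by rewrite mulr_ge0.
  by lra.
have w1 : whp P (e1 + a) (fun w => forall j, (j < N * n)%N -> `|h1 j w| <= c1).
  apply: whpS (lexx _) _ (whp_and wv (hd1 t _ _ tT gq)) => w [k1 k2] j jN.
  by apply: bnd => //; [exact: k1|exact: (block_osc g n0 fine1 k2)].
have w2 : whp P (e1 + a) (fun w => forall j, (j < N * n)%N -> `|h2 j w| <= c2).
  apply: whpS (lexx _) _ (whp_and wv (hd2 t _ _ tT gq)) => w [k1 k2] j jN.
  by apply: bnd => //; [exact: k1|exact: (block_osc g n0 fine2 k2)].
have w3 := hc1 t _ q h1 _ tT gq (fun j jN => ah Y j aY jN) w1.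
have w4 := hc2 t _ q h2 _ tT gq (fun j jN => ah S j aS jN) w2.
apply: whpS (whp_and w3 w4); first by rewrite /a; lra.
move=> w [k3 k4] M MN.
have -> : \sum_(j < M) v j w * area_step n p Y S j w =
    transform h1 S q M w - transform h2 Y q M w.
  rewrite /transform -sumrB; apply: eq_bigr => j _.
  by rewrite /area_step /h1 /h2 -/q; field.
rewrite (le_lt_trans (ler_normB _ _))// (splitr e) ltrD//; [exact: k3|exact: k4].
Qed.

(** Frozen at the last coarse point, [V] is an adapted weight on the fine grid. *)
Lemma sum_area Y S V : regular Y -> regular S ->
  adapted P W T V -> as_bounded P T V -> forall e e' : R, 0 < e -> 0 < e' ->
  exists2 del : R, 0 < del & forall t N p n, t <= T -> grid t N p ->
    (forall j, (j < N)%N -> p j.+1 - p j < del) -> (0 < n)%N ->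
    whp P e' (fun w => `|\sum_(k < N) V (p k) w * block_area n p Y S k w| < e).
Proof.
move=> rY rS aV bV e e' e0 e'0.
pose a := e' / 2 / 2; have a0 : 0 < a by rewrite !divr_gt0.
have [C C0 hC] := adapted_whp_bounded aV bV a0.
have [del del0 hd] := area_transform rY rS C0 e0 (divr_gt0 e'0 (ltr0n R 2)).
exists del => // t N p n tT g fine n0.
have := hd t N p n (fun j => V (p (j %/ n)%N)) a tT g fine n0 _ _.
move=> h; apply: whpS (h _ _).
- by rewrite /a; lra.
- move=> w /(_ _ (leqnn _)).
  rewrite (big_block_dep n N (fun k j => V (p k) w * area_step n p Y S j w)).
  by under eq_bigr do rewrite -big_distrr/=.
- by move=> j jN; exact: (fmeas_base aV tT g).
- apply: whpS (lexx _) _ (hC t N p tT g) => w k j jN.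
  by apply: k; rewrite ltnW// ltn_block.
Qed.

(** Expanding each square leaves twice a sum of area increments weighted by the area already
    accumulated in the block, to which [area_transform] applies, and the squares of the increments,
    bounded by the squared oscillation times quadratic variations. *)
Lemma sum_area_sqr Y S : regular Y -> regular S ->
  forall e e' : R, 0 < e -> 0 < e' ->
  exists2 del : R, 0 < del & forall t N p n, t <= T -> grid t N p ->
    (forall j, (j < N)%N -> p j.+1 - p j < del) -> (0 < n)%N ->
    whp P e' (fun w => \sum_(k < N) (block_area n p Y S k w) ^+ 2 < e).
Proof.
move=> rY rS e e' e0 e'0.
have [aY cY gY] := rY; have [aS cS gS] := rS.
pose a := e' / 10; have a0 : 0 < a by rewrite !divr_gt0.
have half0 : (0 : R) < 1 / 2 by rewrite divr_gt0.
have e40 : 0 < e / 4 by rewrite divr_gt0.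
have [d1 d10 hd1] := area_transform rY rS ltr01 half0 a0.
have [d2 d20 hd2] := area_transform rY rS ltr01 e40 a0.
have [K1 K10 hK1] := regular_qv_tight T0 rY a0.
have [K2 K20 hK2] := regular_qv_tight T0 rS a0.
pose K := K1 + K2; have K0 : 0 < K by rewrite addr_gt0.
(* These two bounds give [rho ^+ 2 / 2 * K <= e / 4]. *)
pose rho := Num.min 1 (e / (2 * K)).
have rho0 : 0 < rho by rewrite lt_min ltr01 divr_gt0// mulr_gt0.
have [d3 d30 hd3] := as_continuous_osc aY cY rho0 a0.
have [d4 d40 hd4] := as_continuous_osc aS cS rho0 a0.
exists (Num.min (Num.min d1 d2) (Num.min d3 d4)) => [|t N p n tT g fine n0].
  by rewrite !lt_min d10 d20 d30.
have fineS dd : Num.min (Num.min d1 d2) (Num.min d3 d4) <= dd ->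
    forall j, (j < N)%N -> p j.+1 - p j < dd.
  by move=> h j jN; rewrite (lt_le_trans (fine j jN)).
have fine1 := fineS d1 _; have fine2 := fineS d2 _.
have fine3 := fineS d3 _; have fine4 := fineS d4 _.
have {}fine1 : forall j, (j < N)%N -> p j.+1 - p j < d1.
  by apply: fine1; rewrite !ge_min lexx.
have {}fine2 : forall j, (j < N)%N -> p j.+1 - p j < d2.
  by apply: fine2; rewrite !ge_min lexx orbT.
have {}fine3 : forall j, (j < N)%N -> p j.+1 - p j < d3.
  by apply: fine3; rewrite !ge_min lexx !orbT.
have {}fine4 : forall j, (j < N)%N -> p j.+1 - p j < d4.
  by apply: fine4; rewrite !ge_min lexx !orbT.
have gq := subgrid_grid n0 g; set q := subgrid n p in gq *.
pose G M w := \sum_(j < M) 1 * area_step n p Y S j w.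
have wG : whp P (0 + 0 + a) (fun w => forall M, (M <= N * n)%N ->
    `|G M w| < 1 / 2).
  apply: (hd1 t N p n (fun _ _ => 1) 0 tT g fine1 n0).
    by move=> j jN; exact: fmeas_cst.
  by apply: whp_true => // w j _; rewrite normr1.
have fstep j i : (j < N * n)%N -> (i < j)%N -> fm (q j) (area_step n p Y S i).
  move=> jN ij; have iN := ltn_trans ij jN.
  have qq X l : adapted P W T X -> (l <= j)%N -> fm (q j) (X (q l)).
    move=> aX lj; apply: (@fmeas_mono _ _ _ _ _ (q l)).
      by rewrite (grid_le gq)// lj ltnW.
    apply: (adapted_fm aX); apply: (grid_itvT gq) => //.
    by rewrite (leq_trans lj)// ltnW.
  have qb X : adapted P W T X -> fm (q j) (X (p (i %/ n)%N)).
    move=> aX; apply: (@fmeas_mono _ _ _ _ _ (q i)).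
      by rewrite (grid_le gq)// ltnW//= ltnW.
    exact: (fmeas_base aX tT g).
  rewrite /area_step; apply: fmeasM; last exact: fmeas_cst.
  by apply: fmeasB; (apply: fmeasM; apply: fmeasB);
    do ?[exact: qb|apply: qq => //; exact: ltnW].
have fG j M : (j < N * n)%N -> (M <= j)%N -> fm (q j) (G M).
  move=> jN Mj; apply: fmeas_sum => i _; apply: fmeasM; first exact: fmeas_cst.
  by apply: fstep => //; rewrite (leq_trans (ltn_ord i)).
(* The area accumulated since the start of the block containing [j], as a difference of two running
   totals; each stays below 1/2, whence the bound 1. *)
pose v j w := G j w - G (j %/ n * n)%N w.
have wv : whp P (0 + 0 + a) (fun w => forall j, (j < N * n)%N -> `|v j w| <= 1).
  apply: whpS (lexx _) _ wG => w k j jN; rewrite (le_trans (ler_normB _ _))//.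
  have := k j (ltnW jN); have := k (j %/ n * n)%N _.
  move=> /(_ (leq_trans (leq_divM _ _) (ltnW jN))); lra.
have fv j : (j < N * n)%N -> fm (q j) (v j).
  by move=> jN; apply: fmeasB; apply: fG => //; exact: leq_divM.
have w2 := hd2 t N p n v _ tT g fine2 n0 fv wv.
have w3 := whp_and (hd3 t _ q tT gq) (hd4 t _ q tT gq).
have w4 := whp_and (hK1 t _ q tT gq) (hK2 t _ q tT gq).
apply: whpS (whp_and w2 (whp_and w3 w4)); first by rewrite /a; lra.
move=> w [/(_ _ (leqnn _)) k2 [[k3 k4] [k5 k6]]].
have -> : \sum_(k < N) block_area n p Y S k w ^+ 2 =
    2 * (\sum_(j < N * n) v j w * area_step n p Y S j w) +
    \sum_(j < N * n) area_step n p Y S j w ^+ 2.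
  rewrite big_distrr/= -big_split/=.
  rewrite (big_block n N (fun j => 2 * (v j w * area_step n p Y S j w) +
    area_step n p Y S j w ^+ 2)).
  apply: eq_bigr => k _; rewrite (sqr_sum (fun i => area_step n p Y S (k * n + i) w)).
  apply: eq_bigr => i _; congr (_ + _); rewrite mulrA; congr (_ * _); congr (_ * _).
  rewrite /v block_divn// /G big_split_ord/= [RHS]addrC addKr.
  by apply: eq_bigr => l _; rewrite mul1r.
have hs : \sum_(j < N * n) area_step n p Y S j w ^+ 2 <= rho ^+ 2 / 2 * K.
  have hj j : (j < N * n)%N -> area_step n p Y S j w ^+ 2 <=
      rho ^+ 2 / 2 * ((Y (q j.+1) w - Y (q j) w) ^+ 2 + (S (q j.+1) w - S (q j) w) ^+ 2).
    move=> jN; have b1 := block_osc g n0 fine3 k3 jN.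
    have b2 := block_osc g n0 fine4 k4 jN.
    rewrite /area_step -/q; rewrite -/q in b1 b2.
    move: b1 b2; set x := Y (q j) w - _; set y := S (q j) w - _.
    set u := Y _ _ - _; set z := S _ _ - _ => b1 b2.
    have x2 : x ^+ 2 <= rho ^+ 2.
      by rewrite -(real_normK (num_real x)) lerXn2r ?nnegrE ?(ltW rho0) ?(ltW b1).
    have y2 : y ^+ 2 <= rho ^+ 2.
      by rewrite -(real_normK (num_real y)) lerXn2r ?nnegrE ?(ltW rho0) ?(ltW b2).
    have x3 : x ^+ 2 * z ^+ 2 <= rho ^+ 2 * z ^+ 2 by rewrite ler_wpM2r// sqr_ge0.
    have y3 : y ^+ 2 * u ^+ 2 <= rho ^+ 2 * u ^+ 2 by rewrite ler_wpM2r// sqr_ge0.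
    have h1 : ((x * z - y * u) / 2) ^+ 2 <= (x ^+ 2 * z ^+ 2 + y ^+ 2 * u ^+ 2) / 2.
      rewrite -subr_ge0.
      rewrite (_ : _ - _ = ((x * z + y * u) / 2) ^+ 2); last by field.
      exact: sqr_ge0.
    move: h1 x3 y3; lra.
  apply: (@le_trans _ _ (\sum_(j < N * n) rho ^+ 2 / 2 *
      ((Y (q j.+1) w - Y (q j) w) ^+ 2 + (S (q j.+1) w - S (q j) w) ^+ 2))).
    by apply: ler_sum => j _; exact: hj.
  rewrite -big_distrr/= ler_wpM2l ?divr_ge0 ?sqr_ge0// big_split/=.
  by rewrite lerD.
have hr : rho ^+ 2 / 2 * K <= e / 4.
  have r1 : rho <= 1 by rewrite ge_min lexx.
  have r2 : rho * (2 * K) <= e.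
    by rewrite -ler_pdivlMr ?mulr_gt0// ge_min lexx orbT.
  have : rho * (rho * K) <= rho * K.
    by rewrite ler_piMl// mulr_ge0// ltW.
  move: r2; rewrite expr2; lra.
have := ler_norm (\sum_(j < N * n) v j w * area_step n p Y S j w).
move: k2 hs hr; lra.
Qed.

Section Integral.
Variables (Y S Z : R -> Omega -> R).
Hypotheses (rY : regular Y) (rS : regular S).
Hypothesis hZ : forall u, 0 <= u <= T -> stratonovich P Y S u (Z u).

Definition strat_error p (k : nat) (w : Omega) : R :=
  Z (p k.+1) w - Z (p k) w
  - (Y (p k) w + Y (p k.+1) w) / 2 * (S (p k.+1) w - S (p k) w).

Let mY s : 0 <= s <= T -> measurable_fun setT (Y s).
Proof.
have [aY _ _] := rY; move=> sT.
exact: (@fmeas_measurable _ _ _ P W s _ (adapted_fm aY sT)).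
Qed.

Let mS s : 0 <= s <= T -> measurable_fun setT (S s).
Proof.
have [aS _ _] := rS; move=> sT.
exact: (@fmeas_measurable _ _ _ P W s _ (adapted_fm aS sT)).
Qed.

Lemma strat_error_approx t N p (e e' : R) : t <= T -> grid t N p ->
  0 < e -> 0 < e' -> exists2 n, (0 < n)%N & whp P e' (fun w =>
    forall k, (k < N)%N -> `|strat_error p k w - block_area n p Y S k w| < e).
Proof.
move=> tT g e0 e'0; have e20 : 0 < e / 2 by rewrite divr_gt0.
have [n n0 hn] := strat_refine mY mS hZ tT g e20 e'0.
exists n => //; apply: whpS (lexx _) _ hn => w h k kN.
have h1 := h k.+1 kN; have h2 := h k (ltnW kN).
have := trap_block_area p Y S k w n0; rewrite /strat_error.
move: h1 h2; rewrite !ltr_norml => /andP[? ?] /andP[? ?] ?.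
by apply/andP; split; lra.
Qed.

(** On a fine subdivision a transform of [Z] is the transform of [S] by [h * Y], plus a cross term
    bounded by quadratic variations, plus an approximation error that the choice of [n] makes
    negligible for the given grid. *)
Lemma strat_good : good Z.
Proof.
have [aY cY gY] := rY; have [aS cS gS] := rS.
move=> e e' e0 e'0; pose a := e' / 5; have a0 : 0 < a by rewrite !divr_gt0.
pose e3 := e / 4; have e30 : 0 < e3 by rewrite divr_gt0.
have [C C0 hC] := adapted_whp_bounded aY (as_continuous_bounded T0 cY) a0.
have [K1 K10 hK1] := regular_qv_tight T0 rY a0.
have [K2 K20 hK2] := regular_qv_tight T0 rS a0.
pose K := K1 + K2; have K0 : 0 < K by rewrite addr_gt0.
have [c0 c00 hc] := good_whp gS e30 a0.
(* The first bound keeps the weights [h * Y] below the threshold [c0] of [S], the second keeps the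
   cross term below [e / 2]. *)
pose c := Num.min (c0 / C) (e / K).
have cp : 0 < c by rewrite lt_min !divr_gt0.
exists c => // t N p h tT g ah bh.
(* Each increment of [Z] contributes an error of at most [c * (2 * eta)], and [N.+1] such terms add
   up to [e3]. *)
pose eta := e3 / 2 / (c * N.+1%:R).
have cN0 : 0 < c * N.+1%:R by rewrite mulr_gt0// ltr0n.
have eta0 : 0 < eta by rewrite !divr_gt0.
have [n n0 hn] := strat_refine mY mS hZ tT g eta0 a0.
have gq := subgrid_grid n0 g; set q := subgrid n p in gq hn *.
pose v j w := h (j %/ n)%N w * Y (q j) w.
have fv j : (j < N * n)%N -> fm (q j) (v j).
  move=> jN; have kN := ltn_block jN; apply: fmeasM.
    apply: (@fmeas_mono _ _ _ _ _ (p (j %/ n)%N)); last exact: ah.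
    have [_ _ inc] := g.
    by have /andP[] := subgrid_dist n0 (inc _ kN); rewrite subr_ge0.
  by apply: (adapted_fm aY); apply: (grid_itvT gq) => //; exact: ltnW.
have wv : whp P a (fun w => forall j, (j < N * n)%N -> `|v j w| <= c0).
  apply: whpS (lexx _) _ (hC t _ q tT gq) => w k j jN.
  rewrite normrM (@le_trans _ _ (c0 / C * C))//; last by rewrite divfK// gt_eqF.
  rewrite ler_pM// ?k ?(ltnW jN)// (le_trans (bh _ _ (ltn_block jN)))//.
  by rewrite ge_min lexx.
have w1 := hc t _ q v _ tT gq fv wv.
have w2 := whp_and (hK1 t _ q tT gq) (hK2 t _ q tT gq).
apply: whpS (whp_and w1 (whp_and w2 hn)); first by rewrite /a; lra.
move=> w [k1 [[k2 k3] k4]] M MN.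
have MnN : (M * n <= N * n)%N by rewrite leq_mul2r MN orbT.
pose cross := \sum_(j < M * n) h (j %/ n)%N w *
  ((Y (q j.+1) w - Y (q j) w) * (S (q j.+1) w - S (q j) w) / 2).
pose err k := (Z (p k.+1) w - trap Y S q (k.+1 * n) w)
            - (Z (p k) w - trap Y S q (k * n) w).
have EZ : transform h Z p M w =
    transform v S q (M * n) w + cross + \sum_(k < M) h k w * err k.
  have -> : transform h Z p M w =
     \sum_(k < M) h k w * (trap Y S q (k.+1 * n) w - trap Y S q (k * n) w)
     + \sum_(k < M) h k w * err k.
    by rewrite -big_split/=; apply: eq_bigr => k _; rewrite /err; ring.
  congr (_ + _); rewrite /transform /cross -big_split/=.
  rewrite [RHS](eq_bigr (fun j : 'I__ => h (j %/ n)%N w * ((Y (q j) w + Y (q j.+1) w) / 2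
     * (S (q j.+1) w - S (q j) w)))); last first.
    by move=> j _; rewrite /v; field.
  rewrite [RHS](big_block_dep n M (fun k j => h k w * ((Y (q j) w + Y (q j.+1) w) / 2
     * (S (q j.+1) w - S (q j) w)))).
  apply: eq_bigr => k _; rewrite -big_distrr/=; congr (_ * _).
  by rewrite /trap mulSnr big_split_ord/= [LHS]addrC addKr.
have hcross : `|cross| <= e / 2.
  have step j : (j < M * n)%N -> `|h (j %/ n)%N w *
      ((Y (q j.+1) w - Y (q j) w) * (S (q j.+1) w - S (q j) w) / 2)| <=
      c / 4 * ((Y (q j.+1) w - Y (q j) w) ^+ 2 + (S (q j.+1) w - S (q j) w) ^+ 2).
    move=> jM; have jN : (j < N * n)%N by rewrite (leq_trans jM).
    set u := _ - _; set z := S _ _ - _.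
    have h1 : `|u * z / 2| <= (u ^+ 2 + z ^+ 2) / 4.
      have g1 := sqr_ge0 (u - z); have g2 := sqr_ge0 (u + z).
      rewrite (_ : (u - z) ^+ 2 = u ^+ 2 + z ^+ 2 - 2 * (u * z)) in g1; last by ring.
      rewrite (_ : (u + z) ^+ 2 = u ^+ 2 + z ^+ 2 + 2 * (u * z)) in g2; last by ring.
      by rewrite ler_norml; apply/andP; split; move: g1 g2; lra.
    rewrite normrM [leRHS](_ : _ = c * ((u ^+ 2 + z ^+ 2) / 4)); last by field.
    by rewrite ler_pM// bh// ltn_block.
  apply: (@le_trans _ _ (c / 4 * K)); last first.
    have : c * K <= e by rewrite -ler_pdivlMr// ge_min lexx orbT.
    by lra.
  apply: le_trans (ler_norm_sum _ _ _) _.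
  apply: (@le_trans _ _ (\sum_(j < N * n) c / 4 * ((Y (q j.+1) w - Y (q j) w) ^+ 2
     + (S (q j.+1) w - S (q j) w) ^+ 2))); last first.
    by rewrite -big_distrr/= ler_wpM2l ?divr_ge0 ?(ltW cp)// big_split/= lerD.
  rewrite -(subnKC MnN) big_split_ord/= -[leLHS]addr0 lerD//.
    by apply: ler_sum => j _; exact: step.
  apply: sumr_ge0 => j _; rewrite mulr_ge0 ?divr_ge0 ?(ltW cp)//.
  by rewrite addr_ge0// sqr_ge0.
have herr : `|\sum_(k < M) h k w * err k| <= e3.
  apply: le_trans (ler_norm_sum _ _ _) _.
  apply: (@le_trans _ _ (\sum_(k < M) c * (2 * eta))).
    apply: ler_sum => k _; have kN : (k < N)%N by rewrite (leq_trans (ltn_ord k)).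
    rewrite normrM ler_pM ?bh// /err (le_trans (ler_normB _ _))//.
    have := k4 k.+1 kN; have := k4 k (ltnW kN).
    by rewrite !(distrC (trap _ _ _ _ _)); lra.
  rewrite sumr_const card_ord -[leLHS]mulr_natr.
  have -> : e3 = c * (2 * eta) * N.+1%:R.
    by rewrite /eta; field; rewrite !gt_eqF// ltr0n.
  apply: ler_wpM2l; first by apply/ltW; apply: mulr_gt0 => //; apply: mulr_gt0.
  by rewrite ler_nat (leq_trans MN).
rewrite EZ (le_lt_trans (ler_normD _ _))//.
have := ler_normD (transform v S q (M * n) w) cross.
have := k1 _ MnN; move: hcross herr; rewrite /e3; lra.
Qed.

(** The mesh is fixed first, from [sum_area], which is uniform in [n]; only then is [n] chosen for
    the given grid, so that errors and block areas nearly coincide. *)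
Lemma sum_strat_error V : adapted P W T V -> as_bounded P T V ->
  forall e e' : R, 0 < e -> 0 < e' ->
  exists2 del : R, 0 < del & forall t N p, t <= T -> grid t N p ->
    (forall j, (j < N)%N -> p j.+1 - p j < del) ->
    whp P e' (fun w => `|\sum_(k < N) V (p k) w * strat_error p k w| < e).
Proof.
move=> aV bV e e' e0 e'0.
pose a := e' / 3; have a0 : 0 < a by rewrite divr_gt0.
have e20 : 0 < e / 2 by rewrite divr_gt0.
have [del del0 hd] := sum_area rY rS aV bV e20 a0.
have [C C0 hC] := adapted_whp_bounded aV bV a0.
exists del => // t N p tT g fine.
pose eta := e / 2 / (C * N.+1%:R).
have CN0 : 0 < C * N.+1%:R by rewrite mulr_gt0// ltr0n.
have eta0 : 0 < eta by rewrite !divr_gt0.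
have [n n0 hn] := strat_error_approx tT g eta0 a0.
apply: whpS (whp_and (hd t N p n tT g fine n0) (whp_and (hC t N p tT g) hn)).
  by rewrite /a; lra.
move=> w [k1 [k2 k3]].
have -> : \sum_(k < N) V (p k) w * strat_error p k w =
    \sum_(k < N) V (p k) w * block_area n p Y S k w +
    \sum_(k < N) V (p k) w * (strat_error p k w - block_area n p Y S k w).
  by rewrite -big_split/=; apply: eq_bigr => k _; ring.
rewrite (le_lt_trans (ler_normD _ _))// (splitr e) ltr_leD//.
apply: le_trans (ler_norm_sum _ _ _) _.
apply: (@le_trans _ _ (\sum_(k < N) C * eta)).
  apply: ler_sum => k _; rewrite normrM ler_pM ?(ltW (k3 _ _))//.
  by rewrite k2// ltnW.
rewrite sumr_const card_ord -[leLHS]mulr_natr.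
have -> : e / 2 = C * eta * N.+1%:R.
  by rewrite /eta; field; rewrite !gt_eqF// ltr0n.
by apply: ler_wpM2l; [apply/ltW; exact: mulr_gt0|rewrite ler_nat].
Qed.

Lemma sum_strat_error_sqr : forall e e' : R, 0 < e -> 0 < e' ->
  exists2 del : R, 0 < del & forall t N p, t <= T -> grid t N p ->
    (forall j, (j < N)%N -> p j.+1 - p j < del) ->
    whp P e' (fun w => \sum_(k < N) strat_error p k w ^+ 2 < e).
Proof.
move=> e e' e0 e'0.
pose a := e' / 2; have a0 : 0 < a by rewrite divr_gt0.
have e40 : 0 < e / 4 by rewrite divr_gt0.
have [del del0 hd] := sum_area_sqr rY rS e40 a0.
exists del => // t N p tT g fine.
(* The bound 1 makes the square of a deviation below [eta] again at most [eta]. *)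
pose eta := Num.min 1 (e / (4 * N.+1%:R)).
have N0 : 0 < N.+1%:R :> R by rewrite ltr0n.
have eta0 : 0 < eta by rewrite lt_min ltr01 divr_gt0// mulr_gt0.
have [n n0 hn] := strat_error_approx tT g eta0 a0.
apply: whpS (whp_and (hd t N p n tT g fine n0) hn).
  by rewrite /a; lra.
move=> w [k1 k3].
have : \sum_(k < N) strat_error p k w ^+ 2 <=
    \sum_(k < N) (2 * block_area n p Y S k w ^+ 2 + 2 * eta).
  apply: ler_sum => k _; have := k3 k (ltn_ord k).
  set x := strat_error _ _ _; set y := block_area _ _ _ _ _ _ => xy.
  have h1 : (x - y) ^+ 2 <= eta.
    rewrite -(real_normK (num_real (x - y))) (@le_trans _ _ (eta ^+ 2))//.
      by rewrite lerXn2r ?nnegrE ?(ltW eta0) ?(ltW xy).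
    by rewrite expr2 ler_piMl ?(ltW eta0)// ge_min lexx.
  (* This is the inequality x^2 <= 2 (x - y)^2 + 2 y^2. *)
  have := sqr_ge0 (x - 2 * y).
  have -> : (x - 2 * y) ^+ 2 = x ^+ 2 - 4 * x * y + 4 * y ^+ 2 by ring.
  move: h1; have -> : (x - y) ^+ 2 = x ^+ 2 - 2 * x * y + y ^+ 2 by ring.
  lra.
rewrite big_split/= -big_distrr/= sumr_const card_ord -[X in _ <= _ + X]mulr_natr.
have : eta * N.+1%:R <= e / 4.
  have -> : e / 4 = e / (4 * N.+1%:R) * N.+1%:R by field; rewrite gt_eqF.
  by rewrite ler_wpM2r ?(ltW N0)// ge_min lexx orbT.
have : eta * N%:R <= eta * N.+1%:R by apply: ler_wpM2l; [exact: ltW|rewrite ler_nat].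
move: k1; lra.
Qed.

(** The average of [V] over a step is its left value plus half its increment. The left value is an
    adapted weight; the increment is paired with the error by a weighted Cauchy-Schwarz inequality,
    the squared errors having a vanishing sum. *)
Lemma sum_avg_strat_error V t : t <= T -> adapted P W T V -> as_bounded P T V ->
  tight P t (qvar V) -> vanish P t (fun N p w =>
    \sum_(k < N) (V (p k) w + V (p k.+1) w) / 2 * strat_error p k w).
Proof.
move=> tT aV bV qV e e' e0 e'0.
pose a := e' / 3; have a0 : 0 < a by rewrite divr_gt0.
have e20 : 0 < e / 2 by rewrite divr_gt0.
have [K1 [d3 d30 hK]] := qV _ a0.
pose K := `|K1| + 1; have K0 : 0 < K by rewrite ltr_wpDl.
(* 2 |dV E| <= dV^2 r + E^2 / r with r K = e *)
pose r := e / K; have r0 : 0 < r by rewrite divr_gt0.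
have er0 : 0 < e * r by rewrite mulr_gt0.
have [d1 d10 hd1] := sum_strat_error aV bV e20 a0.
have [d2 d20 hd2] := sum_strat_error_sqr er0 a0.
exists (Num.min d1 (Num.min d2 d3)) => [|N p g fine].
  by rewrite !lt_min d10 d20.
have [fine1 /fine_min[fine2 fine3]] := fine_min fine.
apply: whpS (whp_and (hd1 t N p tT g fine1)
  (whp_and (hd2 t N p tT g fine2) (hK N p g fine3))).
  by rewrite /a; lra.
move=> w [k1 [k2 k30]].
have k3 : qvar V N p w <= K.
  rewrite (le_trans (ler_norm _))// (le_trans k30)// (le_trans (ler_norm _))//.
  by rewrite /K lerDl.
have -> : \sum_(k < N) (V (p k) w + V (p k.+1) w) / 2 * strat_error p k w =
   \sum_(k < N) V (p k) w * strat_error p k w +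
   \sum_(k < N) (V (p k.+1) w - V (p k) w) / 2 * strat_error p k w.
  by rewrite -big_split/=; apply: eq_bigr => k _; field.
rewrite (le_lt_trans (ler_normD _ _))// (splitr e) ltrD//.
apply: le_lt_trans (ler_norm_sum _ _ _) _.
apply: (@le_lt_trans _ _ (\sum_(k < N) (r / 4 * (V (p k.+1) w - V (p k) w) ^+ 2 +
   r^-1 / 4 * strat_error p k w ^+ 2))).
  apply: ler_sum => k _; set x := V _ _ - _; set y := strat_error _ _ _.
  have g1 : 0 <= r / 4 * (x - y / r) ^+ 2 by apply: mulr_ge0; [rewrite divr_ge0// ltW|exact: sqr_ge0].
  have g2 : 0 <= r / 4 * (x + y / r) ^+ 2 by apply: mulr_ge0; [rewrite divr_ge0// ltW|exact: sqr_ge0].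
  have i1 : r / 4 * (x - y / r) ^+ 2 = r / 4 * x ^+ 2 + r^-1 / 4 * y ^+ 2 - x / 2 * y.
    by field; rewrite gt_eqF.
  have i2 : r / 4 * (x + y / r) ^+ 2 = r / 4 * x ^+ 2 + r^-1 / 4 * y ^+ 2 + x / 2 * y.
    by field; rewrite gt_eqF.
  by rewrite ler_norml; apply/andP; split; move: g1 g2; rewrite i1 i2; lra.
rewrite big_split/= -!big_distrr/=.
have h1 : r * \sum_(k < N) (V (p k.+1) w - V (p k) w) ^+ 2 <= e.
  by rewrite (@le_trans _ _ (r * K))// ?ler_wpM2l ?(ltW r0)// /r divfK// gt_eqF.
have h2 : r^-1 * \sum_(k < N) strat_error p k w ^+ 2 < e.
  by rewrite mulrC ltr_pdivrMr.
by move: h1 h2; lra.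
Qed.

End Integral.

End StratonovichArea.

(** * Calculus in jets *)

Section FiniteOrderContinuity.
Context {R : realType} {C : eqType}.
Implicit Types (F G : (C -> R) -> R) (u v w : C -> R) (s : seq C).

(** A basic neighbourhood in the product topology constrains finitely many coordinates, so finitely
    many of the given limits are combined. *)
Lemma ptws_cvg (X : Type) (FX : set_system X) (g : X -> C -> R) u : Filter FX ->
  (forall c, g x c @[x --> FX] --> u c) ->
  (g : X -> {ptws C -> R}) @ FX --> (u : {ptws C -> R}).
Proof.
move=> FF cg U [] P [] [] Q QfinP <- [] V JV Vu PU.
apply: (filterS (P := g @^-1` V)) => [x Vx|]; first by apply: PU; exists V.
have [L Lsub /[dup] VL <-] := QfinP _ JV; rewrite preimage_bigcap.
apply: filter_bigI => /= M /[dup] LM /Lsub /set_mem [] c _ [N oN NM].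
rewrite -NM; have := cg c; apply; apply: open_nbhs_nbhs; split => //.
by move: Vu; rewrite -VL => /(_ _ LM); rewrite -NM.
Qed.

Definition depends_on s F : Prop :=
  forall u v, (forall c, c \in s -> u c = v c) -> F u = F v.

(** If no [del] worked, the counterexamples, reset to [u] outside [s] without changing the value of
    [F], would converge to [u] in every coordinate, against the continuity of [F]. *)
Lemma depends_on_continuous s F u : depends_on s F ->
  {for u, continuous (F : {ptws C -> R} -> R)} -> forall e : R, 0 < e ->
  exists2 del : R, 0 < del & forall v,
    (forall c, c \in s -> `|v c - u c| < del) -> `|F v - F u| < e.
Proof.
move=> dF cF e e0; apply: contrapT => nex.
have [f fP] : exists f : nat -> C -> R, forall k,
    (forall c, c \in s -> `|f k c - u c| < k.+1%:R^-1) /\ ~ `|F (f k) - F u| < e.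
  have h k : exists v, (forall c, c \in s -> `|v c - u c| < k.+1%:R^-1) /\
      ~ `|F v - F u| < e.
    apply: contrapT => nh; apply: nex; exists k.+1%:R^-1 => [|v hv].
      by rewrite invr_gt0 ltr0n.
    by apply: contrapT => nv; apply: nh; exists v.
  by exists (fun k => projT1 (cid (h k))) => k; case: cid.
pose g k c := if c \in s then f k c else u c.
have cg : (g : nat -> {ptws C -> R}) @ \oo --> (u : {ptws C -> R}).
  apply: ptws_cvg => c; rewrite /g; case: (boolP (c \in s)) => cs; last exact: cvg_cst.
  apply/cvgrPdist_lt => r r0; near=> k; rewrite distrC.
  apply: lt_trans ((fP k).1 c cs) _.
  by near: k; exact: near_infty_natSinv_lt (PosNum r0).
have := cvg_comp _ _ cg cF => /cvgrPdist_lt /(_ e e0) [k _ /(_ k (leqnn k))] /=.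
rewrite distrC (_ : F (g k) = F (f k)); last first.
  by apply: dF => c cs; rewrite /g cs.
by have [_] := fP k.
Unshelve. all: by end_near. Qed.

Lemma pd_at c F u r :
  derive1 (fun r => F [eta u with c |-> r]) r = pd c F [eta u with c |-> r].
Proof.
rewrite /pd /= eqxx; congr (derive1 _ _); apply/funext => r'; congr F.
by apply/funext => c' /=; case: ifP.
Qed.

Lemma depends_on_pd s F c : depends_on s F -> depends_on s (pd c F).
Proof.
move=> dF u v uv; case: (boolP (c \in s)) => cs.
  rewrite /pd uv//; congr (derive1 _ _); apply/funext => r; apply: dF => c' c's /=.
  by case: ifP => // _; exact: uv.
rewrite /pd; have E w : (fun r : R => F [eta w with c |-> r]) = cst (F w).
  apply/funext => r; apply: dF => c' c's /=; case: eqP => // c'c.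
  by move: c's; rewrite c'c (negbTE cs).
by rewrite !E !derive1_cst.
Qed.

Lemma pd_notin s F c u : depends_on s F -> c \notin s -> pd c F u = 0.
Proof.
move=> dF cs; rewrite /pd (_ : (fun r : R => _) = cst (F u)) ?derive1_cst//.
apply/funext => r; apply: dF => c' c's /=; case: eqP => // c'c.
by move: c's; rewrite c'c (negbTE cs).
Qed.

Lemma mean_value (f : R -> R) (a b : R) : (forall x, derivable f x 1) ->
  exists2 xi, Num.min a b <= xi <= Num.max a b &
    f b - f a = (b - a) * derive1 f xi.
Proof.
move=> df; wlog ab : a b / a <= b => [hwlog|].
  case: (boolP (a <= b)) => [ab|]; first exact: hwlog.
  rewrite -ltNge => /ltW ba.
  have [xi xi_ab e] := hwlog b a ba.
  exists xi; first by rewrite minC maxC.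
  by rewrite -opprB e; ring.
rewrite min_l// max_r//; move: ab; rewrite le_eqVlt => /predU1P[<-|ab].
  by exists a; rewrite ?lexx// !subrr mul0r.
have [||c] := @MVT R f (derive1 f) a b ab.
- move=> x _; rewrite derive1E; apply/derivableP; exact: df.
- by apply: derivable_within_continuous => x _; exact: df.
rewrite in_itv/= => /andP[/ltW ac /ltW cb] e.
by exists c; rewrite ?ac// e mulrC.
Qed.

(* strict differentiability at u, from the joint continuity of the partial
   derivatives; coordinates outside S are frozen *)
Lemma strict_expansion s (S : pred C) F u : uniq s -> depends_on s F ->
  (forall c, c \in s -> S c ->
    {for u, continuous (pd c F : {ptws C -> R} -> R)} /\
    forall v, derivable (fun r : R => F [eta v with c |-> r]) (v c) 1) ->
  forall e : R, 0 < e -> exists2 del : R, 0 < del & forall v w,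
    (forall c, c \in s -> `|v c - u c| < del) ->
    (forall c, c \in s -> `|w c - u c| < del) ->
    (forall c, c \in s -> ~~ S c -> w c = v c) ->
    `|F w - F v - \sum_(c <- s) (w c - v c) * pd c F v| <=
      e * \sum_(c <- s) `|w c - v c|.
Proof.
move=> us dF dif e e0.
have [del del0 hdel] : exists2 del : R, 0 < del & forall c, c \in s -> S c ->
    forall v, (forall c', c' \in s -> `|v c' - u c'| < del) ->
    `|pd c F v - pd c F u| < e / 2.
  have : forall L : seq C, {subset L <= s} -> exists2 del : R, 0 < del &
      forall c, c \in L -> S c ->
      forall v, (forall c', c' \in s -> `|v c' - u c'| < del) ->
      `|pd c F v - pd c F u| < e / 2.
    elim=> [_|c L IH Ls]; first by exists 1.
    have [d1 d10 h1] := IH (fun c' h => Ls c' (mem_behead (s := c :: L) h)).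
    have cs : c \in s by apply: Ls; exact: mem_head.
    case: (boolP (S c)) => Sc; last first.
      exists d1 => // c'; rewrite inE => /predU1P[->|]; last exact: h1.
      by move=> Sc'; move: Sc; rewrite Sc'.
    have [cc _] := dif c cs Sc.
    have e20 : 0 < e / 2 by rewrite divr_gt0.
    have [d2 d20 h2] := depends_on_continuous (depends_on_pd c dF) cc e20.
    exists (Num.min d1 d2) => [|c' c'L Sc' v hv]; first by rewrite lt_min d10.
    have hv1 c2 : c2 \in s -> `|v c2 - u c2| < d1.
      by move=> /hv; rewrite lt_min => /andP[].
    have hv2 c2 : c2 \in s -> `|v c2 - u c2| < d2.
      by move=> /hv; rewrite lt_min => /andP[].
    move: c'L; rewrite inE => /predU1P[->|c'L]; first exact: h2.
    exact: h1.
  by move=> /(_ s (fun _ h => h)).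
exists del => // v w hv hw vw.
(* Coordinates pass from [v] to [w] one at a time. Each passage is a mean value whose intermediate
   point is still within [del] of [u], where the partial derivative is within [e] of its value at
   [v]. *)
have key L : uniq L -> {subset L <= s} ->
    `|F (fun c => if c \in L then w c else v c) - F v
      - \sum_(c <- L) (w c - v c) * pd c F v| <=
      e * \sum_(c <- L) `|w c - v c|.
  elim: L => [_ _|c L IH /= /andP[cL uL] Ls].
    rewrite !big_nil mulr0 subr0 (_ : (fun c => _) = v) ?subrr ?normr0//.
  have cs : c \in s by apply: Ls; exact: mem_head.
  have Ls' : {subset L <= s} by move=> c' h; apply: Ls; rewrite inE h orbT.
  have {}IH := IH uL Ls'.
  pose x c' := if c' \in L then w c' else v c'.
  have xw : (fun c' => if c' \in c :: L then w c' else v c') = [eta x with c |-> w c].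
    apply/funext => c' /=; rewrite inE; case: eqP => [->|]//=.
  rewrite xw !big_cons.
  have xc : x c = v c by rewrite /x (negbTE cL).
  have step : `|F [eta x with c |-> w c] - F x - (w c - v c) * pd c F v| <=
      e * `|w c - v c|.
    case: (boolP (S c)) => Sc; last first.
      have wv := vw c cs Sc; rewrite wv subrr mul0r subr0 normr0 mulr0.
      rewrite (_ : F [eta x with c |-> v c] = F x) ?subrr ?normr0//.
      by congr F; apply/funext => c' /=; case: eqP => [->|//]; rewrite xc.
    have [_ dd] := dif c cs Sc.
    have df r : derivable (fun r : R => F [eta x with c |-> r]) r 1.
      have := dd [eta x with c |-> r]; rewrite /= eqxx.
      suff -> : (fun r' : R => F [eta [eta x with c |-> r] with c |-> r']) =
                (fun r' : R => F [eta x with c |-> r']) by [].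
      by apply/funext => r'; congr F; apply/funext => c' /=; case: (c' == c).
    have [xi hxi] := mean_value (v c) (w c) df.
    rewrite (_ : F [eta x with c |-> v c] = F x); last first.
      by congr F; apply/funext => c' /=; case: eqP => [->|//]; rewrite xc.
    rewrite pd_at => ->; rewrite -mulrBr normrM mulrC ler_wpM2r//.
    set y := [eta x with c |-> xi].
    have hy c' : c' \in s -> `|y c' - u c'| < del.
      move=> c's; rewrite /y /=; case: eqP => [->|_]; last first.
        by rewrite /x; case: ifP => _; [exact: hw|exact: hv].
      have := hv c cs; have := hw c cs; rewrite !ltr_norml => /andP[a1 a2] /andP[a3 a4].
      by move: hxi; rewrite ge_min le_max => /andP[/orP[] a5 /orP[] a6]; apply/andP; split; lra.
    have g1 := hdel c cs Sc y hy; have g2 := hdel c cs Sc v hv.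
    rewrite -(subrK (pd c F u) (pd c F y)) -addrA (le_trans (ler_normD _ _))//.
    by rewrite (splitr e) lerD// ?(ltW g1)// distrC ltW.
  have -> : F [eta x with c |-> w c] - F v -
      ((w c - v c) * pd c F v + \sum_(j <- L) (w j - v j) * pd j F v) =
      (F [eta x with c |-> w c] - F x - (w c - v c) * pd c F v) +
      (F x - F v - \sum_(j <- L) (w j - v j) * pd j F v) by ring.
  by rewrite (le_trans (ler_normD _ _))// mulrDr lerD.
have := key s us (fun _ h => h).
rewrite (_ : F (fun c => if c \in s then w c else v c) = F w)//.
by apply: dF => c ->.
Qed.

(** Divided by [h], the error of [strict_expansion] is a small multiple of the sum of the difference
    quotients of the coordinates, which converge and hence stay bounded. *)
Lemma chain_rule s (S : pred C) F (x : R -> C -> R) (x' : C -> R) (r0 : R) :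
  uniq s -> depends_on s F ->
  (forall c, c \in s -> S c ->
    {for x r0, continuous (pd c F : {ptws C -> R} -> R)} /\
    forall v, derivable (fun r : R => F [eta v with c |-> r]) (v c) 1) ->
  (forall c, c \in s -> ~~ S c -> forall r, x r c = x r0 c) ->
  (forall c, c \in s -> is_derive r0 1 (fun r : R => x r c) (x' c)) ->
  is_derive r0 1 (fun r => F (x r)) (\sum_(c <- s) x' c * pd c F (x r0)).
Proof.
move=> us dF dif fix_ dx.
have exp := strict_expansion us dF dif.
pose q c h : R := h^-1 * (x (h + r0) c - x r0 c).
have qc c : c \in s -> q c h @[h --> 0^'] --> x' c.
  move=> cs; have [dc dE] := dx c cs; rewrite -dE.
  have := dc; rewrite /derivable /derive /=.
  rewrite (_ : (fun h : R => h^-1 *: _) = q c) //.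
  by apply/funext => h; rewrite /q/= /GRing.scale/= mulr1.
have xcont c : c \in s -> forall e : R, 0 < e ->
    \forall h \near (0 : R)^', `|x (h + r0) c - x r0 c| < e.
  move=> cs e e0; have [dc _] := dx c cs.
  have /differentiable_continuous : differentiable (fun r : R => x r c) r0.
    exact/derivable1_diffP.
  move=> /cvgrPdist_lt /(_ e e0) [r /= rr0 hr]; exists r => // h /= hr' _.
  rewrite distrC; apply: hr => /=; rewrite opprD addrA addrAC subrr add0r normrN.
  by move: hr'; rewrite /ball_/= sub0r normrN.
have allc (e : R) : 0 < e -> forall L : seq C, {subset L <= s} ->
    \forall h \near (0 : R)^', forall c, c \in L -> `|x (h + r0) c - x r0 c| < e.
  move=> e0; elim=> [_|c L IH Ls]; first exact: nearW.
  have h1 := xcont c (Ls c (mem_head _ _)) e e0.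
  have h2 := IH (fun c' h => Ls c' (mem_behead (s := c :: L) h)).
  near=> h => c'; rewrite inE => /predU1P[->|c'L]; first by near: h.
  by move: c' c'L; near: h.
have cvgsum (L : seq C) (f : C -> R -> R) (l : C -> R) : {subset L <= s} ->
    (forall c, c \in s -> f c h @[h --> 0^'] --> l c) ->
    (\sum_(c <- L) f c h) @[h --> 0^'] --> \sum_(c <- L) l c.
  elim: L => [_ _|c L IH Ls cf].
    by rewrite big_nil; under eq_fun do rewrite big_nil; exact: cvg_cst.
  rewrite big_cons; under eq_fun do rewrite big_cons.
  apply: cvgD; first by apply: cf; apply: Ls; exact: mem_head.
  by apply: IH => // c' h; apply: Ls; rewrite inE h orbT.
set D := \sum_(c <- s) _.
have main : (fun h : R => h^-1 * (F (x (h + r0)) - F (x r0))) @ 0^' --> D.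
  have c1 : (\sum_(c <- s) q c h * pd c F (x r0)) @[h --> 0^'] --> D.
    apply: cvgsum => // c cs; apply: cvgM; [exact: qc|exact: cvg_cst].
  have c2 : (\sum_(c <- s) `|q c h|) @[h --> 0^'] --> \sum_(c <- s) `|x' c|.
    apply: cvgsum => // c cs; apply: cvg_norm; exact: qc.
  pose K := \sum_(c <- s) `|x' c| + 1.
  have K0 : 0 < K by rewrite ltr_pwDr// sumr_ge0.
  apply/cvgrPdist_lt => e e0.
  have e20 : 0 < e / 2 by rewrite divr_gt0.
  have [del del0 hdel] := exp (e / 2 / K) (divr_gt0 e20 K0).
  move/cvgrPdist_lt : c1 => /(_ _ e20) c1.
  move/cvgrPdist_lt : c2 => /(_ _ ltr01) c2.
  have c3 := allc del del0 s (fun _ h => h).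
  near=> h.
  have h0 : h != 0 by near: h; exact: nbhs_dnbhs_neq.
  have g1 : `|D - \sum_(c <- s) q c h * pd c F (x r0)| < e / 2 by near: h.
  have g2 : `|\sum_(c <- s) `|x' c| - \sum_(c <- s) `|q c h| | < 1 by near: h.
  have g3 : forall c, c \in s -> `|x (h + r0) c - x r0 c| < del by near: h.
  have g4 : `|F (x (h + r0)) - F (x r0)
      - \sum_(c <- s) (x (h + r0) c - x r0 c) * pd c F (x r0)| <=
      e / 2 / K * \sum_(c <- s) `|x (h + r0) c - x r0 c|.
    apply: hdel => //; last by move=> c cs Sc; rewrite fix_.
    by move=> c cs; rewrite subrr normr0.
  have g5 : `|h^-1 * (F (x (h + r0)) - F (x r0)) -
      \sum_(c <- s) q c h * pd c F (x r0)| <= e / 2 / K * \sum_(c <- s) `|q c h|.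
    have -> : \sum_(c <- s) q c h * pd c F (x r0) =
        h^-1 * \sum_(c <- s) (x (h + r0) c - x r0 c) * pd c F (x r0).
      by rewrite big_distrr/=; apply: eq_bigr => c _; rewrite /q mulrA.
    have -> : \sum_(c <- s) `|q c h| =
        `|h^-1| * \sum_(c <- s) `|x (h + r0) c - x r0 c|.
      by rewrite big_distrr/=; apply: eq_bigr => c _; rewrite /q normrM.
    by rewrite -mulrBr normrM mulrCA ler_wpM2l.
  have g6 : e / 2 / K * \sum_(c <- s) `|q c h| <= e / 2.
    rewrite mulrAC ler_pdivrMr// ler_wpM2l ?(ltW e20)//.
    by move: g2; rewrite /K ltr_norml => /andP[? ?]; lra.
  rewrite -(subrK (\sum_(c <- s) q c h * pd c F (x r0)) D) -addrA.
  rewrite (le_lt_trans (ler_normD _ _))// (splitr e) ltr_leD// distrC.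
  exact: le_trans g5 g6.
have E : (fun h : R => h^-1 *: (((fun r => F (x r)) \o shift r0) (h *: 1) - F (x r0))) =
    (fun h : R => h^-1 * (F (x (h + r0)) - F (x r0))).
  by apply/funext => h; rewrite /= /GRing.scale/= mulr1.
apply: DeriveDef.
  by rewrite /derivable E; apply/cvg_ex; exists D.
by rewrite /derive E; exact: cvg_lim main.
Unshelve. all: by end_near. Qed.

End FiniteOrderContinuity.

(** * Smooth functions and the symmetry of second derivatives *)

Section SmoothFunctions.
Context {R : realType} {C : eqType}.
Implicit Types (F f : (C -> R) -> R) (u v : C -> R) (S : pred C).

Lemma smooth_in_continuous S F : smooth_in S F ->
  continuous (F : {ptws C -> R} -> R).
Proof. by move=> /(_ [::] isT)[]. Qed.

Lemma smooth_in_derivable S F c u : smooth_in S F -> S c ->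
  derivable (fun r : R => F [eta u with c |-> r]) (u c) 1.
Proof. by move=> sF Sc; have [_ h] := sF [::] isT; exact: h. Qed.

Arguments smooth_in_derivable [S F c] u.

Lemma smooth_in_pd S F c : S c -> smooth_in S F -> smooth_in S (pd c F).
Proof.
move=> Sc sF s Ss; have := sF (rcons s c).
by rewrite foldr_rcons all_rcons Sc Ss; exact.
Qed.

Lemma smooth_in_partials S F c u : smooth_in S F -> S c ->
  {for u, continuous (pd c F : {ptws C -> R} -> R)} /\
  forall v, derivable (fun r : R => F [eta v with c |-> r]) (v c) 1.
Proof.
move=> sF Sc; split=> [|v]; last exact: (smooth_in_derivable v sF Sc).
by have := smooth_in_continuous (smooth_in_pd Sc sF); exact.
Qed.

(* keeps the kernel from comparing smoothness proofs by unfolding the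
   iterated partial derivatives *)
Local Opaque smooth_in.

Lemma smooth_pd F c : smooth F -> smooth (pd c F).
Proof. exact: smooth_in_pd. Qed.

Lemma eta_with_id u c : [eta u with c |-> u c] = u :> (C -> R).
Proof. by apply/funext => c' /=; case: eqP => [->|]. Qed.

Definition with_two i j u (x y : R) : C -> R :=
  fun c => if c == i then x else if c == j then y else u c.

Section TwoVariables.
Variables (i j : C) (u : C -> R) (f : (C -> R) -> R).
Hypotheses (ij : i != j) (sf : smooth f).
Local Notation pt := (with_two i j u).

(** Two applications of the mean value theorem, in [i] and then in [j]. The left side is symmetric
    in the two variables up to regrouping, so the other order yields the other mixed derivative,
    whence [schwarz] by continuity. *)
Lemma second_difference (h : R) : exists xi et : R,
  [/\ Num.min (u i) (u i + h) <= xi <= Num.max (u i) (u i + h),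
      Num.min (u j) (u j + h) <= et <= Num.max (u j) (u j + h) &
      f (pt (u i + h) (u j + h)) - f (pt (u i + h) (u j))
      - (f (pt (u i) (u j + h)) - f (pt (u i) (u j))) =
      h * (h * pd j (pd i f) (pt xi et))].
Proof.
have ptx x0 y x : [eta pt x0 y with i |-> x] = pt x y :> (C -> R).
  by apply/funext => c /=; rewrite /with_two; case: (c == i).
have pty x y0 y : [eta pt x y0 with j |-> y] = pt x y :> (C -> R).
  apply/funext => c /=; rewrite /with_two; case: eqP => [->|].
    by rewrite eq_sym (negbTE ij).
  by case: (c == i).
have dx (g : (C -> R) -> R) y x : smooth g ->
    derivable (fun x => g (pt x y)) x 1 /\
    derive1 (fun x => g (pt x y)) x = pd i g (pt x y).
  move=> sg; have := smooth_in_derivable (c := i) (pt x y) sg isT.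
  have pti : pt x y i = x by rewrite /with_two eqxx.
  rewrite /pd pti.
  by rewrite (_ : (fun r : R => g [eta pt x y with i |-> r]) = fun x => g (pt x y))//;
    apply/funext => r; rewrite ptx.
have dy (g : (C -> R) -> R) y x : smooth g ->
    derivable (fun y => g (pt x y)) y 1 /\
    derive1 (fun y => g (pt x y)) y = pd j g (pt x y).
  move=> sg; have := smooth_in_derivable (c := j) (pt x y) sg isT.
  have ptj : pt x y j = y by rewrite /with_two eq_sym (negbTE ij) eqxx.
  rewrite /pd ptj.
  by rewrite (_ : (fun r : R => g [eta pt x y with j |-> r]) = fun y => g (pt x y))//;
    apply/funext => r; rewrite pty.
pose phi x := f (pt x (u j + h)) - f (pt x (u j)).
have dphi (x : R) : is_derive x 1 phi (pd i f (pt x (u j + h)) - pd i f (pt x (u j))).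
  have [d1 e1] := dx f (u j + h) x sf; have [d2 e2] := dx f (u j) x sf.
  rewrite -e1 -e2 !derive1E; apply: is_deriveB; exact: derivableP.
have [|xi hxi exi] := @mean_value _ phi (u i) (u i + h).
  by move=> x; case: (dphi x).
have [|et het eet] := @mean_value _ (fun y => pd i f (pt xi y)) (u j) (u j + h).
  by move=> y; have [] := dy (pd i f) y xi (smooth_pd i sf).
exists xi, et; split => //.
have [_ e2] := dy (pd i f) et xi (smooth_pd i sf).
have e3 : derive1 phi xi = pd i f (pt xi (u j + h)) - pd i f (pt xi (u j)).
  by rewrite derive1E; have [_ ->] := dphi xi.
move: exi; rewrite e3 eet e2 /phi.
by rewrite !(addrC (u i)) !(addrC (u j)) !addrK.
Qed.

End TwoVariables.

Lemma with_two_near i j u (x y h e : R) : 0 < h -> h < e ->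
  Num.min (u i) (u i + h) <= x <= Num.max (u i) (u i + h) ->
  Num.min (u j) (u j + h) <= y <= Num.max (u j) (u j + h) ->
  forall c, `|with_two i j u x y c - u c| < e.
Proof.
move=> h0 he; rewrite !min_l ?max_r ?lerDl ?(ltW h0)//.
move=> /andP[x3 x4] /andP[y3 y4] c; rewrite /with_two.
case: eqP => [->|_]; first by rewrite ger0_norm; lra.
case: eqP => [->|_]; first by rewrite ger0_norm; lra.
by rewrite subrr normr0 (lt_trans h0).
Qed.

Lemma second_difference_eq (a b x y z v k : R) : k != 0 ->
  x - y - (z - v) = k * (k * b) -> x - z - (y - v) = k * (k * a) -> a = b.
Proof.
by move=> k0 e1 e2; apply: (mulfI k0); apply: (mulfI k0); rewrite -e1 -e2; ring.
Qed.

Lemma dist_half (e a b c : R) :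
  `|a - c| < e / 2 -> `|c - b| < e / 2 -> `|a - b| <= e.
Proof.
move=> ac cb; rewrite (le_trans (ler_distD c _ _))// (splitr e).
by apply: lerD; exact: ltW.
Qed.

Lemma schwarz s i j f u : depends_on s f -> smooth f ->
  pd i (pd j f) u = pd j (pd i f) u.
Proof.
move=> df sf; have [->//|ij] := eqVneq i j.
apply/eqP; rewrite -subr_eq0 -normr_le0; apply/ler_addgt0Pr => e e0; rewrite add0r.
have e20 : 0 < e / 2 by rewrite divr_gt0.
have cont a b := smooth_in_continuous (smooth_pd a (smooth_pd b sf)).
have dep a b := depends_on_pd a (depends_on_pd b df).
have [d1 d10 h1] := depends_on_continuous (dep i j) (cont i j u) e20.
have [d2 d20 h2] := depends_on_continuous (dep j i) (cont j i u) e20.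
pose h := Num.min d1 d2 / 2.
have m0 : 0 < Num.min d1 d2 by rewrite lt_min d10.
have h0 : 0 < h by rewrite divr_gt0.
have hm : h < Num.min d1 d2 by rewrite /h; lra.
have [x1 [y1 [hx1 hy1 E1]]] := second_difference u ij sf h.
have ji : j != i by rewrite eq_sym.
have [y2 [x2 [hy2 hx2 E2]]] := second_difference u ji sf h.
have sw (x y : R) : with_two j i u y x = with_two i j u x y.
  apply/funext => c; rewrite /with_two; case: eqP => [->|//].
  by rewrite (negbTE ji).
rewrite !sw in E2.
have m1 : Num.min d1 d2 <= d1 by rewrite ge_min lexx.
have m2 : Num.min d1 d2 <= d2 by rewrite ge_min lexx orbT.
have hd1 : h < d1 := lt_le_trans hm m1; have hd2 : h < d2 := lt_le_trans hm m2.
have g2 := h2 _ (fun c _ => with_two_near h0 hd2 hx1 hy1 c).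
have g1 := h1 _ (fun c _ => with_two_near h0 hd1 hx2 hy2 c).
have E : pd i (pd j f) (with_two i j u x2 y2) = pd j (pd i f) (with_two i j u x1 y1).
  have hn : h != 0 by rewrite gt_eqF.
  exact: second_difference_eq hn E1 E2.
rewrite distrC E in g1.
exact: dist_half g1 g2.
Qed.

Lemma smooth_iter F c k : smooth F -> smooth (iter k (pd c) F).
Proof. by move=> sF; elim: k => [|k IH]; [exact: sF|exact: smooth_pd IH]. Qed.

End SmoothFunctions.

Section MultiIndexDerivatives.
Context {R : realType} {n : nat}.
Implicit Types (f : ('I_n -> R) -> R) (J : mindex n) (i : 'I_n).
Local Opaque smooth_in.

Lemma depends_on_all f : depends_on (index_enum 'I_n) f.
Proof.
by move=> u v uv; congr f; apply/funext => c; apply: uv; rewrite mem_index_enum.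
Qed.

Lemma pdC i j f : smooth f -> pd i (pd j f) = pd j (pd i f).
Proof. by move=> sf; apply/funext => u; exact: schwarz (depends_on_all f) sf. Qed.

Lemma pd_iterC i j k f : smooth f ->
  pd i (iter k (pd j) f) = iter k (pd j) (pd i f).
Proof.
move=> sf; elim: k => [|k IH]//=.
by rewrite pdC; [rewrite IH|exact: smooth_iter sf].
Qed.

Lemma smooth_pdn_seq J f (l : seq 'I_n) : smooth f ->
  smooth (foldr (fun k g => iter (J k) (pd k) g) f l).
Proof. by move=> sf; elim: l => [|k l IH]; [exact: sf|exact: smooth_iter IH]. Qed.

Lemma smooth_pdn J f : smooth f -> smooth (pdn J f).
Proof. exact: smooth_pdn_seq. Qed.

(** [pdn] differentiates in the fixed order of [enum], so the new derivative is commuted inwards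
    until it meets the block of its own variable. *)
Lemma pd_pdn i J f : smooth f -> pd i (pdn J f) = pdn (mindexS i J) f.
Proof.
move=> sf; rewrite /pdn; have := mem_enum 'I_n i; have := enum_uniq 'I_n.
rewrite inE; elim: (enum 'I_n) => [|k l IH]//= /andP[kl ul].
have tail : i \notin l ->
    foldr (fun k g => iter (mindexS i J k) (pd k) g) f l =
    foldr (fun k g => iter (J k) (pd k) g) f l.
  elim: l {IH kl ul} => [|c l IH]//=; rewrite inE negb_or => /andP[ic il].
  by rewrite IH// ffunE eq_sym (negbTE ic) addn0.
rewrite inE; case: eqP => [ik _|ik] /=.
  by rewrite -ik in kl *; rewrite tail// ffunE eqxx addn1.
move=> il; rewrite pd_iterC; last exact: smooth_pdn_seq.
by rewrite IH// ffunE eq_sym; case: eqP => // _; rewrite addn0.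
Qed.

Lemma pdn0 f : pdn (mindex0 : mindex n) f = f.
Proof.
rewrite /pdn; elim: (enum 'I_n) => [|k l IH]//=.
by rewrite IH ffunE.
Qed.

End MultiIndexDerivatives.

Lemma is_derive_bigsum {R : realType} (I : Type) (l : seq I) (f : I -> R -> R)
    (df : I -> R) (x : R) : (forall i, is_derive x 1 (f i) (df i)) ->
  is_derive x 1 (fun r => \sum_(i <- l) f i r) (\sum_(i <- l) df i).
Proof.
move=> h; elim: l => [|i l IH].
  rewrite big_nil (_ : (fun r => _) = cst 0); first exact: is_derive_cst.
  by apply/funext => r; rewrite big_nil.
rewrite big_cons (_ : (fun r => _) = f i + (fun r => \sum_(i <- l) f i r)).
  exact: is_deriveD.
by apply/funext => r; rewrite big_cons.
Qed.

Section ProlongationChainRule.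
Context {R : realType} {d : measure_display} {Omega : measurableType d} {n m : nat}.
Variables (z eta etat : 'I_m -> R -> Omega -> ('I_n -> R) -> R).
Variables (t : R) (w : Omega).
Hypotheses (sz : forall a, smooth (z a t w)) (seta : forall a, smooth (eta a t w))
  (setat : forall a, smooth (etat a t w)).
Local Notation jt := (prolong z eta etat t w).
Implicit Types (F : (coord n m -> R) -> R) (x : 'I_n -> R) (i : 'I_n).

Lemma finite_order_uniq F : finite_order F -> exists2 s, uniq s & depends_on s F.
Proof.
move=> [s hs]; exists (undup s); first exact: undup_uniq.
by move=> u v uv; apply: hs => c cs; apply: uv; rewrite mem_undup.
Qed.

Lemma tderE s i F u : uniq s -> depends_on s F ->
  tder i F u = \sum_(c <- s) dcoord i u c * pd c F u.
Proof.
move=> us dF; rewrite /tder (@fsbigE _ _ _ _ _ s)//.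
  by apply: eq_bigl => c; rewrite in_setT.
by move=> c _ cs; rewrite (pd_notin _ dF cs) mulr0.
Qed.

Lemma is_derive_coordinate f x i : smooth f ->
  is_derive (x i) 1 (fun r : R => f [eta x with i |-> r]) (pd i f x).
Proof.
move=> sf; rewrite /pd derive1E; apply/derivableP.
exact: (@smooth_in_derivable _ _ xpredT f i x sf isT).
Qed.

Lemma is_derive_prolong F x i : dfun F ->
  is_derive (x i) 1 (fun r : R => F (jt [eta x with i |-> r])) (tder i F (jt x)).
Proof.
move=> [fF sF]; have [s us dF] := finite_order_uniq fF.
rewrite (tderE _ _ us dF).
have jx : jt [eta x with i |-> x i] = jt x by rewrite eta_with_id.
have := @chain_rule R _ s (predC1 Time) F (fun r => jt [eta x with i |-> r])
  (dcoord i (jt x)) (x i) us dF.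
rewrite jx; apply.
- by move=> c _ cT; exact: smooth_in_partials sF cT.
- by move=> c _ /=; rewrite negbK => /eqP -> r.
move=> c _; case: c => [j||a J|a J|a J] /=.
- by case: (j == i); [exact: is_derive_id|exact: is_derive_cst].
- exact: is_derive_cst.
- by rewrite -pd_pdn//; apply: is_derive_coordinate; exact: smooth_pdn.
- by rewrite -pd_pdn//; apply: is_derive_coordinate; exact: smooth_pdn.
- by rewrite -pd_pdn//; apply: is_derive_coordinate; exact: smooth_pdn.
Qed.

Lemma is_derive_fields (f : ('I_m -> R) -> R) x i : smooth f ->
  is_derive (x i) 1 (fun r : R => f (fun b => z b t w [eta x with i |-> r]))
    (\sum_b pd i (z b t w) x * pd b f (fun b => z b t w x)).
Proof.
move=> sf.
have := @chain_rule R _ (index_enum 'I_m) xpredT f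
  (fun r b => z b t w [eta x with i |-> r]) (fun b => pd i (z b t w) x) (x i)
  (index_enum_uniq _) (depends_on_all f).
rewrite eta_with_id; apply => // c _.
- by move=> _; exact: (@smooth_in_partials _ _ xpredT).
- exact: is_derive_coordinate.
Qed.

Lemma pd_flux (L : 'I_n -> 'I_m -> ('I_m -> R) -> R)
    (Q : 'I_m -> (coord n m -> R) -> R) (B : 'I_n -> (coord n m -> R) -> R) x i :
  (forall i a, smooth (L i a)) -> (forall a, dfun (Q a)) -> (forall i, dfun (B i)) ->
  pd i (fun y => \sum_a L i a (fun b => z b t w y) * Q a (jt y) - B i (jt y)) x =
  \sum_a ((\sum_b pd i (z b t w) x * pd b (L i a) (fun b => z b t w x)) * Q a (jt x)
          + L i a (fun b => z b t w x) * tder i (Q a) (jt x))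
  - tder i (B i) (jt x).
Proof.
move=> sL dQ dB; rewrite /pd derive1E.
have dsum : is_derive (x i) 1
   (fun r : R => \sum_a L i a (fun b => z b t w [eta x with i |-> r])
       * Q a (jt [eta x with i |-> r]))
   (\sum_a ((\sum_b pd i (z b t w) x * pd b (L i a) (fun b => z b t w x))
         * Q a (jt x) + L i a (fun b => z b t w x) * tder i (Q a) (jt x))).
  apply: is_derive_bigsum => a.
  have d1 := is_derive_fields x i (sL i a).
  have d2 := is_derive_prolong x i (dQ a).
  have := is_deriveM d1 d2; rewrite /= eta_with_id => d3.
  by apply: is_derive_eq d3 _; rewrite /GRing.scale/=; ring.
have d4 := is_deriveB dsum (is_derive_prolong x i (dB i)).
exact: derive_val.
Qed.

End ProlongationChainRule.

(** * The variational symmetry *)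

Section LagrangianSymmetry.
Context {R : realType} {n m : nat}.
Local Notation jet := (coord n m -> R).
Implicit Types (u : jet) (a b : 'I_m) (i j : 'I_n).

(** The boolean lets one computation serve both Lagrangians: [true] for the dt part, [false] for the
    dW part. *)
Definition velocity (vt : bool) a : coord n m :=
  if vt then JetEta a mindex0 else JetEtat a mindex0.

Lemma JetZ_eq a b (J K : mindex n) :
  (JetZ a J == JetZ b K :> coord n m) = (a == b) && (J == K).
Proof. by apply/eqP/andP => [[-> ->]|[/eqP-> /eqP->]]. Qed.

Lemma JetEta_eq a b (J K : mindex n) :
  (JetEta a J == JetEta b K :> coord n m) = (a == b) && (J == K).
Proof. by apply/eqP/andP => [[-> ->]|[/eqP-> /eqP->]]. Qed.

Lemma JetEtat_eq a b (J K : mindex n) :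
  (JetEtat a J == JetEtat b K :> coord n m) = (a == b) && (J == K).
Proof. by apply/eqP/andP => [[-> ->]|[/eqP-> /eqP->]]. Qed.

Lemma mindexS_neq0 i : (mindexS i mindex0 == mindex0 :> mindex n) = false.
Proof.
apply/negbTE/eqP => /ffunP/(_ i); rewrite !ffunE eqxx; discriminate.
Qed.

Lemma mindexS0_inj i j : (mindexS i mindex0 == mindexS j mindex0 :> mindex n) = (i == j).
Proof.
apply/eqP/eqP => [/ffunP/(_ i)|-> //]; rewrite !ffunE eqxx !add0n.
by case: eqP.
Qed.

Lemma velocity_JetZ vt a b J : (velocity vt a == JetZ b J) = false.
Proof. by rewrite /velocity; case: vt; apply/negbTE/eqP. Qed.

Lemma velocity_eq vt vt' a b :
  (velocity vt a == velocity vt' b) = (vt == vt') && (a == b).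
Proof.
rewrite /velocity; case: vt; case: vt' => /=.
- by rewrite JetEta_eq eqxx andbT.
- by apply/negbTE/eqP.
- by apply/negbTE/eqP.
- by rewrite JetEtat_eq eqxx andbT.
Qed.

Lemma sum_kron (f : 'I_m -> R) a : \sum_b f b * (b == a)%:R = f a.
Proof.
rewrite (bigD1 a)//= eqxx mulr1 big1 ?addr0// => b /negbTE ->.
by rewrite mulr0.
Qed.

Variables (vt : bool) (L0 : 'I_m -> ('I_m -> R) -> R)
  (L1 : 'I_n -> 'I_m -> ('I_m -> R) -> R) (H : ('I_m -> R) -> R).
Hypotheses (sL0 : forall a, smooth (L0 a)) (sL1 : forall i a, smooth (L1 i a))
  (sH : smooth H).
Local Notation lag := (lagrangian (velocity vt) L0 L1 H).

Lemma pd_lagrangian_jz a u : pd (JetZ a mindex0) lag u =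
  \sum_b pd a (L0 b) (jz u) * u (velocity vt b)
  + \sum_i \sum_b pd a (L1 i b) (jz u) * u (Zx i b) - pd a H (jz u).
Proof.
have jzu r : jz [eta u with JetZ a mindex0 |-> r] = [eta jz u with a |-> r].
  by apply/funext => b; rewrite /jz /= JetZ_eq eqxx andbT.
have dF f : smooth f -> is_derive (jz u a) 1
    (fun r : R => f (jz [eta u with JetZ a mindex0 |-> r])) (pd a f (jz u)).
  move=> sf; rewrite /pd derive1E.
  rewrite (_ : (fun r : R => f (jz _)) = (fun r : R => f [eta jz u with a |-> r])).
    by apply/derivableP; exact: (@smooth_in_derivable _ _ xpredT f a (jz u) sf isT).
  by apply/funext => r; rewrite jzu.
have dcst c f : c != JetZ a mindex0 -> smooth f -> is_derive (jz u a) 1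
    (fun r : R => f (jz [eta u with JetZ a mindex0 |-> r]) *
      [eta u with JetZ a mindex0 |-> r] c) (pd a f (jz u) * u c).
  move=> cz sf; have := is_deriveM (dF f sf) (is_derive_cst (u c) (jz u a) 1).
  move=> dd; rewrite (_ : (fun r : R => _) =
    (fun r : R => f (jz [eta u with JetZ a mindex0 |-> r])) * cst (u c)).
    by apply: is_derive_eq dd _; rewrite /GRing.scale/=; ring.
  by apply/funext => r; rewrite /= (negbTE cz).
rewrite [LHS]derive1E; apply: derive_val.
apply: is_deriveB; last exact: (dF _ sH).
apply: is_deriveD.
  apply: is_derive_bigsum => b; apply: dcst; last exact: sL0.
  by rewrite velocity_JetZ.
apply: is_derive_bigsum => i; apply: is_derive_bigsum => b.
apply: dcst; last exact: sL1.
by rewrite /Zx JetZ_eq mindexS_neq0 andbF.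
Qed.

Lemma pd_lagrangian_linear c u : (forall a, JetZ a mindex0 != c) ->
  pd c lag u = \sum_b L0 b (jz u) * (velocity vt b == c)%:R
    + \sum_i \sum_b L1 i b (jz u) * (Zx i b == c)%:R.
Proof.
move=> hc.
have jzu r : jz [eta u with c |-> r] = jz u.
  by apply/funext => b; rewrite /jz /= (negbTE (hc b)).
have dF (f : ('I_m -> R) -> R) : is_derive (u c) 1
    (fun r : R => f (jz [eta u with c |-> r])) 0.
  rewrite (_ : (fun r : R => _) = cst (f (jz u))); first exact: is_derive_cst.
  by apply/funext => r; rewrite jzu.
have dl c' (f : ('I_m -> R) -> R) : is_derive (u c) 1
    (fun r : R => f (jz [eta u with c |-> r]) * [eta u with c |-> r] c')
    (f (jz u) * (c' == c)%:R).
  have d1 : is_derive (u c) 1 (fun r : R => [eta u with c |-> r] c') (c' == c)%:R.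
    by rewrite /=; case: (c' == c); [exact: is_derive_id|exact: is_derive_cst].
  have dd := is_deriveM (dF f) d1.
  by apply: is_derive_eq dd _; rewrite /GRing.scale/= jzu; ring.
rewrite [LHS]derive1E -[RHS]subr0; apply: derive_val.
apply: is_deriveB.
apply: is_deriveD; first by apply: is_derive_bigsum => b; exact: dl.
by apply: is_derive_bigsum => i; apply: is_derive_bigsum => b; exact: dl.
Qed.

Lemma pd_lagrangian_velocity vt' a u :
  pd (velocity vt' a) lag u = (vt == vt')%:R * L0 a (jz u).
Proof.
rewrite pd_lagrangian_linear => [|b]; last by rewrite eq_sym velocity_JetZ.
rewrite [X in _ + X]big1 ?addr0 => [|i _]; last first.
  by apply: big1 => b _; rewrite /Zx eq_sym velocity_JetZ mulr0.
rewrite -(sum_kron (fun b => L0 b (jz u))) big_distrr/=.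
apply: eq_bigr => b _; rewrite velocity_eq.
by case: (vt == vt'); case: (b == a); rewrite /= ?mulr0 ?mulr1 ?mul1r ?mul0r.
Qed.

Lemma pd_lagrangian_Zx i a u : pd (Zx i a) lag u = L1 i a (jz u).
Proof.
rewrite pd_lagrangian_linear => [|b]; last first.
  by rewrite /Zx JetZ_eq [mindex0 == _]eq_sym mindexS_neq0 andbF.
rewrite big1 ?add0r => [|b _]; last by rewrite /Zx velocity_JetZ mulr0.
rewrite (bigD1 i)//= [X in _ + X]big1 ?addr0 => [|j ji].
  rewrite -[RHS](sum_kron (fun b => L1 i b (jz u))); apply: eq_bigr => b _.
  by rewrite /Zx JetZ_eq eqxx andbT.
by apply: big1 => b _; rewrite /Zx JetZ_eq mindexS0_inj (negbTE ji) andbF mulr0.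
Qed.

Lemma Xact_lagrangian (Q PP PPt : 'I_m -> jet -> R) u : Xact Q PP PPt lag u =
  \sum_a Q a u * (\sum_b pd a (L0 b) (jz u) * u (velocity vt b)
    + \sum_i \sum_b pd a (L1 i b) (jz u) * u (Zx i b) - pd a H (jz u))
  + \sum_i \sum_a L1 i a (jz u) * tder i (Q a) u
  + \sum_a L0 a (jz u) * (if vt then PP a u else PPt a u).
Proof.
rewrite /Xact -addrA; congr (_ + _ + _).
- by apply: eq_bigr => a _; congr (_ * _); exact: pd_lagrangian_jz.
- apply: eq_bigr => i _; apply: eq_bigr => a _; rewrite mulrC; congr (_ * _).
  exact: pd_lagrangian_Zx.
rewrite -big_split/=; apply: eq_bigr => a _.
have -> : pd (JetEta a mindex0) lag u = (vt == true)%:R * L0 a (jz u).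
  exact: (pd_lagrangian_velocity true).
have -> : pd (JetEtat a mindex0) lag u = (vt == false)%:R * L0 a (jz u).
  exact: (pd_lagrangian_velocity false).
by case: (vt) => /=; ring.
Qed.

(** The symmetry turns the divergence of [B] into [Xact]; the terms [L1 * tder Q] cancel and the
    derivatives of [L1] pair up into its curl. The derivatives of [L0] are left without their
    antisymmetric partner, which only the chain rule for L0(z) in time supplies. *)
Lemma symmetry_flux (Q PP PPt : 'I_m -> jet -> R) (B : 'I_n -> jet -> R) u :
  div_symmetry Q PP PPt lag B ->
  \sum_i (\sum_a ((\sum_b u (Zx i b) * pd b (L1 i a) (jz u)) * Q a u
                  + L1 i a (jz u) * tder i (Q a) u) - tder i (B i) u) =
  - \sum_a Q a u * (\sum_b pd a (L0 b) (jz u) * u (velocity vt b)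
      + \sum_i \sum_b curl (L1 i) a b (jz u) * u (Zx i b) - pd a H (jz u))
  - \sum_a L0 a (jz u) * (if vt then PP a u else PPt a u).
Proof.
move=> sym; rewrite sumrB -(sym u) Xact_lagrangian.
set M := \sum_i \sum_a L1 i a _ * _; set s3 := \sum_a L0 a _ * _.
have -> : \sum_i \sum_a ((\sum_b u (Zx i b) * pd b (L1 i a) (jz u)) * Q a u
                  + L1 i a (jz u) * tder i (Q a) u) =
    \sum_a Q a u * (\sum_i \sum_b pd b (L1 i a) (jz u) * u (Zx i b)) + M.
  rewrite /M; under eq_bigr do rewrite big_split/=.
  rewrite big_split/=; congr (_ + _); rewrite exchange_big/=.
  apply: eq_bigr => a _; rewrite -big_distrl/= mulrC; congr (_ * _).
  by apply: eq_bigr => i _; apply: eq_bigr => b _; rewrite mulrC.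
have alg (s1 A S2 : R) : s1 - A = - S2 -> s1 + M - (A + M + s3) = - S2 - s3.
  by move=> <-; ring.
apply: alg; rewrite -sumrB -sumrN; apply: eq_bigr => a _.
have -> : \sum_i \sum_b curl (L1 i) a b (jz u) * u (Zx i b) =
    \sum_i \sum_b pd a (L1 i b) (jz u) * u (Zx i b)
    - \sum_i \sum_b pd b (L1 i a) (jz u) * u (Zx i b).
  rewrite -sumrB; apply: eq_bigr => i _; rewrite -sumrB; apply: eq_bigr => b _.
  by rewrite /curl mulrBl.
set x1 := \sum_i \sum_b pd b _ _ * _; set x2 := \sum_i \sum_b pd a _ _ * _.
set x3 := \sum_b _; set x4 := pd a H _; ring.
Qed.

End LagrangianSymmetry.

(** * Processes along the paths *)

Section CompositionWithFields.
Context {R : realType} {d : measure_display} {Omega : measurableType d}.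
Variables (P : probability Omega R) (W : R -> Omega -> R).
Context {C : eqType}.
Implicit Types (F : (C -> R) -> R) (s : seq C).

(** As [N] has countably many values, a preimage is a countable union of pieces on each of which [N]
    is constant. *)
Lemma fmeas_glue t (N : Omega -> int) (X : int -> Omega -> R) :
  (forall p, filtration P W t [set w | N w = p]) ->
  (forall p, fmeas P W t (X p)) -> fmeas P W t (fun w => X (N w) w).
Proof.
move=> mN mX B mB.
have [_ _ fU] := filtration_sigma_algebra P W t.
have fI : forall A B, filtration P W t A -> filtration P W t B ->
    filtration P W t (A `&` B).
  have := sigma_algebra_id (filtration_sigma_algebra P W t) => E A1 A2.
  rewrite -E; exact: (@measurableI _ (g_sigma_algebraType (filtration P W t))).
have -> : (fun w => X (N w) w) @^-1` B =
    \bigcup_k (if unpickle k is Some p then [set w | N w = p] `&` (X p @^-1` B)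
               else set0).
  apply/seteqP; split => w /=.
    by move=> h; exists (pickle (N w)) => //; rewrite pickleK.
  by move=> [k _]; case: unpickle => [p [<-]|].
apply: fU => k; case: unpickle => [p|].
  by apply: fI; [exact: mN|exact: mX].
by have [] := filtration_sigma_algebra P W t.
Qed.

(** Induction on the number of random coordinates: one of them is rounded down to a multiple of
    [1 / k.+1], where [fmeas_glue] makes it constant, and continuity of [F] lets [k] tend to
    infinity. *)
Lemma fmeas_continuous s t F (X : C -> Omega -> R) : depends_on s F ->
  continuous (F : {ptws C -> R} -> R) -> (forall c, c \in s -> fmeas P W t (X c)) ->
  fmeas P W t (fun w => F (fun c => X c w)).
Proof.
move=> dF cF mX.
have key (L : seq C) (Y : C -> Omega -> R) : (forall c, c \in L -> fmeas P W t (Y c)) ->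
    (forall c, c \notin L -> exists k, forall w, Y c w = k) ->
    fmeas P W t (fun w => F (fun c => Y c w)).
  elim: L Y => [|c L IH] Y mY kY.
    rewrite (_ : (fun w => _) = fun=> F (fun c => Y c point)).
      exact: fmeas_cst.
    apply/funext => w; congr F; apply/funext => c.
    by have [k hk] := kY c isT; rewrite !hk.
  pose N (k : nat) w : int := Num.floor (k.+1%:R * Y c w).
  pose Z (k : nat) (p : int) c' w : R := if c' == c then p%:~R / k.+1%:R else Y c' w.
  apply: (fmeas_lim (X := fun k w => F (fun c' => Z k (N k w) c' w))) => [k|w].
    apply: (fmeas_glue (N := N k) (X := fun p w => F (fun c' => Z k p c' w))) => p.
      have -> : [set w | N k w = p] =
          (fun w => k.+1%:R * Y c w) @^-1` `[p%:~R, (p + 1)%:~R[%classic.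
        apply/seteqP; split => w /=; rewrite in_itv/=.
          by move=> <-; rewrite floor_le_tmp lt_succ_floor.
        by move=> h; apply: floor_def.
      have h : fmeas P W t (fun w => k.+1%:R * Y c w).
        by apply: fmeasM; [exact: fmeas_cst|apply: mY; exact: mem_head].
      by apply: h; exact: measurable_itv.
    apply: IH => c' c'L; rewrite /Z; case: eqP => [_|c'c].
    - exact: fmeas_cst.
    - by apply: mY; rewrite inE c'L orbT.
    - by exists (p%:~R / k.+1%:R).
    - by apply: kY; rewrite inE negb_or c'L andbT; exact/eqP.
  apply: (cvg_comp (fun k c' => Z k (N k w) c' w)
    (F : {ptws C -> R} -> R) _ (cF (fun c => Y c w))).
  apply: ptws_cvg => c'; rewrite /Z; case: eqP => [->|_]; last exact: cvg_cst.
  apply/cvgrPdist_lt => e e0; near=> k.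
  have k0 : 0 < k.+1%:R :> R by rewrite ltr0n.
  have h1 : (N k w)%:~R <= k.+1%:R * Y c w by exact: floor_le_tmp.
  have h2 : k.+1%:R * Y c w < (N k w + 1)%:~R by exact: lt_succ_floor.
  have -> : Y c w - (N k w)%:~R / k.+1%:R = (k.+1%:R * Y c w - (N k w)%:~R) / k.+1%:R.
    by rewrite mulrBl [k.+1%:R * _]mulrC mulfK// pnatr_eq0.
  rewrite normrM ger0_norm ?subr_ge0// gtr0_norm ?invr_gt0//.
  apply: (@le_lt_trans _ _ (1 / k.+1%:R)).
    rewrite ler_pM2r ?invr_gt0//.
    by move: h2; rewrite intrD; lra.
  by rewrite div1r; near: k; exact: near_infty_natSinv_lt (PosNum e0).
pose Y c w := if c \in s then X c w else 0.
rewrite (_ : (fun w => _) = (fun w => F (fun c => Y c w))).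
  apply: (key s) => c cs; rewrite /Y ?cs; first exact: mX.
  by exists 0; rewrite (negbTE cs).
by apply/funext => w; apply: dF => c cs; rewrite /Y cs.
Unshelve. all: by end_near. Qed.

Lemma within_continuous_comp s F (A : set R) (v : R -> C -> R) : depends_on s F ->
  continuous (F : {ptws C -> R} -> R) ->
  (forall c, c \in s -> {within A, continuous (fun t => v t c)}) ->
  {within A, continuous (fun t => F (v t))}.
Proof.
move=> dF cF cv; apply/subspace_continuousP => t At; apply/cvgrPdist_lt => e e0.
have [del del0 hdel] := depends_on_continuous dF (cF (v t)) e0.
have : forall L : seq C, {subset L <= s} ->
    \forall r \near within A (nbhs t), forall c, c \in L -> `|v r c - v t c| < del.
  elim=> [_|c L IH Ls]; first exact: nearW.
  have h1 := IH (fun c' h => Ls c' (mem_behead (s := c :: L) h)).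
  have /subspace_continuousP/(_ t At)/cvgrPdist_lt/(_ _ del0) h2 :=
    cv c (Ls c (mem_head _ _)).
  near=> r => c'; rewrite inE => /predU1P[->|c'L].
    by rewrite distrC; near: r.
  by move: c' c'L; near: r.
move=> /(_ s (fun _ h => h)); apply: filterS => r hr.
by rewrite distrC; apply: hdel.
Unshelve. all: by end_near. Qed.

End CompositionWithFields.

(** * Taylor estimates, uniform along a continuous path *)

Section UniformExpansions.
Context {R : realType}.
Variable T : R.

Section Taylor.
Context {m : nat}.
Implicit Types (f : ('I_m -> R) -> R) (u v w : 'I_m -> R).

Let smooth_expansion f u : smooth f -> forall e : R, 0 < e ->
  exists2 del : R, 0 < del & forall v w,
    (forall c, `|v c - u c| < del) -> (forall c, `|w c - u c| < del) ->
    `|f w - f v - \sum_c (w c - v c) * pd c f v| <= e * \sum_c `|w c - v c|.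
Proof.
move=> sf e e0; have [|del del0 h] := strict_expansion (u := u)
  (index_enum_uniq _) (depends_on_all f) _ e0 (S := xpredT).
  by move=> c _ _; exact: (@smooth_in_partials _ _ xpredT).
by exists del => // v w hv hw; apply: h.
Qed.

(** The trapezoidal rule is exact for quadratic functions. Along the segment from [v] to [w], the
    slope of [f] is affine up to [e / 2 * D ^+ 2], so [f] differs from a quadratic by an error of
    that order. *)
Lemma trapezoid_expansion f u : smooth f -> forall e : R, 0 < e ->
  exists2 del : R, 0 < del & forall v w,
    (forall c, `|v c - u c| < del) -> (forall c, `|w c - u c| < del) ->
    `|f w - f v - \sum_c (pd c f v + pd c f w) / 2 * (w c - v c)| <=
      e * (\sum_c `|w c - v c|) ^+ 2.
Proof.
move=> sf e e0; have e20 : 0 < e / 2 by rewrite divr_gt0.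
have [del del0 hdel] : exists2 del : R, 0 < del & forall c v w,
    (forall c, `|v c - u c| < del) -> (forall c, `|w c - u c| < del) ->
    `|pd c f w - pd c f v - \sum_d (w d - v d) * pd d (pd c f) v| <=
      e / 2 * \sum_d `|w d - v d|.
  have : forall l : seq 'I_m, exists2 del : R, 0 < del & forall c, c \in l -> forall v w,
      (forall c, `|v c - u c| < del) -> (forall c, `|w c - u c| < del) ->
      `|pd c f w - pd c f v - \sum_d (w d - v d) * pd d (pd c f) v| <=
        e / 2 * \sum_d `|w d - v d|.
    elim=> [|c l [d1 d10 h1]]; first by exists 1.
    have [d2 d20 h2] := smooth_expansion u (smooth_pd c sf) e20.
    exists (Num.min d1 d2) => [|c' + v w hv hw]; first by rewrite lt_min d10.
    have hv1 a : `|v a - u a| < d1 by have := hv a; rewrite lt_min => /andP[].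
    have hv2 a : `|v a - u a| < d2 by have := hv a; rewrite lt_min => /andP[].
    have hw1 a : `|w a - u a| < d1 by have := hw a; rewrite lt_min => /andP[].
    have hw2 a : `|w a - u a| < d2 by have := hw a; rewrite lt_min => /andP[].
    by rewrite inE => /predU1P[->|c'l]; [exact: h2|exact: h1].
  move=> /(_ (index_enum 'I_m))[del del0 h]; exists del => // c.
  exact: (h c (mem_index_enum c)).
exists del => // v w hv hw.
pose D : R := \sum_c `|w c - v c|; have D0 : 0 <= D by apply: sumr_ge0.
pose x (r : R) c := v c + r * (w c - v c).
have x0 : x 0 = v by apply/funext => c; rewrite /x mul0r addr0.
have x1 : x 1 = w by apply/funext => c; rewrite /x mul1r addrC subrK.
have xu r : 0 <= r <= 1 -> forall c, `|x r c - u c| < del.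
  move=> /andP[r0 r1] c; have := hv c; have := hw c.
  rewrite !ltr_norml => /andP[a1 a2] /andP[a3 a4].
  have -> : x r c - u c = (1 - r) * (v c - u c) + r * (w c - u c) by rewrite /x; ring.
  have [->|rn0] := eqVneq r 0; first by rewrite subr0 mul1r mul0r addr0 a3 a4.
  have rp : 0 < r by rewrite lt_neqAle eq_sym rn0.
  have b1 : r * - del < r * (w c - u c) by rewrite ltr_pM2l.
  have b2 : r * (w c - u c) < r * del by rewrite ltr_pM2l.
  have r1' : 0 <= 1 - r by rewrite subr_ge0.
  have b3 : (1 - r) * - del <= (1 - r) * (v c - u c) by rewrite ler_wpM2l// ltW.
  have b4 : (1 - r) * (v c - u c) <= (1 - r) * del by rewrite ler_wpM2l// ltW.
  by apply/andP; split; lra.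
pose g (r : R) : R := f (x r).
pose g' (r : R) : R := \sum_c (w c - v c) * pd c f (x r).
have dg (r : R) : is_derive r 1 g (g' r).
  apply: (@chain_rule R _ (index_enum 'I_m) xpredT f x (fun c => w c - v c) r
    (index_enum_uniq _) (depends_on_all f)) => //.
  - by move=> c _ _; exact: (@smooth_in_partials _ _ xpredT).
  - move=> c _; rewrite /x.
    have := is_deriveD (is_derive_cst (v c) r 1)
      (is_deriveM (is_derive_id r (1 : R)) (is_derive_cst (w c - v c) r 1)).
    by move=> dd; apply: is_derive_eq dd _; rewrite /GRing.scale/=; ring.
pose A : R := \sum_c (w c - v c) * \sum_d (w d - v d) * pd d (pd c f) v.
have g'A r : 0 <= r <= 1 -> `|g' r - g' 0 - r * A| <= e / 2 * D ^+ 2.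
  move=> r01; have /andP[r0 r1] := r01.
  have -> : g' r - g' 0 - r * A = \sum_c (w c - v c) *
      (pd c f (x r) - pd c f v - \sum_d (x r d - v d) * pd d (pd c f) v).
    rewrite /g' /A x0 big_distrr/= -!sumrB; apply: eq_bigr => c _.
    have -> : \sum_d (x r d - v d) * pd d (pd c f) v =
        r * \sum_d (w d - v d) * pd d (pd c f) v.
      rewrite big_distrr/=; apply: eq_bigr => k _; rewrite /x.
      by rewrite [v k + _]addrC addrK mulrA.
    set b1 := pd c f _; set b2 := pd c f _; set b3 := \sum_d _; ring.
  apply: le_trans (ler_norm_sum _ _ _) _.
  apply: (@le_trans _ _ (\sum_c `|w c - v c| * (e / 2 * D))).
    apply: ler_sum => c _; rewrite normrM ler_wpM2l//.
    apply: le_trans (hdel c v (x r) hv (xu r r01)) _.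
    rewrite ler_wpM2l ?(ltW e20)//; apply: ler_sum => k _.
    rewrite /x [v k + _]addrC addrK normrM ger0_norm//.
    by rewrite ler_piMl.
  by rewrite -big_distrl/= -/D; rewrite mulrCA -expr2.
(* A local function, [g] minus its quadratic model, not the convex function used for martingales. *)
pose psi (r : R) : R := g r - r * g' 0 - r ^+ 2 * (A / 2).
have dpsi (r : R) : is_derive r 1 psi (g' r - g' 0 - r * A).
  have d1 := is_deriveM (is_derive_id r (1 : R)) (is_derive_cst (g' 0) r 1).
  have d2 := is_deriveM (is_deriveM (is_derive_id r (1 : R)) (is_derive_id r (1 : R)))
    (is_derive_cst (A / 2) r 1).
  have dd := is_deriveB (is_deriveB (dg r) d1) d2.
  rewrite (_ : psi = g - id * cst (g' 0) - id * id * cst (A / 2)).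
    by apply: is_derive_eq dd _; rewrite /GRing.scale/=; field.
  by apply/funext.
have [|xi hxi exi] := @mean_value _ psi 0 1; first by move=> r; case: (dpsi r).
have xi01 : 0 <= xi <= 1.
  by move: hxi; rewrite min_l ?max_r.
have psi1 : `|psi 1 - psi 0| <= e / 2 * D ^+ 2.
  rewrite exi subr0 mul1r derive1E; have [_ ->] := dpsi xi; exact: g'A.
have g1A := g'A 1 (introT andP (conj ler01 (lexx 1))).
have -> : \sum_c (pd c f v + pd c f w) / 2 * (w c - v c) = (g' 0 + g' 1) / 2.
  rewrite /g' x0 x1 -big_split/= mulrC big_distrr/=; apply: eq_bigr => c _; by field.
have -> : f w - f v - (g' 0 + g' 1) / 2 =
    (psi 1 - psi 0) - (g' 1 - g' 0 - 1 * A) / 2.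
  by rewrite /psi /g x0 x1; field.
rewrite (le_trans (ler_normB _ _))// normrM (ger0_norm (_ : 0 <= 2^-1))//.
have : 0 <= D ^+ 2 by exact: sqr_ge0.
have : 0 <= e * D ^+ 2 by rewrite mulr_ge0 ?sqr_ge0 ?(ltW e0).
rewrite -/D; move: psi1 g1A; lra.
Qed.

Variables (zt : R -> 'I_m -> R).
Hypothesis cz : forall b, {within `[0, T], continuous (fun t => zt t b)}.

Let zt_near s0 (del : R) : 0 <= s0 <= T -> 0 < del -> exists2 r : R, 0 < r &
  forall s, 0 <= s <= T -> `|s - s0| < r -> forall b, `|zt s b - zt s0 b| < del.
Proof.
move=> s0T del0.
have : forall l : seq 'I_m, exists2 r : R, 0 < r & forall b, b \in l ->
    forall s, 0 <= s <= T -> `|s - s0| < r -> `|zt s b - zt s0 b| < del.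
  elim=> [|b l [r1 r10 h1]]; first by exists 1.
  have /subspace_continuousP/(_ s0) := @cz b.
  rewrite /= in_itv/= => /(_ s0T)/cvgrPdist_lt/(_ _ del0)[r2 /= r20 h2].
  exists (Num.min r1 r2) => [|b' + s sT]; first by rewrite lt_min r10.
  rewrite lt_min inE => + /andP[ss1 ss2] => /predU1P[->|b'l]; last exact: h1.
  rewrite distrC; apply: h2 => /=; last by rewrite in_itv.
  by rewrite distrC.
move=> /(_ (index_enum 'I_m))[r r0 h]; exists r => // s sT ss b.
exact: (h b (mem_index_enum b)).
Qed.

(** The radius of the expansion depends on its base point; on the compact image of a continuous path
    [segment_uniform] makes it uniform in time. *)
Lemma path_expansion f : smooth f -> forall e : R, 0 < e ->
  exists2 del : R, 0 < del & forall s u : R, 0 <= s <= T -> 0 <= u <= T ->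
    `|s - u| < del -> `|f (zt u) - f (zt s) -
      \sum_c (zt u c - zt s c) * pd c f (zt s)| <= e * \sum_c `|zt u c - zt s c|.
Proof.
move=> sf e e0; apply: segment_uniform => s0 s0T.
have [del del0 h] := smooth_expansion (zt s0) sf e0.
have [r r0 hr] := zt_near s0T del0.
by exists r => // s u sT uT ss us; apply: h => c; apply: hr.
Qed.

Lemma path_trapezoid f : smooth f -> forall e : R, 0 < e ->
  exists2 del : R, 0 < del & forall s u : R, 0 <= s <= T -> 0 <= u <= T ->
    `|s - u| < del -> `|f (zt u) - f (zt s) -
      \sum_c (pd c f (zt s) + pd c f (zt u)) / 2 * (zt u c - zt s c)| <=
      e * (\sum_c `|zt u c - zt s c|) ^+ 2.
Proof.
move=> sf e e0; apply: segment_uniform => s0 s0T.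
have [del del0 h] := trapezoid_expansion (zt s0) sf e0.
have [r r0 hr] := zt_near s0T del0.
by exists r => // s u sT uT ss us; apply: h => c; apply: hr.
Qed.

End Taylor.

End UniformExpansions.

Section TimeIntegral.
Context {R : realType}.
Variable T : R.
Hypothesis T0 : 0 < T.
Local Notation mu := (@lebesgue_measure R).
Implicit Types f g : R -> R.

Definition primitive f (t : R) : R := \int[mu]_(s in `[0, t]) f s.

Lemma primitive0 f : primitive f 0 = 0.
Proof. by rewrite /primitive set_itv1 Rintegral_set1. Qed.

Lemma within_continuous_integrable f (t t' : R) : 0 <= t -> t' <= T ->
  {within `[0, T], continuous f} -> mu.-integrable `[t, t'] (EFin \o f).
Proof.
move=> t0 tT cf; apply: continuous_compact_integrable; first exact: segment_compact.
apply: continuous_subspaceW cf => r /=; rewrite !in_itv/= => /andP[h1 h2].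
by rewrite (le_trans t0 h1) (le_trans h2 tT).
Qed.

Lemma primitive_increment f (t t' c e : R) : {within `[0, T], continuous f} ->
  0 <= t -> t <= t' -> t' <= T ->
  (forall r, t <= r <= t' -> `|f r - c| <= e) ->
  `|primitive f t' - primitive f t - c * (t' - t)| <= e * (t' - t).
Proof.
move=> cf t0 tt' tT hf.
have i0 := within_continuous_integrable (lexx 0) tT cf.
have i1 := within_continuous_integrable t0 tT cf.
have ic k : mu.-integrable `[t, t'] (EFin \o (fun=> k : R)).
  apply: continuous_compact_integrable; first exact: segment_compact.
  by apply: continuous_subspaceT => r; exact: cvg_cst.
have len k : \int[mu]_(_ in `[t, t']) (k : R) = k * (t' - t).
  rewrite Rintegral_cst//; congr (_ * _); rewrite /= lebesgue_measure_itv/= lte_fin.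
  move: tt'; rewrite le_eqVlt => /predU1P[->|->]; last by rewrite -EFinB.
  by rewrite ltxx subrr.
have -> : primitive f t' - primitive f t = \int[mu]_(s in `[t, t']) f s.
  rewrite /primitive Rintegral_itvB//.
  rewrite Rintegral_itv_obnd_cbnd//; apply: integrableS i1 => //.
  by apply: subset_itvr; rewrite bnd_simp.
rewrite -len -RintegralB// -len.
have i2 : mu.-integrable `[t, t'] (EFin \o (fun r => f r - c)).
  by apply: (@integrableB _ _ _ _ _ _ _ _ i1 (ic c)).
apply: (@le_trans _ _ (\int[mu]_(r in `[t, t']) `|f r - c|)).
  by apply: le_normr_Rintegral.
apply: le_Rintegral => //; exact: integrable_norm.
Qed.

Lemma sum_increments (x : nat -> R) N : \sum_(k < N) (x k.+1 - x k) = x N - x 0%N.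
Proof.
elim: N => [|N IH]; first by rewrite big_ord0 subrr.
by rewrite big_ord_recr/= IH; ring.
Qed.

Lemma riemann_sum f : {within `[0, T], continuous f} -> forall e : R, 0 < e ->
  exists2 del : R, 0 < del & forall t N p, t <= T -> grid t N p ->
    (forall j, (j < N)%N -> p j.+1 - p j < del) ->
    `|\sum_(k < N) f (p k) * (p k.+1 - p k) - primitive f t| < e.
Proof.
move=> cf e e0; pose r := e / 2 / T; have r0 : 0 < r by rewrite !divr_gt0.
have [del del0 hd] := within_continuous_osc r0 cf.
exists del => // t N p tT g fine; have [p0 pN inc] := g.
have -> : primitive f t = \sum_(k < N) (primitive f (p k.+1) - primitive f (p k)).
  by rewrite (sum_increments (fun k => primitive f (p k))) p0 pN primitive0 subr0.
rewrite -sumrB; apply: le_lt_trans (ler_norm_sum _ _ _) _.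
apply: (@le_lt_trans _ _ (\sum_(k < N) r * (p k.+1 - p k))).
  apply: ler_sum => k _; have kN := ltn_ord k; rewrite distrC.
  have /andP[h1 h2] := grid_itvT g tT (ltnW kN).
  have /andP[h3 h4] := grid_itvT g tT kN.
  apply: primitive_increment => //; first exact/ltW/inc.
  move=> s /andP[s1 s2]; apply/ltW/hd.
  - by rewrite (le_trans h1 s1) (le_trans s2 h4).
  - by rewrite h1.
  by rewrite ger0_norm ?subr_ge0// (le_lt_trans _ (fine k kN))// lerD2r.
rewrite -big_distrr/= sum_increments p0 pN subr0.
have : r * t <= r * T by rewrite ler_wpM2l// ltW.
rewrite /r divfK ?gt_eqF//; lra.
Qed.

Lemma riemann_stieltjes_sum f g : {within `[0, T], continuous f} ->
  {within `[0, T], continuous g} -> forall e : R, 0 < e ->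
  exists2 del : R, 0 < del & forall t N p, t <= T -> grid t N p ->
    (forall j, (j < N)%N -> p j.+1 - p j < del) ->
    `|\sum_(k < N) (f (p k) + f (p k.+1)) / 2 *
        (primitive g (p k.+1) - primitive g (p k))
      - primitive (fun s => f s * g s) t| < e.
Proof.
move=> cf cg e e0.
have [Cf hCf] := within_continuous_bounded T0 cf.
have [Cg hCg] := within_continuous_bounded T0 cg.
have TT : (0 : R) <= 0 <= T by apply/andP; split=> //; exact: ltW.
have Cf0 : 0 <= Cf by exact: le_trans (normr_ge0 _) (hCf 0 TT).
have Cg0 : 0 <= Cg by exact: le_trans (normr_ge0 _) (hCg 0 TT).
have cfg : {within `[0, T], continuous (fun s => f s * g s)}.
  by move=> s; apply: cvgM; [exact: cf|exact: cg].
(* [Cf], [Cg] and 1 are the factors of the three errors made on a step, and [r * K * T] equals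
   [e / 2]. *)
pose K := Cf + Cg + 1; have K0 : 0 < K by rewrite ltr_pwDr// addr_ge0.
pose r := e / 2 / (K * T); have r0 : 0 < r by rewrite !divr_gt0// mulr_gt0.
have [d1 d10 hd1] := within_continuous_osc r0 cf.
have [d2 d20 hd2] := within_continuous_osc r0 cg.
have [d3 d30 hd3] := within_continuous_osc r0 cfg.
exists (Num.min d1 (Num.min d2 d3)) => [|t N p tT gr fine].
  by rewrite !lt_min d10 d20.
have [p0 pN inc] := gr.
have -> : primitive (fun s => f s * g s) t =
    \sum_(k < N) (primitive (fun s => f s * g s) (p k.+1)
                  - primitive (fun s => f s * g s) (p k)).
  rewrite (sum_increments (fun k => primitive (fun s => f s * g s) (p k))).
  by rewrite p0 pN primitive0 subr0.
rewrite -sumrB; apply: le_lt_trans (ler_norm_sum _ _ _) _.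
apply: (@le_lt_trans _ _ (\sum_(k < N) r * K * (p k.+1 - p k))).
  apply: ler_sum => k _; have kN := ltn_ord k.
  have T1 := grid_itvT gr tT (ltnW kN); have T2 := grid_itvT gr tT kN.
  have /andP[h1 h2] := T1; have /andP[h3 h4] := T2.
  have lt12 := inc k kN; have D0 : 0 <= p k.+1 - p k by rewrite subr_ge0 ltW.
  have := fine k kN; rewrite !lt_min => /andP[f1 /andP[f2 f3]].
  have sT s : p k <= s <= p k.+1 -> 0 <= s <= T.
    by move=> /andP[s1 s2]; rewrite (le_trans h1 s1) (le_trans s2 h4).
  have sd s dd : p k <= s <= p k.+1 -> p k.+1 - p k < dd -> `|s - p k| < dd.
    move=> /andP[s1 s2]; apply: le_lt_trans.
    by rewrite ger0_norm ?subr_ge0// lerD2r.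
  have a1 : `|primitive g (p k.+1) - primitive g (p k) - g (p k) * (p k.+1 - p k)|
      <= r * (p k.+1 - p k).
    apply: primitive_increment => //; first exact: ltW.
    by move=> s s12; apply/ltW/hd2 => //; [exact: sT|exact: sd].
  have a2 : `|primitive (fun s => f s * g s) (p k.+1)
      - primitive (fun s => f s * g s) (p k) - f (p k) * g (p k) * (p k.+1 - p k)|
      <= r * (p k.+1 - p k).
    apply: primitive_increment => //; first exact: ltW.
    by move=> s s12; apply/ltW/hd3 => //; [exact: sT|exact: sd].
  have a3 : `|f (p k.+1) - f (p k)| < r.
    by apply: hd1 => //; apply: sd f1; rewrite lexx ltW.
  have a4 : `|(f (p k) + f (p k.+1)) / 2| <= Cf.
    rewrite normrM (@ger0_norm _ 2^-1)// ler_pdivrMr//.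
    by rewrite (le_trans (ler_normD _ _))// mulr_natr mulr2n lerD// hCf.
  set F1 := primitive _ (p k.+1) in a2 *; set F0 := primitive _ (p k) in a2 *.
  set G1 := primitive g _ in a1 *; set G0 := primitive g _ in a1 *.
  have -> : (f (p k) + f (p k.+1)) / 2 * (G1 - G0) - (F1 - F0) =
     (f (p k) + f (p k.+1)) / 2 * (G1 - G0 - g (p k) * (p k.+1 - p k)) +
     (f (p k.+1) - f (p k)) / 2 * g (p k) * (p k.+1 - p k) -
     (F1 - F0 - f (p k) * g (p k) * (p k.+1 - p k)) by field.
  have b1 : `|(f (p k) + f (p k.+1)) / 2 * (G1 - G0 - g (p k) * (p k.+1 - p k))|
      <= Cf * (r * (p k.+1 - p k)) by rewrite normrM ler_pM.
  have b2 : `|(f (p k.+1) - f (p k)) / 2 * g (p k) * (p k.+1 - p k)|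
      <= r * Cg * (p k.+1 - p k).
    rewrite normrM (ger0_norm D0) ler_wpM2r// normrM ler_pM ?hCg//.
    rewrite normrM (@ger0_norm _ 2^-1)//; have := normr_ge0 (f (p k.+1) - f (p k)).
    by move: a3; lra.
  apply: le_trans (ler_normB _ _) _.
  apply: le_trans (lerD (ler_normD _ _) (lexx _)) _.
  apply: le_trans (lerD (lerD b1 b2) a2) _.
  by rewrite le_eqVlt; apply/orP; left; apply/eqP; rewrite /K; ring.
rewrite -big_distrr/= sum_increments p0 pN subr0.
have : r * K * t <= r * K * T by rewrite ler_wpM2l// mulr_ge0// ltW.
have -> : r * K * T = e / 2 by rewrite /r; field; rewrite !gt_eqF.
lra.
Qed.

End TimeIntegral.

Section TimeIntegralProcess.
Context {R : realType} {d : measure_display} {Omega : measurableType d}.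
Variables (P : probability Omega R) (W : R -> Omega -> R) (T : R).
Hypothesis T0 : 0 < T.
Implicit Types (a V : R -> Omega -> R) (p : nat -> R).

(** A property true for each outcome once the mesh is fine enough becomes uniform in probability:
    [whp_uniform] is indexed by the grids of mesh below [1 / k.+1]. *)
Lemma whp_fine (Phi : R -> nat -> (nat -> R) -> Omega -> Prop) :
  (forall t N p, t <= T -> grid t N p -> measurable [set w | ~ Phi t N p w]) ->
  (forall w, exists2 del : R, 0 < del & forall t N p, t <= T -> grid t N p ->
    (forall j, (j < N)%N -> p j.+1 - p j < del) -> Phi t N p w) ->
  forall e' : R, 0 < e' -> exists2 del : R, 0 < del & forall t N p, t <= T ->
    grid t N p -> (forall j, (j < N)%N -> p j.+1 - p j < del) ->
    whp P e' (Phi t N p).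
Proof.
move=> mPhi hPhi e' e'0.
pose D (k : nat) : set (R * nat * (nat -> R)) := [set i | [/\ i.1.1 <= T,
  grid i.1.1 i.1.2 i.2 & forall j, (j < i.1.2)%N -> i.2 j.+1 - i.2 j < k.+1%:R^-1]].
have inv_le k (x : R) : 0 < x -> (Num.truncn x^-1 <= k)%N -> k.+1%:R^-1 <= x.
  move=> x0 kx; rewrite -[leRHS]invrK lef_pV2 ?posrE ?invr_gt0 ?ltr0n//.
  by rewrite (le_trans (ltW (truncnS_gt _)))// ler_nat.
have [k hk] : exists k, forall i, D k i -> whp P e' (Phi i.1.1 i.1.2 i.2).
  apply: (whp_uniform (Phi := fun i => Phi i.1.1 i.1.2 i.2)) => //.
  - move=> k [[t N] p] [/= tT g fine]; split => // j jN.
    rewrite (lt_le_trans (fine j jN))// lef_pV2 ?posrE ?ltr0n//.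
    by rewrite ler_nat.
  - by move=> [[t N] p] [/= tT g _]; exact: mPhi.
  - apply: aeW => w; have [del del0 hd] := hPhi w.
    exists (Num.truncn del^-1) => -[[t N] p] [/= tT g fine].
    apply: hd => // j jN; apply: lt_le_trans (fine j jN) _.
    exact: inv_le.
exists k.+1%:R^-1 => [|t N p tT g fine]; first by rewrite invr_gt0 ltr0n.
exact: (hk (t, N, p)).
Qed.

(** The integral is a limit of Riemann sums over equidistant grids, so measurability of [a] at each
    fixed time suffices. *)
Lemma time_integral_measurable a t : adapted P W T a -> continuous_paths T a ->
  0 <= t <= T -> measurable_fun setT (time_integral a t).
Proof.
move=> aa ca /andP[t0 tT]; have [<-|tn0] := eqVneq 0 t.
  rewrite (_ : time_integral a 0 = fun=> 0); first exact: measurable_cst.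
  by apply/funext => w; exact: primitive0.
have tp : 0 < t by rewrite lt_neqAle tn0.
pose p (n k : nat) := t * (k%:R / n.+1%:R).
have n0 n : 0 < n.+1%:R :> R by rewrite ltr0n.
have step n k : p n k.+1 - p n k = t / n.+1%:R.
  by rewrite /p -mulrBr -mulrBl -[k.+1%:R]natr1 [k%:R + 1]addrC addrK mul1r.
have g n : grid t n.+1 (p n).
  split; first by rewrite /p mul0r mulr0.
    by rewrite /p divff ?mulr1// gt_eqF.
  by move=> j _; rewrite -subr_gt0 step divr_gt0.
apply: (@measurable_fun_cvg _ _ _ _
  (fun n w => \sum_(k < n.+1) a (p n k) w * (p n k.+1 - p n k))).
  move=> n; apply: measurable_sum => k; apply: measurable_funM => //.
  apply: (@fmeas_measurable _ _ _ P W (p n k)); apply: (adapted_fm aa).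
  by apply: (grid_itvT (g n) tT); exact: ltnW.
move=> w _; apply/cvgrPdist_lt => e e0.
have [del del0 hd] := riemann_sum T0 (ca w) e0.
near=> n; rewrite distrC; apply: hd => // j _; rewrite step.
rewrite ltr_pdivrMr// mulrC -ltr_pdivrMr//.
apply: lt_le_trans (truncnS_gt _) _; rewrite ler_nat ltnS.
by near: n; exists (Num.truncn (t / del)).
Unshelve. all: by end_near. Qed.

Lemma time_integral_good a : adapted P W T a -> continuous_paths T a ->
  good P W T (time_integral a).
Proof.
move=> aa ca; apply: bv_good.
  by move=> s sT; exact: time_integral_measurable.
apply: aeW => w; have [C hC] := within_continuous_bounded T0 (ca w).
have C0 : 0 <= C.
  by apply: le_trans (normr_ge0 _) (hC 0 _); rewrite lexx ltW.
exists (C * T) => t N p tT g; have [p0 pN inc] := g.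
apply: (@le_trans _ _ (\sum_(k < N) C * (p k.+1 - p k))).
  apply: ler_sum => k _; have kN := ltn_ord k.
  have /andP[h1 h2] := grid_itvT g tT (ltnW kN).
  have /andP[h3 h4] := grid_itvT g tT kN.
  have := @primitive_increment _ T (a ^~ w) (p k) (p k.+1) 0 C (ca w) h1
    (ltW (inc k kN)) h4.
  rewrite mul0r subr0; apply => r /andP[r1 r2]; rewrite subr0; apply: hC.
  by rewrite (le_trans h1 r1) (le_trans r2 h4).
rewrite -big_distrr/= sum_increments p0 pN subr0.
by rewrite ler_wpM2l.
Qed.

Lemma sum_avg_time_integral V a : adapted P W T V -> continuous_paths T V ->
  adapted P W T a -> continuous_paths T a -> forall e e' : R, 0 < e -> 0 < e' ->
  exists2 del : R, 0 < del & forall t N p, t <= T -> grid t N p ->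
    (forall j, (j < N)%N -> p j.+1 - p j < del) ->
    whp P e' (fun w => `|\sum_(k < N) (V (p k) w + V (p k.+1) w) / 2 *
        (time_integral a (p k.+1) w - time_integral a (p k) w)
      - time_integral (fun s w => V s w * a s w) t w| < e).
Proof.
move=> aV cV aa ca e e' e0 e'0; apply: whp_fine => //; last first.
  by move=> w; exact: (riemann_stieltjes_sum T0 (cV w) (ca w) e0).
move=> t N p tT g.
have tT' : 0 <= t <= T.
  by have := grid_itvT g tT (leqnn N); have [_ -> _] := g.
have mX X s : adapted P W T X -> 0 <= s <= T -> measurable_fun setT (X s).
  by move=> aX sT; apply: (@fmeas_measurable _ _ _ P W s); apply: (adapted_fm aX sT).
rewrite (_ : [set w | _] = [set w | e <= `|\sum_(k < N) (V (p k) w + V (p k.+1) w) / 2 *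
        (time_integral a (p k.+1) w - time_integral a (p k) w)
      - time_integral (fun s w => V s w * a s w) t w|]); last first.
  by apply/seteqP; split => w /=; rewrite leNgt => /negP.
apply: measurable_set_le => //; apply: measurableT_comp => //.
apply: measurable_funB.
  apply: measurable_sum => k; have kN := ltn_ord k.
  have T1 := grid_itvT g tT (ltnW kN); have T2 := grid_itvT g tT kN.
  apply: measurable_funM.
    by apply: measurable_funM => //; apply: measurable_funD; exact: mX.
  by apply: measurable_funB; exact: time_integral_measurable.
apply: time_integral_measurable => //.
  by move=> s B sT mB; exact: (fmeasM (adapted_fm aV sT) (adapted_fm aa sT) mB).
by move=> w s; apply: cvgM; [exact: (cV w)|exact: (ca w)].
Qed.

End TimeIntegralProcess.

(** * Stratonovich calculus *)

Section StratonovichToolbox.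
Context {R : realType} {d : measure_display} {Omega : measurableType d}.
Variables (P : probability Omega R) (W : R -> Omega -> R) (T : R).
Hypothesis T0 : 0 < T.
Local Notation fm := (fmeas P W).
Local Notation regular := (regular P W T).
Implicit Types (S X Y Z V a : R -> Omega -> R) (p : nat -> R).

(** The class of outer factors: continuous for every outcome but not assumed to be good integrators,
    which makes stability under products and smooth functions elementary. *)
Definition path_process X : Prop := adapted P W T X /\ continuous_paths T X.

Lemma path_processD X Y : path_process X -> path_process Y ->
  path_process (fun t w => X t w + Y t w).
Proof.
move=> [aX cX] [aY cY]; split.
  by move=> t B tT mB; exact: (fmeasD (adapted_fm aX tT) (adapted_fm aY tT) mB).
by move=> w s; apply: cvgD; [exact: (cX w)|exact: (cY w)].
Qed.

Lemma path_processM X Y : path_process X -> path_process Y ->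
  path_process (fun t w => X t w * Y t w).
Proof.
move=> [aX cX] [aY cY]; split.
  by move=> t B tT mB; exact: (fmeasM (adapted_fm aX tT) (adapted_fm aY tT) mB).
by move=> w s; apply: cvgM; [exact: (cX w)|exact: (cY w)].
Qed.

Lemma path_process_cst (c : R) : path_process (fun _ _ => c).
Proof.
split; first by move=> t B tT mB; exact: (fmeas_cst P W t c mB).
by move=> w s; exact: cvg_cst.
Qed.

Lemma path_processN X : path_process X -> path_process (fun t w => - X t w).
Proof.
move=> pX; have := path_processM (path_process_cst (-1)) pX.
by under eq_fun do under eq_fun do rewrite mulN1r.
Qed.

Lemma path_processB X Y : path_process X -> path_process Y ->
  path_process (fun t w => X t w - Y t w).
Proof. by move=> pX pY; exact: path_processD pX (path_processN pY). Qed.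

Lemma path_process_sum (I : Type) (r : seq I) (X : I -> R -> Omega -> R) :
  (forall i, path_process (X i)) ->
  path_process (fun t w => \sum_(i <- r) X i t w).
Proof.
move=> h; elim: r => [|i r IH].
  rewrite (_ : (fun t w => _) = fun _ _ => 0); first exact: path_process_cst.
  by apply/funext => t; apply/funext => w; rewrite big_nil.
rewrite (_ : (fun t w => _) = fun t w => X i t w + \sum_(i <- r) X i t w).
  exact: path_processD.
by apply/funext => t; apply/funext => w; rewrite big_cons.
Qed.

Lemma path_process_bounded X : path_process X -> as_bounded P T X.
Proof. by move=> [_ cX]; exact/(as_continuous_bounded T0)/continuous_paths_as. Qed.

Lemma path_process_regular X : path_process X -> good P W T X -> regular X.
Proof. by move=> [aX cX] gX; split => //; exact: continuous_paths_as. Qed.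

Lemma regular_tight X t : t <= T -> regular X -> tight P t (qvar X).
Proof.
move=> tT rX e' e'0; have [C C0 h] := regular_qv_tight T0 rX e'0.
exists C, 1 => // N p g _; apply: whpS (lexx _) _ (h t N p tT g) => w.
by rewrite ger0_norm ?qvar_ge0.
Qed.

Lemma adapted_measurable X s : adapted P W T X -> 0 <= s <= T ->
  measurable_fun setT (X s).
Proof.
by move=> aX sT; apply: (@fmeas_measurable _ _ _ P W s); apply: (adapted_fm aX sT).
Qed.

(** The increments of [X] are uniformly small by continuity, and the product of the other two is
    bounded by the sum of their squares. *)
Lemma vanish_cubic X Y Z t : t <= T -> adapted P W T X -> as_continuous P T X ->
  tight P t (qvar Y) -> tight P t (qvar Z) -> vanish P t (fun N p w =>
    \sum_(k < N) (X (p k.+1) w - X (p k) w) * (Y (p k.+1) w - Y (p k) w)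
      * (Z (p k.+1) w - Z (p k) w)).
Proof.
move=> tT aX cX tY tZ; apply: vanish_small (tightD tY tZ) _ => r e' r0 e'0.
have [del del0 h] := as_continuous_osc aX cX r0 e'0.
exists del => // N p g fine; apply: whpS (lexx _) _ (h t N p tT g) => w osc.
apply: le_trans (ler_norm_sum _ _ _) _.
rewrite (@ger0_norm _ (_ + _)) ?addr_ge0 ?qvar_ge0// /qvar -big_split/= big_distrr/=.
apply: ler_sum => k _; have kN := ltn_ord k.
have hX : `|X (p k.+1) w - X (p k) w| < r.
  apply: osc => //; first exact: ltnW.
  by have [_ _ inc] := g; rewrite gtr0_norm ?fine// subr_gt0 inc.
set x := X _ _ - _ in hX *; set y := Y _ _ - _; set v := Z _ _ - _.
rewrite -mulrA normrM ler_pM// ?(ltW hX)//.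
have g1 := sqr_ge0 (y - v); have g2 := sqr_ge0 (y + v).
rewrite (_ : (y - v) ^+ 2 = y ^+ 2 + v ^+ 2 - 2 * (y * v)) in g1; last by ring.
rewrite (_ : (y + v) ^+ 2 = y ^+ 2 + v ^+ 2 + 2 * (y * v)) in g2; last by ring.
have g3 := sqr_ge0 y; have g4 := sqr_ge0 v.
by rewrite ler_norml; apply/andP; split; move: g1 g2 g3 g4; lra.
Qed.

(** The increment of the product is [x * (y' - y) + y' * (x' - x)], where [x] and [y'] are bounded
    with high probability. *)
Lemma tight_qvar_mul X Y t : t <= T -> adapted P W T X -> as_bounded P T X ->
  adapted P W T Y -> as_bounded P T Y -> tight P t (qvar X) -> tight P t (qvar Y) ->
  tight P t (qvar (fun s w => X s w * Y s w)).
Proof.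
move=> tT aX bX aY bY tX tY e' e'0; pose b := e' / 4.
have b0 : 0 < b by rewrite divr_gt0.
have [C1 C10 h1] := adapted_whp_bounded aX bX b0.
have [C2 C20 h2] := adapted_whp_bounded aY bY b0.
have [K1 [d1 d10 k1]] := tX _ b0; have [K2 [d2 d20 k2]] := tY _ b0.
exists (2 * (C1 ^+ 2 * K2 + C2 ^+ 2 * K1)), (Num.min d1 d2).
  by rewrite lt_min d10.
move=> N p g /fine_min[f1 f2].
apply: whpS (whp_and (whp_and (h1 t N p tT g) (h2 t N p tT g))
  (whp_and (k1 N p g f1) (k2 N p g f2))); first by rewrite /b; lra.
move=> w [[m1 m2] [m3 m4]]; rewrite ger0_norm ?qvar_ge0//.
rewrite ger0_norm ?qvar_ge0// in m3; rewrite ger0_norm ?qvar_ge0// in m4.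
have step k : (k < N)%N -> (X (p k.+1) w * Y (p k.+1) w - X (p k) w * Y (p k) w) ^+ 2
    <= 2 * (C1 ^+ 2 * (Y (p k.+1) w - Y (p k) w) ^+ 2
            + C2 ^+ 2 * (X (p k.+1) w - X (p k) w) ^+ 2).
  move=> kN; set x := X (p k) w; set x' := X (p k.+1) w.
  set y := Y (p k) w; set y' := Y (p k.+1) w.
  have x2 : x ^+ 2 <= C1 ^+ 2.
    rewrite -(real_normK (num_real x)) lerXn2r ?nnegrE ?(ltW C10)//.
    by apply: m1; exact: ltnW.
  have y2 : y' ^+ 2 <= C2 ^+ 2.
    by rewrite -(real_normK (num_real y')) lerXn2r ?nnegrE ?(ltW C20)// m2.
  have i1 : x ^+ 2 * (y' - y) ^+ 2 <= C1 ^+ 2 * (y' - y) ^+ 2.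
    by rewrite ler_wpM2r// sqr_ge0.
  have i2 : y' ^+ 2 * (x' - x) ^+ 2 <= C2 ^+ 2 * (x' - x) ^+ 2.
    by rewrite ler_wpM2r// sqr_ge0.
  have := sqr_ge0 (x * (y' - y) - y' * (x' - x)).
  have -> : (x * (y' - y) - y' * (x' - x)) ^+ 2 =
    2 * (x ^+ 2 * (y' - y) ^+ 2 + y' ^+ 2 * (x' - x) ^+ 2)
    - (x' * y' - x * y) ^+ 2 by ring.
  by move: i1 i2; lra.
apply: (@le_trans _ _ (\sum_(k < N) 2 * (C1 ^+ 2 * (Y (p k.+1) w - Y (p k) w) ^+ 2
            + C2 ^+ 2 * (X (p k.+1) w - X (p k) w) ^+ 2))).
  by apply: ler_sum => k _; exact: step.
rewrite -big_distrr/= ler_wpM2l// big_split/= -!big_distrr/=.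
by rewrite lerD// ler_wpM2l ?sqr_ge0.
Qed.

(** A limit in probability may be altered on a null set. This lets an integral be replaced by the
    expression that an equation gives for it. *)
Lemma stratonovich_ae Y S t (I I' : Omega -> R) : t <= T ->
  (forall s, 0 <= s <= T -> measurable_fun setT (Y s)) ->
  (forall s, 0 <= s <= T -> measurable_fun setT (S s)) ->
  measurable_fun setT I' -> {ae P, forall w, I' w = I w} ->
  stratonovich P Y S t I -> stratonovich P Y S t I'.
Proof.
move=> tT mY mS mI' [N [mN PN sN]] [mI hI]; split => // e e' e0 e'0.
have [del del0 hd] := hI e e' e0 e'0; exists del => // s ps ms.
have g := itv_partition_grid ps.
have mtr : measurable_fun setT (trapezoid Y S s).
  rewrite (_ : trapezoid Y S s = trap Y S (fun j => nth 0 (0 :: s) j) (size s)).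
    exact: (measurable_trap tT g).
  by apply/funext => w; exact: trapezoidE.
have mset (J : Omega -> R) : measurable_fun setT J ->
    measurable [set w | e <= `|trapezoid Y S s w - J w|].
  move=> mJ; apply: measurable_set_le => //; apply: measurableT_comp => //.
  exact: measurable_funB.
have mA := mset _ mI; have mA' := mset _ mI'; have PA := hd s ps ms.
set A := [set w | _] in PA mA *; set A' := [set w | _] in mA' *.
have sub : A' `<=` A `|` N.
  move=> w; rewrite /A /A'/= => h; have [Nw|nN] := pselect (N w); [by right|left].
  suff <- : I' w = I w by [].
  by apply: contrapT => nI; apply: nN; apply: sN.
apply: (@le_trans _ _ (P (A `|` N))).
  by apply: le_measure; rewrite ?inE//; exact: measurableU.
apply: (@le_trans _ _ (P A + P N)%E); first exact: measureU2.
by rewrite PN adde0.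
Qed.

Lemma vanish_stratonovich Y S t (I : Omega -> R) : t <= T ->
  (forall s, 0 <= s <= T -> measurable_fun setT (Y s)) ->
  (forall s, 0 <= s <= T -> measurable_fun setT (S s)) ->
  measurable_fun setT I ->
  vanish P t (fun N p w => trap Y S p N w - I w) -> stratonovich P Y S t I.
Proof.
move=> tT mY mS mI v; split => // e e' e0 e'0.
have [del del0 hd] := v e e' e0 e'0; exists del => // s ps ms.
have g := itv_partition_grid ps.
have := whp_bound _ (hd _ _ g ms).
set A := [set w | ~ _]; set B := [set w | _ <= _].
have AB : A = B.
  by apply/seteqP; split => w; rewrite /A /B/= trapezoidE leNgt => /negP.
rewrite AB; apply; rewrite /B; apply: measurable_set_le => //.
apply: measurableT_comp => //; apply: measurable_funB => //.
rewrite (_ : trapezoid Y S s = trap Y S (fun j => nth 0 (0 :: s) j) (size s)).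
  exact: (measurable_trap tT g).
by apply/funext => w; exact: trapezoidE.
Qed.

Lemma integral_process_regular X a Y S : path_process X -> path_process a ->
  regular Y -> regular S ->
  (forall u, 0 <= u <= T -> stratonovich P Y S u
    (fun w => X u w - X 0 w - time_integral a u w)) -> regular X.
Proof.
move=> pX [aa ca] rY rS hX; apply: path_process_regular => //.
have gZ := strat_good T0 rY rS hX.
apply: good_ae (good_add gZ (time_integral_good T0 aa ca)) => u uT.
apply: aeW => w; have -> : time_integral a 0 w = 0 by exact: primitive0.
by ring.
Qed.

Section FunctionsOfProcesses.
Context {m : nat}.
Variable z : 'I_m -> R -> Omega -> R.
Hypothesis pz : forall b, path_process (z b).
Hypothesis rz : forall b, regular (z b).
Variable t : R.
Hypothesis tT : t <= T.
Implicit Types f : ('I_m -> R) -> R.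
Local Notation zat s w := (fun b => z b s w).

Lemma smooth_path_process f : smooth f -> path_process (fun s w => f (zat s w)).
Proof.
move=> sf; have cf := smooth_in_continuous sf; split.
  move=> s B sT mB; apply: (fmeas_continuous (depends_on_all f) cf _ mB) => b _.
  by have [az _] := pz b; exact: adapted_fm az sT.
move=> w; apply: (within_continuous_comp (depends_on_all f) cf (v := fun s b => z b s w)).
by move=> b _; have [_ cz] := pz b; exact: cz.
Qed.

Lemma sqr_sum_le (x : 'I_m -> R) :
  (\sum_c `|x c|) ^+ 2 <= m%:R * \sum_c x c ^+ 2.
Proof.
have -> : m%:R * \sum_c x c ^+ 2 = \sum_c \sum_e (x c ^+ 2 + x e ^+ 2) / 2.
  have e1 : \sum_c \sum_(e < m) (x c ^+ 2 + x e ^+ 2) =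
      \sum_c (m%:R * x c ^+ 2 + \sum_e x e ^+ 2).
    apply: eq_bigr => c _; rewrite big_split/= sumr_const card_ord.
    by rewrite -[X in X + _]mulr_natl.
  under [RHS]eq_bigr => c _ do rewrite -mulr_suml.
  rewrite -mulr_suml e1 big_split/= sumr_const card_ord -mulr_sumr.
  by rewrite -[X in _ + X]mulr_natl; field.
rewrite expr2 big_distrl/=; apply: ler_sum => c _; rewrite big_distrr/=.
apply: ler_sum => e _; rewrite -(real_normK (num_real (x c))).
rewrite -(real_normK (num_real (x e))); have := sqr_ge0 (`|x c| - `|x e|).
rewrite (_ : (`|x c| - `|x e|) ^+ 2 =
  `|x c| ^+ 2 + `|x e| ^+ 2 - 2 * (`|x c| * `|x e|)); last by ring.
by lra.
Qed.

Lemma sum_sqr_increments_le N p w :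
  \sum_(k < N) (\sum_c `|z c (p k.+1) w - z c (p k) w|) ^+ 2 <=
  m%:R * \sum_c qvar (z c) N p w.
Proof.
apply: (@le_trans _ _ (\sum_(k < N) m%:R * \sum_c (z c (p k.+1) w - z c (p k) w) ^+ 2)).
  by apply: ler_sum => k _; exact: sqr_sum_le.
by rewrite -big_distrr/= exchange_big.
Qed.

Lemma tight_sum_qvar : tight P t (fun N p w => m%:R * \sum_c qvar (z c) N p w).
Proof.
apply: tightM; first exact: tight_cst.
by apply: tight_sum => c; exact: regular_tight.
Qed.

Lemma path_process_bounded_fin (X : 'I_m -> R -> Omega -> R) :
  (forall c, path_process (X c)) -> forall e, 0 < e -> exists2 C : R, 0 < C &
    forall N p, grid t N p ->
      whp P e (fun w => forall c j, (j <= N)%N -> `|X c (p j) w| <= C).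
Proof.
move=> pX e e0.
have : forall l : seq 'I_m, forall e : R, 0 < e -> exists2 C : R, 0 < C &
    forall N p, grid t N p -> whp P e (fun w => forall c, c \in l ->
      forall j, (j <= N)%N -> `|X c (p j) w| <= C).
  elim=> [e1 e10|c l IH e1 e10].
    by exists 1 => // N p _; apply: whp_true => //; exact: ltW.
  have e120 : 0 < e1 / 2 by rewrite divr_gt0.
  have [C1 C10 h1] := IH _ e120; have [ac _] := pX c.
  have [C2 C20 h2] := adapted_whp_bounded ac (path_process_bounded (pX c)) e120.
  exists (Num.max C1 C2) => [|N p g]; first by rewrite lt_max C10.
  apply: whpS (whp_and (h1 N p g) (h2 t N p tT g)); first by rewrite -splitr.
  move=> w [k1 k2] c'; rewrite inE => /predU1P[->|c'l] j jN; rewrite le_max.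
    by rewrite k2// orbT.
  by rewrite k1.
move=> /(_ (index_enum 'I_m) e e0)[C C0 h]; exists C => // N p g.
apply: whpS (lexx _) _ (h N p g) => w k c; exact: (k c (mem_index_enum c)).
Qed.

Lemma whp_fine_increments (e : (nat -> R) -> nat -> Omega -> R)
    (b : (nat -> R) -> nat -> Omega -> R) :
  (forall s N p k, s <= T -> grid s N p -> (k < N)%N -> measurable_fun setT (e p k)) ->
  (forall s N p k, s <= T -> grid s N p -> (k < N)%N -> measurable_fun setT (b p k)) ->
  (forall w, exists2 del : R, 0 < del & forall s N p, s <= T -> grid s N p ->
    (forall j, (j < N)%N -> p j.+1 - p j < del) ->
    forall k, (k < N)%N -> e p k w <= b p k w) ->
  forall e' : R, 0 < e' -> exists2 del : R, 0 < del & forall N p, grid t N p ->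
    (forall j, (j < N)%N -> p j.+1 - p j < del) ->
    whp P e' (fun w => forall k, (k < N)%N -> e p k w <= b p k w).
Proof.
move=> me mb heb e' e'0.
have [|del del0 h] := @whp_fine _ _ _ P T
  (fun s N p w => forall k, (k < N)%N -> e p k w <= b p k w) _ heb e' e'0.
  move=> s N p sT g.
  set A := [set w | _].
  have -> : A = \bigcup_(k in `I_N) [set w | b p k w < e p k w].
    rewrite /A; apply/seteqP; split => w /=.
      move=> /existsNP[k /not_implyP[kN /negP]]; rewrite -ltNge => hk.
      by exists k.
    by move=> [k /= kN hk] /(_ k kN); rewrite leNgt hk.
  apply: bigcup_measurable => k /= kN; apply: measurable_set_lt.
    exact: mb sT g kN.
  exact: me sT g kN.
by exists del => // N p g f; exact: (h t N p tT g f).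
Qed.

Let mz f s N p k : smooth f -> s <= T -> grid s N p -> (k <= N)%N ->
  measurable_fun setT (fun w => f (zat (p k) w)).
Proof.
move=> sf sT g kN; have [af _] := smooth_path_process sf.
exact: adapted_measurable af (grid_itvT g sT kN).
Qed.

Let mzb c s N p k : s <= T -> grid s N p -> (k <= N)%N ->
  measurable_fun setT (z c (p k)).
Proof.
move=> sT g kN; have [az _] := pz c.
exact: adapted_measurable az (grid_itvT g sT kN).
Qed.

Let cz w b : {within `[0, T], continuous (fun s => z b s w)}.
Proof. by have [_] := pz b; exact. Qed.

(** For fine meshes an increment of f(z) is at most [C + 1] times the sum of the |dz_c|: [C] bounds
    the partial derivatives on the grid and 1 absorbs the error of the expansion. *)
Lemma tight_qvar_smooth f : smooth f ->
  tight P t (qvar (fun s w => f (zat s w))).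
Proof.
move=> sf e' e'0; pose a := e' / 3; have a0 : 0 < a by rewrite divr_gt0.
have [C C0 hC] := path_process_bounded_fin
  (fun c => smooth_path_process (smooth_pd c sf)) a0.
have [K [d1 d10 hK]] := tight_sum_qvar a0.
have [|||d2 d20 hT] := @whp_fine_increments
  (fun p k w => `|f (zat (p k.+1) w) - f (zat (p k) w) -
      \sum_c (z c (p k.+1) w - z c (p k) w) * pd c f (zat (p k) w)|)
  (fun p k w => 1 * \sum_c `|z c (p k.+1) w - z c (p k) w|) _ _ _ a a0.
- move=> s N p k sT g kN; apply: measurableT_comp => //; apply: measurable_funB.
    by apply: measurable_funB; [exact: mz sT g kN|exact: mz sT g (ltnW kN)].
  apply: measurable_sum => c; apply: measurable_funM.
    by apply: measurable_funB; [exact: mzb sT g kN|exact: mzb sT g (ltnW kN)].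
  exact: mz (smooth_pd c sf) sT g (ltnW kN).
- move=> s N p k sT g kN; apply: measurable_funM => //; apply: measurable_sum => c.
  apply: measurableT_comp => //.
  by apply: measurable_funB; [exact: mzb sT g kN|exact: mzb sT g (ltnW kN)].
- move=> w; have [del del0 h] := path_expansion (zt := fun s b => z b s w) (@cz w) sf ltr01.
  exists del => // s N p sT g fine k kN; apply: h.
  + exact: grid_itvT g sT (ltnW kN).
  + exact: grid_itvT g sT kN.
  + by rewrite distrC ger0_norm ?fine// subr_ge0 ltW//; have [_ _] := g; exact.
exists ((C + 1) ^+ 2 * K), (Num.min d1 d2) => [|N p g /fine_min[f1 f2]].
  by rewrite lt_min d10.
apply: whpS (whp_and (hC N p g) (whp_and (hK N p g f1) (hT N p g f2))).
  by rewrite /a; lra.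
move=> w [k1 [k2 k3]]; rewrite ger0_norm ?qvar_ge0//.
apply: (@le_trans _ _ ((C + 1) ^+ 2 * (m%:R * \sum_c qvar (z c) N p w))); last first.
  by rewrite ler_wpM2l ?sqr_ge0// (le_trans (ler_norm _)).
apply: (@le_trans _ _ ((C + 1) ^+ 2 *
    \sum_(k < N) (\sum_c `|z c (p k.+1) w - z c (p k) w|) ^+ 2)); last first.
  by rewrite ler_wpM2l ?sqr_ge0// sum_sqr_increments_le.
rewrite /qvar big_distrr/=; apply: ler_sum => k _; have kN := ltn_ord k.
have := k3 k kN; rewrite mul1r; set D := \sum_c `|_|; set x := f _ - f _ => hx.
have D0 : 0 <= D by rewrite /D; apply: sumr_ge0 => c _; exact: normr_ge0.
have hs : `|\sum_c (z c (p k.+1) w - z c (p k) w) * pd c f (zat (p k) w)| <= C * D.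
  rewrite /D big_distrr/=; apply: le_trans (ler_norm_sum _ _ _) _.
  apply: ler_sum => c _; rewrite normrM mulrC ler_wpM2r//.
  by apply: k1; exact: ltnW.
have xD : `|x| <= (C + 1) * D.
  move: hx hs; set y := \sum_c _ => hx hs.
  rewrite -(subrK y x) (le_trans (ler_normD _ _))//; lra.
rewrite -(real_normK (num_real x)) -exprMn lerXn2r ?nnegrE//.
by rewrite mulr_ge0// addr_ge0// ltW.
Qed.

Lemma vanish_trapezoid_chain_rule f V : smooth f -> path_process V ->
  vanish P t (fun N p w => \sum_(k < N) (V (p k) w + V (p k.+1) w) / 2 *
    (f (zat (p k.+1) w) - f (zat (p k) w) -
      \sum_c (pd c f (zat (p k) w) + pd c f (zat (p k.+1) w)) / 2 *
         (z c (p k.+1) w - z c (p k) w))).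
Proof.
move=> sf pV; apply: vanish_small tight_sum_qvar _ => r e' r0 e'0.
have e'20 : 0 < e' / 2 by rewrite divr_gt0.
have [aV _] := pV.
have [C C0 hC] := adapted_whp_bounded aV (path_process_bounded pV) e'20.
have rC0 : 0 < r / C by rewrite divr_gt0.
have [|||d2 d20 hT] := @whp_fine_increments
  (fun p k w => `|f (zat (p k.+1) w) - f (zat (p k) w) -
      \sum_c (pd c f (zat (p k) w) + pd c f (zat (p k.+1) w)) / 2 *
         (z c (p k.+1) w - z c (p k) w)|)
  (fun p k w => r / C * (\sum_c `|z c (p k.+1) w - z c (p k) w|) ^+ 2) _ _ _ _ e'20.
- move=> s N p k sT g kN; apply: measurableT_comp => //; apply: measurable_funB.
    by apply: measurable_funB; [exact: mz sT g kN|exact: mz sT g (ltnW kN)].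
  apply: measurable_sum => c; apply: measurable_funM.
    apply: measurable_funM => //; apply: measurable_funD.
      exact: mz (smooth_pd c sf) sT g (ltnW kN).
    exact: mz (smooth_pd c sf) sT g kN.
  by apply: measurable_funB; [exact: mzb sT g kN|exact: mzb sT g (ltnW kN)].
- move=> s N p k sT g kN; apply: measurable_funM => //; apply: measurable_funX.
  apply: measurable_sum => c; apply: measurableT_comp => //.
  by apply: measurable_funB; [exact: mzb sT g kN|exact: mzb sT g (ltnW kN)].
- move=> w; have [del del0 h] := path_trapezoid (zt := fun s b => z b s w) (@cz w) sf rC0.
  exists del => // s N p sT g fine k kN; apply: h.
  + exact: grid_itvT g sT (ltnW kN).
  + exact: grid_itvT g sT kN.
  + by rewrite distrC ger0_norm ?fine// subr_ge0 ltW//; have [_ _] := g; exact.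
exists d2 => // N p g fine.
apply: whpS (whp_and (hC t N p tT g) (hT N p g fine)); first by rewrite -splitr.
move=> w [k1 k2]; rewrite (@ger0_norm _ (m%:R * _)); last first.
  by rewrite mulr_ge0// sumr_ge0// => c _; exact: qvar_ge0.
apply: le_trans (ler_norm_sum _ _ _) _.
apply: (@le_trans _ _ (r * \sum_(k < N) (\sum_c `|z c (p k.+1) w - z c (p k) w|) ^+ 2));
  last by rewrite ler_wpM2l ?(ltW r0)// sum_sqr_increments_le.
rewrite big_distrr/=; apply: ler_sum => k _; have kN := ltn_ord k.
rewrite normrM; set D := \sum_c `|_|.
have -> : r * D ^+ 2 = C * (r / C * D ^+ 2) by field; rewrite gt_eqF.
rewrite ler_pM//; last exact: k2.
rewrite normrM (@ger0_norm _ 2^-1)// ler_pdivrMr// (le_trans (ler_normD _ _))//.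
by rewrite mulr_natr mulr2n lerD// k1// ltnW.
Qed.

End FunctionsOfProcesses.

End StratonovichToolbox.

(** * Rules of calculus for trapezoidal sums *)

Section TrapezoidalCalculus.
Context {R : realType} {d : measure_display} {Omega : measurableType d}.
Variables (P : probability Omega R) (W : R -> Omega -> R) (T : R).
Hypothesis T0 : 0 < T.
Variable t : R.
Hypothesis tT : t <= T.
Local Notation regular := (regular P W T).
Local Notation path_process := (path_process P W T).
Implicit Types (S X Y Z V a : R -> Omega -> R) (p : nat -> R).

Lemma trapDl X Y S p N w :
  trap (fun s w => X s w + Y s w) S p N w = trap X S p N w + trap Y S p N w.
Proof. by rewrite /trap -big_split; apply: eq_bigr => k _ /=; field. Qed.

Lemma trapNl X S p N w : trap (fun s w => - X s w) S p N w = - trap X S p N w.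
Proof. by rewrite /trap -sumrN; apply: eq_bigr => k _ /=; field. Qed.

Lemma trapDr X S Z p N w :
  trap X (fun s w => S s w + Z s w) p N w = trap X S p N w + trap X Z p N w.
Proof. by rewrite /trap -big_split; apply: eq_bigr => k _ /=; field. Qed.

Lemma trapNr X S p N w : trap X (fun s w => - S s w) p N w = - trap X S p N w.
Proof. by rewrite /trap -sumrN; apply: eq_bigr => k _ /=; field. Qed.

Lemma trap_cstr X (c : Omega -> R) p N w : trap X (fun _ => c) p N w = 0.
Proof. by rewrite /trap big1// => k _; rewrite subrr mulr0. Qed.

Lemma trap_suml (I : Type) (r : seq I) (X : I -> R -> Omega -> R) S p N w :
  trap (fun s w => \sum_(i <- r) X i s w) S p N w =
  \sum_(i <- r) trap (X i) S p N w.
Proof.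
rewrite /trap exchange_big/=; apply: eq_bigr => k _.
by rewrite -mulr_suml -mulr_suml big_split.
Qed.

Lemma trap_sumr (I : Type) (r : seq I) X (S : I -> R -> Omega -> R) p N w :
  trap X (fun s w => \sum_(i <- r) S i s w) p N w =
  \sum_(i <- r) trap X (S i) p N w.
Proof.
rewrite /trap exchange_big/=; apply: eq_bigr => k _.
by rewrite -mulr_sumr sumrB.
Qed.

(** Integration by parts is exact here, since [(x + x') / 2 * (y' - y) + (y + y') / 2 * (x' - x)] is
    [x' * y' - x * y]. *)
Lemma trap_parts X Y N p w : grid t N p ->
  trap X Y p N w + trap Y X p N w = X t w * Y t w - X 0 w * Y 0 w.
Proof.
move=> [p0 pN _]; rewrite -[in RHS]p0 -[in RHS]pN.
rewrite -(sum_increments (fun k => X (p k) w * Y (p k) w)) /trap -big_split.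
by apply: eq_bigr => k _ /=; field.
Qed.

(* Trapezoidal form of [V o (Y o dS) = (V Y) o dS]. *)
Lemma vanish_trap_assoc V Y S Z : path_process V -> tight P t (qvar V) ->
  regular Y -> regular S ->
  (forall u, 0 <= u <= T -> stratonovich P Y S u (Z u)) ->
  vanish P t (fun N p w => trap (fun s w => V s w * Y s w) S p N w - trap V Z p N w).
Proof.
move=> pV qV rY rS hZ; have [aV cV] := pV; have [aS cS gS] := rS.
have v1 := sum_avg_strat_error T0 rY rS hZ tT aV (path_process_bounded T0 pV) qV.
have v2 := vanish_cubic tT aV (continuous_paths_as P cV)
  (regular_tight T0 tT rY) (regular_tight T0 tT rS).
(* The average of a product minus the product of the averages is a quarter of the product of the
   increments. *)
apply: vanish_eq (vanishB (vanishZ (1 / 4) v2) v1) _ => N p w _.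
rewrite /trap big_distrr/= -!sumrB; apply: eq_bigr => k _ /=.
by rewrite /strat_error; field.
Qed.

(** Meant for an inner factor d_b L0_a(z), for which no integral against z is at hand: the chain
    rule produces products of averages, and these are compared directly with the average of the
    product. *)
Lemma vanish_trap_mul V Y S : path_process V -> tight P t (qvar V) ->
  tight P t (qvar Y) -> tight P t (qvar S) ->
  vanish P t (fun N p w => trap (fun s w => V s w * Y s w) S p N w -
    \sum_(k < N) (V (p k) w + V (p k.+1) w) / 2 *
      ((Y (p k) w + Y (p k.+1) w) / 2 * (S (p k.+1) w - S (p k) w))).
Proof.
move=> [aV cV] qV qY qS.
have v2 := vanish_cubic tT aV (continuous_paths_as P cV) qY qS.
apply: vanish_eq (vanishZ (1 / 4) v2) _ => N p w _.
rewrite /trap big_distrr/= -!sumrB; apply: eq_bigr => k _ /=.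
by field.
Qed.

Lemma vanish_trap_time_integral V a : path_process V -> path_process a ->
  vanish P t (fun N p w => trap V (time_integral a) p N w -
    time_integral (fun s w => V s w * a s w) t w).
Proof.
move=> [aV cV] [aa ca] e e' e0 e'0.
have [del del0 h] := sum_avg_time_integral T0 aV cV aa ca e0 e'0.
by exists del => // N p g f; exact: (h t N p tT g f).
Qed.

Lemma time_integralD X Y w : 0 <= t -> path_process X -> path_process Y ->
  time_integral (fun s w => X s w + Y s w) t w =
  time_integral X t w + time_integral Y t w.
Proof.
move=> t0 [_ cX] [_ cY]; apply: RintegralD => //.
  exact: (within_continuous_integrable (lexx 0) tT (cX w)).
exact: (within_continuous_integrable (lexx 0) tT (cY w)).
Qed.

Lemma time_integralN X w : 0 <= t -> path_process X ->
  time_integral (fun s w => - X s w) t w = - time_integral X t w.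
Proof.
move=> t0 [_ cX]; rewrite /time_integral -[RHS]mulN1r -RintegralZl//.
  by apply: eq_Rintegral => s _; rewrite mulN1r.
exact: (within_continuous_integrable (lexx 0) tT (cX w)).
Qed.

Lemma time_integral_sum (I : Type) (r : seq I) (X : I -> R -> Omega -> R) w :
  0 <= t -> (forall i, path_process (X i)) ->
  time_integral (fun s w => \sum_(i <- r) X i s w) t w =
  \sum_(i <- r) time_integral (X i) t w.
Proof.
move=> t0 pX; elim: r => [|i r IH].
  rewrite big_nil (_ : (fun s w => _) = fun s w => 0); last first.
    by apply/funext => s; apply/funext => w'; rewrite big_nil.
  by rewrite /time_integral Rintegral_cst// mul0r.
rewrite big_cons -IH -time_integralD//; last exact: path_process_sum.
by congr time_integral; apply/funext => s; apply/funext => w'; rewrite big_cons.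
Qed.

End TrapezoidalCalculus.

(** * The conservation law *)

Section NoetherComponent.
Context {R : realType} {d : measure_display} {Omega : measurableType d}.
Variables (P : probability Omega R) (W : R -> Omega -> R) (T : R).
Hypothesis T0 : 0 < T.
Variable t : R.
Hypothesis tT : 0 <= t <= T.
Local Notation regular := (regular P W T).
Local Notation path_process := (path_process P W T).
Context {m : nat}.
(** One index a and one point x are fixed: [f] is L0_a, [g b] is d_a L0_b and [M b] the
    corresponding entry of the curl; [k] and [Y1] are the terms of the equation with the curls of
    L^i, [h] and [Y2] the derivatives of H and Ht, [pp] and [ppt] the coefficients of dQ_a. *)
Variables (z e et M IM : 'I_m -> R -> Omega -> R)
  (f : ('I_m -> R) -> R) (g : 'I_m -> ('I_m -> R) -> R)
  (Q pp ppt k h Y1 Y2 IK : R -> Omega -> R).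
Local Notation zat s w := (fun b => z b s w).
Hypotheses (rW : regular W) (sf : smooth f) (sg : forall b, smooth (g b)).
Hypotheses (pz : forall b, path_process (z b)) (rz : forall b, regular (z b)).
Hypotheses (pQ : path_process Q) (rQ : regular Q).
Hypotheses (pe : forall b, path_process (e b)) (ppp : path_process pp)
  (pk : path_process k) (ph : path_process h).
Hypotheses (ret : forall b, regular (et b)) (rppt : regular ppt)
  (rM : forall b, regular (M b)) (rY1 : regular Y1) (rY2 : regular Y2).
Hypothesis ME : forall b s w, M b s w = g b (zat s w) - pd b f (zat s w).
Hypothesis hz : forall b (u : R), 0 <= u <= T -> stratonovich P (et b) W u
  (fun w => z b u w - z b 0 w - time_integral (e b) u w).
Hypothesis hQ : forall u : R, 0 <= u <= T -> stratonovich P ppt W u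
  (fun w => Q u w - Q 0 w - time_integral pp u w).
Hypothesis hM : forall b (u : R), 0 <= u <= T -> stratonovich P (M b) (z b) u (IM b u).
Hypothesis hK : forall u : R, 0 <= u <= T -> stratonovich P Y1 W u (IK u).
Hypothesis hH : forall u : R, 0 <= u <= T -> stratonovich P Y2 W u
  (fun w => \sum_b IM b u w + time_integral k u w + IK u w - time_integral h u w).

Let tT1 : t <= T. Proof. by case/andP: tT. Qed.
Let t0 : 0 <= t. Proof. by case/andP: tT. Qed.

Let D b s w := g b (zat s w).
Let pD b : path_process (D b). Proof. exact: smooth_path_process. Qed.
Let D' b s w := pd b f (zat s w).
Let lam s w := f (zat s w).
Let plam : path_process lam. Proof. exact: smooth_path_process. Qed.
Let qQ : tight P t (qvar Q). Proof. exact: (regular_tight T0 tT1 rQ). Qed.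
Let qQM X : path_process X -> tight P t (qvar X) ->
  tight P t (qvar (fun s w => Q s w * X s w)).
Proof.
move=> pX qX; have bX := path_process_bounded T0 pX; have bQ := path_process_bounded T0 pQ.
by have [aX _] := pX; have [aQ _] := pQ; exact: (tight_qvar_mul tT1 aQ bQ aX bX qQ qX).
Qed.
Let qD b : tight P t (qvar (D b)).
Proof. exact: (tight_qvar_smooth T0 pz rz tT1 (sg b)). Qed.
Let qD' b : tight P t (qvar (D' b)).
Proof. exact: (tight_qvar_smooth T0 pz rz tT1 (smooth_pd b sf)). Qed.

(* With [~] for equality up to a vanishing term, and sums over b:
   [Q D_b et_b o dW ~ Q D_b o dz_b - Q D_b e_b dt] by the decomposition of z,
   [Q (Y2 - Y1) o dW ~ Q M_b o dz_b + Q (k - h) dt] by the equation of motion,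
   [lam ppt o dW ~ lam o dQ - lam pp dt] by the compatibility relation, and
   [Q D'_b o dz_b ~ Q o dlam] by the chain rule. *)
Lemma vanish_noether_component :
  vanish P t (fun N p w =>
    trap (fun s w => - (Q s w * (\sum_b g b (zat s w) * et b s w + Y1 s w - Y2 s w)
                        + f (zat s w) * ppt s w)) W p N w
    + (f (zat t w) * Q t w - f (zat 0 w) * Q 0 w)
    + time_integral (fun s w =>
        - (Q s w * (\sum_b g b (zat s w) * e b s w + k s w - h s w)
           + f (zat s w) * pp s w)) t w).
Proof.
have pQD b := path_processM pQ (pD b).
have vz := vanish_sum (index_enum 'I_m) (fun b =>
  vanish_trap_assoc T0 tT1 (pQD b) (qQM (pD b) (qD b)) (ret b) rW (@hz b)).
have vM := vanish_sum (index_enum 'I_m) (fun b =>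
  vanish_trap_assoc T0 tT1 pQ qQ (rM b) (rz b) (@hM b)).
have vK := vanish_trap_assoc T0 tT1 pQ qQ rY1 rW hK.
have vH := vanish_trap_assoc T0 tT1 pQ qQ rY2 rW hH.
have vQ := vanish_trap_assoc T0 tT1 plam (tight_qvar_smooth T0 pz rz tT1 sf) rppt rW hQ.
have ve := vanish_sum (index_enum 'I_m) (fun b =>
  vanish_trap_time_integral T0 tT1 (pQD b) (pe b)).
have vk := vanish_trap_time_integral T0 tT1 pQ pk.
have vh := vanish_trap_time_integral T0 tT1 pQ ph.
have vp := vanish_trap_time_integral T0 tT1 plam ppp.
have vD := vanish_sum (index_enum 'I_m) (fun b =>
  vanish_trap_mul tT1 pQ qQ (qD' b) (regular_tight T0 tT1 (rz b))).
have vC := vanish_trapezoid_chain_rule T0 pz rz tT1 sf pQ.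
have trapB X Y S N p w : trap (fun s w => X s w - Y s w) S p N w =
    trap X S p N w - trap Y S p N w by rewrite trapDl trapNl.
have trapI X Z a N p w : trap X (fun u w => Z u w - Z 0 w - time_integral a u w) p N w =
    trap X Z p N w - trap X (time_integral a) p N w.
  by rewrite !trapDr !trapNr trap_cstr subr0.
have pQDe b := path_processM (pQD b) (pe b).
have pQk := path_processM pQ pk; have pQh := path_processM pQ ph.
have plp := path_processM plam ppp.
have FE w : time_integral (fun s w =>
        - (Q s w * (\sum_b g b (zat s w) * e b s w + k s w - h s w)
           + f (zat s w) * pp s w)) t w =
    - (\sum_b time_integral (fun s w => Q s w * D b s w * e b s w) t w
       + time_integral (fun s w => Q s w * k s w) t w
       - time_integral (fun s w => Q s w * h s w) t w
       + time_integral (fun s w => lam s w * pp s w) t w).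
  rewrite -(time_integral_sum tT1 (index_enum _) w t0 pQDe).
  rewrite -(time_integralN tT1 w t0 pQh).
  rewrite -(time_integralD tT1 w t0 (path_process_sum (index_enum _) pQDe) pQk).
  have p1 := path_processD (path_process_sum (index_enum _) pQDe) pQk.
  have p2 := path_processD p1 (path_processN pQh).
  rewrite -(time_integralD tT1 w t0 p1 (path_processN pQh)).
  rewrite -(time_integralD tT1 w t0 p2 plp).
  rewrite -(time_integralN tT1 w t0 (path_processD p2 plp)).
  congr time_integral; apply/funext => s; apply/funext => w'.
  have -> : \sum_b Q s w' * D b s w' * e b s w' =
      Q s w' * \sum_b g b (zat s w') * e b s w'.
    by rewrite mulr_sumr; apply: eq_bigr => b _; rewrite mulrA.
  by rewrite mulrBr mulrDr.
have GE N p w : trap (fun s w =>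
      - (Q s w * (\sum_b g b (zat s w) * et b s w + Y1 s w - Y2 s w)
         + f (zat s w) * ppt s w)) W p N w =
    - (\sum_b trap (fun s w => Q s w * D b s w * et b s w) W p N w
       + trap (fun s w => Q s w * Y1 s w) W p N w
       - trap (fun s w => Q s w * Y2 s w) W p N w
       + trap (fun s w => lam s w * ppt s w) W p N w).
  rewrite -trap_suml -trapDl -trapB -trapDl -trapNl.
  congr trap; apply/funext => s; apply/funext => w'.
  have -> : \sum_b Q s w' * D b s w' * et b s w' =
      Q s w' * \sum_b g b (zat s w') * et b s w'.
    by rewrite mulr_sumr; apply: eq_bigr => b _; rewrite mulrA.
  by rewrite mulrBr mulrDr.
(* By [trap_parts] the boundary term is [trap lam Q] plus [trap Q lam]; with it the claim is exactly
   this signed sum of vanishing terms. *)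
apply: vanish_eq (vanishB (vanishD (vanishB (vanishB (vanishD (vanishB (vanishB
  (vanishD (vanishB (vanishD ve vk) vh) vp) vz) vK) vH) vQ) vM) vC) vD) _.
move=> N p w gr; rewrite FE GE -(trap_parts lam Q w gr) !sumrB.
have -> : \sum_b trap (fun s w => Q s w * M b s w) (z b) p N w =
    \sum_b trap (fun s w => Q s w * D b s w) (z b) p N w -
    \sum_b trap (fun s w => Q s w * D' b s w) (z b) p N w.
  rewrite -sumrB; apply: eq_bigr => b _; rewrite -trapB; congr trap.
  by apply/funext => s; apply/funext => w'; rewrite ME mulrBr.
have -> : \sum_b trap (fun s w => Q s w * D b s w)
      (fun u w => z b u w - z b 0 w - time_integral (e b) u w) p N w =
    \sum_b trap (fun s w => Q s w * D b s w) (z b) p N w -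
    \sum_b trap (fun s w => Q s w * D b s w) (time_integral (e b)) p N w.
  by rewrite -sumrB; apply: eq_bigr => b _; rewrite trapI.
rewrite trapI !trapDr trapNr trap_sumr.
rewrite [X in _ = _ + X - _](_ : _ = trap Q lam p N w - \sum_b \sum_(j < N)
    (Q (p j) w + Q (p j.+1) w) / 2 * ((D' b (p j) w + D' b (p j.+1) w) / 2 *
      (z b (p j.+1) w - z b (p j) w))); last first.
  rewrite exchange_big -sumrB; apply: eq_bigr => j _.
  by rewrite mulrBr mulr_sumr.
ring.
Qed.

End NoetherComponent.

Section RandomFields.
Context {R : realType} {d : measure_display} {Omega : measurableType d}.
Variables (P : probability Omega R) (W : R -> Omega -> R) (T : R).
Context {n : nat}.
Implicit Types (g : Omega -> ('I_n -> R) -> R) (f : R -> Omega -> ('I_n -> R) -> R).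
Local Notation fm := (fmeas P W).
Local Notation path_process := (path_process P W T).

(** The derivative is the limit of the difference quotients with increments [1 / k.+1], a sequence
    independent of the outcome. *)
Lemma fmeas_pd t i g : (forall w, smooth (g w)) -> (forall x, fm t (fun w => g w x)) ->
  forall x, fm t (fun w => pd i (g w) x).
Proof.
move=> sg mg x.
apply: (@fmeas_lim _ _ _ P W t (fun k w => (k.+1%:R^-1)^-1 *
  (g w [eta x with i |-> k.+1%:R^-1 + x i] - g w x))).
  by move=> k; apply: fmeasM; [exact: fmeas_cst|apply: fmeasB; exact: mg].
move=> w; have dg := @smooth_in_derivable _ _ xpredT (g w) i x (sg w) isT.
have /cvgr_dnbhsP/(_ (fun k => k.+1%:R^-1)) := (dg : cvg _).
rewrite -/(derive _ _ _) -derive1E -/(pd i (g w) x) => h.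
have {}h := h (conj (fun k => invr_neq0 (lt0r_neq0 (ltr0Sn R k))) cvg_harmonic).
rewrite (_ : (fun k => _) = (fun k : nat => (k.+1%:R^-1)^-1 *:
  (((fun r : R => g w [eta x with i |-> r]) \o shift (x i)) (k.+1%:R^-1 *: 1)
   - g w [eta x with i |-> x i])))//.
by apply/funext => k; rewrite /= eta_with_id /GRing.scale/= mulr1.
Qed.

Lemma fmeas_pdn t J g : (forall w, smooth (g w)) -> (forall x, fm t (fun w => g w x)) ->
  forall x, fm t (fun w => pdn J (g w) x).
Proof.
move=> sg mg; rewrite /pdn; elim: (enum 'I_n) => [//|i l IH] /=.
elim: (J i) => [//|k IHk] x /=; apply: fmeas_pd => // w.
exact/smooth_iter/smooth_pdn_seq.
Qed.

Lemma regular_field_path_process f J x : regular_field P W T f ->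
  path_process (fun s w => pdn J (f s w) x).
Proof.
move=> [af sf cf]; split => [t B tT|]; last exact: cf.
move: B; rewrite -/(fm t _); apply: fmeas_pdn => [w|y]; first exact: sf.
exact: adapted_fm (af y) tT.
Qed.

Lemma regular_field_value_path_process f x : regular_field P W T f ->
  path_process (fun s w => f s w x).
Proof.
move=> /(regular_field_path_process (mindex0 : mindex n) x).
by under eq_fun do under eq_fun do rewrite pdn0.
Qed.

Lemma regular_field_pd_path_process f i x : regular_field P W T f ->
  path_process (fun s w => pd i (f s w) x).
Proof.
move=> rf; have [_ sf _] := rf.
have [a c] := regular_field_path_process (mindexS i (mindex0 : mindex n)) x rf.
have E s w : 0 <= s <= T -> pdn (mindexS i mindex0) (f s w) x = pd i (f s w) x.
  by move=> sT; rewrite -pd_pdn ?pdn0//; exact: sf.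
split=> [s B sT mB|w].
  have := a s B sT mB; congr (filtration _ _ _ _).
  by apply/seteqP; split => w /=; rewrite E.
apply: subspace_eq_continuous (c w) => s; rewrite inE/= in_itv/= => sT.
exact: E.
Qed.

Context {m : nat}.
Variables z eta etat : 'I_m -> R -> Omega -> ('I_n -> R) -> R.
Hypotheses (rz : forall a, regular_field P W T (z a))
  (reta : forall a, regular_field P W T (eta a))
  (retat : forall a, regular_field P W T (etat a)).

Lemma prolong_path_process x (c : coord n m) :
  path_process (fun s w => prolong z eta etat s w x c).
Proof.
case: c => [i||a J|a J|a J] /=; first exact: path_process_cst.
- split; first by move=> s B sT mB; exact: (fmeas_cst P W s s mB).
  by move=> w; apply: continuous_subspaceT => s; exact: cvg_id.
- exact: regular_field_path_process.
- exact: regular_field_path_process.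
- exact: regular_field_path_process.
Qed.

Lemma dfun_path_process F x : dfun F ->
  path_process (fun s w => F (prolong z eta etat s w x)).
Proof.
move=> [fF sF]; have [s _ dF] := finite_order_uniq fF.
have cF := smooth_in_continuous sF; split => [t B tT mB|w].
  apply: (fmeas_continuous dF cF (X := fun c w => prolong z eta etat t w x c) _ mB) => c _.
  by have [a _] := prolong_path_process x c; exact: adapted_fm a tT.
apply: (within_continuous_comp dF cF (v := fun r => prolong z eta etat r w x)) => c _.
by have [_ cc] := prolong_path_process x c; exact: cc.
Qed.

End RandomFields.

Section NoetherIngredients.
Context {R : realType} {d : measure_display} {Omega : measurableType d}.
Variables (P : probability Omega R) (W : R -> Omega -> R) (T : R).
Local Notation regular := (regular P W T).
Local Notation path_process := (path_process P W T).
Local Opaque smooth_in.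

Lemma regular_measurable X u : regular X -> 0 <= u <= T -> measurable_fun setT (X u).
Proof. by move=> [aX _ _] uT; exact: (adapted_measurable aX uT). Qed.

Lemma path_process_measurable X u : path_process X -> 0 <= u <= T ->
  measurable_fun setT (X u).
Proof. by move=> [aX _] uT; exact: (adapted_measurable aX uT). Qed.

Lemma semimartingale_regular X : 0 < T -> semimartingale P W T X -> regular X.
Proof.
move=> T0 sX; split; first exact: semimartingale_adapted.
  exact: semimartingale_continuous sX.
exact: semimartingale_good.
Qed.

Lemma brownian_regular : 0 < T -> brownian P W -> regular W.
Proof.
move=> T0 hW; split; first exact: brownian_adapted.
  exact: (brownian_continuous T hW).
exact: brownian_good.
Qed.

(** Solving the equation for the integral replaces the variable [I], given separately at each time,
    by an explicit process. *)
Lemma sdiff_stratonovich X a Y : 0 < T -> path_process X -> path_process a ->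
  regular W -> regular Y -> sdiff P W T X a Y ->
  forall u, 0 <= u <= T -> stratonovich P Y W u
    (fun w => X u w - X 0 w - time_integral a u w).
Proof.
move=> T0 pX pa rW rY h u uT; have [I sI aeI] := h u uT.
have /andP[_ uT1] := uT; have T00 : (0 : R) <= 0 <= T by apply/andP; split => //; exact: ltW.
apply: (stratonovich_ae uT1 _ _ _ _ sI) => [s sT|s sT||].
- exact: regular_measurable rY sT.
- exact: regular_measurable rW sT.
- have [aa ca] := pa; apply: measurable_funB; last exact: (time_integral_measurable T0 aa ca).
  have mX := path_process_measurable pX uT; have mX0 := path_process_measurable pX T00.
  exact: measurable_funB mX mX0.
- by apply: filterS aeI => w ->; rewrite addrC addKr.
Qed.

Context {n m : nat}.
Variables z eta etat : 'I_m -> R -> Omega -> ('I_n -> R) -> R.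
Variables (s : R) (w : Omega).
Hypotheses (sz : forall a, smooth (z a s w)) (seta : forall a, smooth (eta a s w))
  (setat : forall a, smooth (etat a s w)).
Local Notation jt := (prolong z eta etat s w).

Lemma noether_flux vt L0 L1 H (Q PP PPt : 'I_m -> (coord n m -> R) -> R) B x :
  (forall a, smooth (L0 a)) -> (forall i a, smooth (L1 i a)) -> smooth H ->
  (forall a, dfun (Q a)) -> (forall i, dfun (B i)) ->
  div_symmetry Q PP PPt (lagrangian (velocity vt) L0 L1 H) B ->
  \sum_i pd i (fun y => \sum_a L1 i a (fun b => z b s w y) * Q a (jt y)
                        - B i (jt y)) x =
  \sum_a - (Q a (jt x) *
    (\sum_b pd a (L0 b) (fun b => z b s w x) * (if vt then eta b s w x else etat b s w x)
     + \sum_i \sum_b curl (L1 i) a b (fun b => z b s w x) * pd i (z b s w) x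
     - pd a H (fun b => z b s w x))
    + L0 a (fun b => z b s w x) * (if vt then PP a (jt x) else PPt a (jt x))).
Proof.
move=> sL0 sL1 sH dQ dB sym.
have jzE : jz (jt x) = fun b => z b s w x.
  by apply/funext => b; rewrite /jz /= pdn0.
have ZxE i b : jt x (Zx i b) = pd i (z b s w) x.
  by rewrite /= -pd_pdn ?pdn0//; exact: sz.
have vE b : jt x (velocity vt b) = if vt then eta b s w x else etat b s w x.
  by rewrite /velocity; case: (vt) => /=; rewrite pdn0.
have := symmetry_flux sL0 sL1 sH (jt x) sym; rewrite jzE => symE.
rewrite (eq_bigr _ (fun i _ => pd_flux sz seta setat x i sL1 dQ dB)).
under eq_bigr => i _.
  under eq_bigr => a _.
    under eq_bigr => b _ do rewrite -ZxE.
    over.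
  over.
rewrite symE -opprD -big_split sumrN /=; congr (- _).
apply: eq_bigr => a _; congr (_ * (_ + _ - _) + _).
  by apply: eq_bigr => b _; rewrite -vE.
by apply: eq_bigr => i _; apply: eq_bigr => b _; rewrite -ZxE.
Qed.

End NoetherIngredients.

Section EquationOfMotion.
Context {R : realType} {d : measure_display} {Omega : measurableType d}.
Variables (P : probability Omega R) (W : R -> Omega -> R) (T : R).
Hypothesis T0 : 0 < T.
Local Notation regular := (regular P W T).
Local Notation path_process := (path_process P W T).
Local Opaque smooth_in.

(** The integrals are given separately at each time and choice collects them into processes. The
    equation is then solved for the integral of d_a Ht, the only one made explicit. *)
Lemma multisymplectic_stratonovich n m L0 L1 Lt1 H Ht
    (z : 'I_m -> R -> Omega -> ('I_n -> R) -> R) x a :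
  multisymplectic P W T L0 L1 Lt1 H Ht z -> regular W ->
  path_process (fun s w => \sum_i \sum_b
    curl (L1 i) a b (fun b => z b s w x) * pd i (z b s w) x) ->
  path_process (fun s w => pd a H (fun b => z b s w x)) ->
  regular (fun s w => pd a Ht (fun b => z b s w x)) ->
  exists (IM : 'I_m -> R -> Omega -> R) (IK : R -> Omega -> R),
    forall u : R, 0 <= u <= T ->
    [/\ forall b, stratonovich P (fun s w => curl L0 a b (fun b => z b s w x))
          (fun s w => z b s w x) u (IM b u),
        stratonovich P (fun s w => \sum_i \sum_b
          curl (Lt1 i) a b (fun b => z b s w x) * pd i (z b s w) x) W u (IK u)
      & stratonovich P (fun s w => pd a Ht (fun b => z b s w x)) W u
          (fun w => \sum_b IM b u w
            + time_integral (fun s w => \sum_i \sum_b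
                curl (L1 i) a b (fun b => z b s w x) * pd i (z b s w) x) u w
            + IK u w
            - time_integral (fun s w => pd a H (fun b => z b s w x)) u w)].
Proof.
move=> hsys rW pk ph rY2.
have /choice[F hF] (u : R) : exists I : ('I_m -> Omega -> R) * (Omega -> R), 0 <= u <= T ->
    [/\ forall b, stratonovich P (fun s w => curl L0 a b (fun b => z b s w x))
          (fun s w => z b s w x) u (I.1 b),
        stratonovich P (fun s w => \sum_i \sum_b
          curl (Lt1 i) a b (fun b => z b s w x) * pd i (z b s w) x) W u I.2
      & stratonovich P (fun s w => pd a Ht (fun b => z b s w x)) W u
          (fun w => \sum_b I.1 b w
            + time_integral (fun s w => \sum_i \sum_b
                curl (L1 i) a b (fun b => z b s w x) * pd i (z b s w) x) u w
            + I.2 w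
            - time_integral (fun s w => pd a H (fun b => z b s w x)) u w)].
  (* Outside [[0, T]] nothing is claimed, so zero is taken there. *)
  have [uT|nuT] := pselect (0 <= u <= T); last by exists (fun _ _ => 0, fun=> 0).
  have [IM [IK [IH [hM hK hH ae]]]] := hsys x a u uT.
  exists (IM, IK) => _; split => //=; have /andP[_ uT1] := uT.
  apply: (stratonovich_ae uT1 _ _ _ _ hH) => [s sT|s sT||].
  - exact: regular_measurable rY2 sT.
  - exact: regular_measurable rW sT.
  - have [ak ck] := pk; have [ah ch] := ph.
    apply: measurable_funB; last exact: (time_integral_measurable T0 ah ch).
    apply: measurable_funD; last by case: hK.
    apply: measurable_funD; last exact: (time_integral_measurable T0 ak ck).
    by apply: measurable_sum => b; case: (hM b).
  - by apply: filterS ae => w ->; rewrite addrC addKr.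
by exists (fun b u => (F u).1 b), (fun u => (F u).2).
Qed.

End EquationOfMotion.

Theorem mainTheorem3 (R : realType) (d : measure_display)
    (Omega : measurableType d) (P : probability Omega R)
    (W : R -> Omega -> R) (hW : brownian P W)
    (T : R) (hT : 0 < T) (n m : nat)
    (L0 : 'I_m -> ('I_m -> R) -> R)
    (L1 Lt1 : 'I_n -> 'I_m -> ('I_m -> R) -> R)
    (H Ht : ('I_m -> R) -> R)
    (hL0 : forall a, smooth (L0 a))
    (hL1 : forall i a, smooth (L1 i a))
    (hLt1 : forall i a, smooth (Lt1 i a))
    (hH : smooth H) (hHt : smooth Ht)
    (Q PP PPt : 'I_m -> (coord n m -> R) -> R)
    (B Bt : 'I_n -> (coord n m -> R) -> R)
    (hQ : forall a, dfun (Q a))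
    (hPP : forall a, dfun (PP a))
    (hPPt : forall a, dfun (PPt a))
    (hB : forall i, dfun (B i))
    (hBt : forall i, dfun (Bt i))
    (hsym : div_symmetry Q PP PPt
              (lagrangian (fun a => JetEta a mindex0) L0 L1 H) B)
    (hsymt : div_symmetry Q PP PPt
              (lagrangian (fun a => JetEtat a mindex0) L0 Lt1 Ht) Bt)
    (z eta etat : 'I_m -> R -> Omega -> ('I_n -> R) -> R)
    (hz : forall a, regular_field P W T (z a))
    (heta : forall a, regular_field P W T (eta a))
    (hetat : forall a, regular_field P W T (etat a))
    (hsemi : semimartingale_integrands P W T L0 Lt1 Ht PPt z eta etat)
    (hdz : forall a x, sdiff P W T (fun t w => z a t w x)
             (fun t w => eta a t w x) (fun t w => etat a t w x))
    (hsys : multisymplectic P W T L0 L1 Lt1 H Ht z)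
    (hcompat : forall a x, sdiff P W T
       (fun t w => Q a (prolong z eta etat t w x))
       (fun t w => PP a (prolong z eta etat t w x))
       (fun t w => PPt a (prolong z eta etat t w x))) :
  forall (x : 'I_n -> R) (t : R), 0 <= t <= T ->
  exists2 I : Omega -> R,
    stratonovich P (fun s w => \sum_i pd i (fun y =>
        \sum_a Lt1 i a (fun b => z b s w y) * Q a (prolong z eta etat s w y)
        - Bt i (prolong z eta etat s w y)) x) W t I &
    {ae P, forall w,
      (\sum_a L0 a (fun b => z b t w x) * Q a (prolong z eta etat t w x)
       - \sum_a L0 a (fun b => z b 0 w x) * Q a (prolong z eta etat 0 w x))
      + time_integral (fun s w => \sum_i pd i (fun y =>
          \sum_a L1 i a (fun b => z b s w y) * Q a (prolong z eta etat s w y)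
          - B i (prolong z eta etat s w y)) x) t w
      + I w = 0}.
Proof.
move=> x t tT; have /andP[t0 tT1] := tT.
have T00 : (0 : R) <= 0 <= T by apply/andP; split => //; exact: ltW.
have rW := brownian_regular hT hW.
have pz b := regular_field_value_path_process x (hz b).
have pe b := regular_field_value_path_process x (heta b).
have pet b := regular_field_value_path_process x (hetat b).
have pdf F : dfun F -> path_process P W T (fun s w => F (prolong z eta etat s w x)).
  exact: dfun_path_process.
have ret b : regular P W T (fun s w => etat b s w x).
  by have [h _ _ _ _] := hsemi x b; exact: semimartingale_regular.
have rppt a : regular P W T (fun s w => PPt a (prolong z eta etat s w x)).
  by have [_ h _ _ _] := hsemi x a; exact: semimartingale_regular.
have rM a b : regular P W T (fun s w => curl L0 a b (fun b => z b s w x)).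
  by have [_ _ h _ _] := hsemi x a; exact: semimartingale_regular.
have rY1 a : regular P W T (fun s w => \sum_i \sum_b
    curl (Lt1 i) a b (fun b => z b s w x) * pd i (z b s w) x).
  by have [_ _ _ h _] := hsemi x a; exact: semimartingale_regular.
have rY2 a : regular P W T (fun s w => pd a Ht (fun b => z b s w x)).
  by have [_ _ _ _ h] := hsemi x a; exact: semimartingale_regular.
have dz b := sdiff_stratonovich hT (pz b) (pe b) rW (ret b) (hdz b x).
have dQ a := sdiff_stratonovich hT (pdf _ (hQ a)) (pdf _ (hPP a)) rW (rppt a) (hcompat a x).
have rz b := integral_process_regular hT (pz b) (pe b) (ret b) rW (dz b).
have rQ a := integral_process_regular hT (pdf _ (hQ a)) (pdf _ (hPP a)) (rppt a) rW (dQ a).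
have pcurl (L : 'I_n -> 'I_m -> ('I_m -> R) -> R) a : (forall i a, smooth (L i a)) ->
    path_process P W T (fun s w => \sum_i \sum_b
    curl (L i) a b (fun b => z b s w x) * pd i (z b s w) x).
  move=> sL; apply: path_process_sum => i; apply: path_process_sum => b.
  apply: path_processM; last exact: regular_field_pd_path_process.
  exact: (path_processB (smooth_path_process pz (smooth_pd a (sL i b)))
    (smooth_path_process pz (smooth_pd b (sL i a)))).
have ph a := smooth_path_process pz (smooth_pd a hH).
pose lam a s w := L0 a (fun b => z b s w x).
pose q a s w := Q a (prolong z eta etat s w x).
(* [G a] and [F a] are the dW and dt coefficients that index [a] contributes to the divergence of
   the flux once the symmetry is used. *)
pose G a s w := - (q a s w * (\sum_b pd a (L0 b) (fun b => z b s w x) * etat b s w x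
  + \sum_i \sum_b curl (Lt1 i) a b (fun b => z b s w x) * pd i (z b s w) x
  - pd a Ht (fun b => z b s w x)) + lam a s w * PPt a (prolong z eta etat s w x)).
pose F a s w := - (q a s w * (\sum_b pd a (L0 b) (fun b => z b s w x) * eta b s w x
  + \sum_i \sum_b curl (L1 i) a b (fun b => z b s w x) * pd i (z b s w) x
  - pd a H (fun b => z b s w x)) + lam a s w * PP a (prolong z eta etat s w x)).
have vG a : vanish P t (fun N p w => trap (G a) W p N w
    + (lam a t w * q a t w - lam a 0 w * q a 0 w) + time_integral (F a) t w).
  have [IM [IK hI]] := multisymplectic_stratonovich hT hsys rW (pcurl _ a hL1) (ph a) (rY2 a).
  apply: (vanish_noether_component hT tT (IM := IM) (IK := IK) rW (hL0 a)
    (fun b => smooth_pd a (hL0 b)) pz rz (pdf _ (hQ a)) (rQ a) pe (pdf _ (hPP a))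
    (pcurl _ a hL1) (ph a) ret (rppt a) (rM a) (rY1 a) (rY2 a) _ dz (dQ a)) => //.
  - by move=> b u /hI[].
  - by move=> u /hI[].
  - by move=> u /hI[].
have smooth_at s w : 0 <= s <= T -> [/\ forall a, smooth (z a s w),
    forall a, smooth (eta a s w) & forall a, smooth (etat a s w)].
  move=> sT; split=> a; [have [_ h _] := hz a|have [_ h _] := heta a|
    have [_ h _] := hetat a]; exact: h.
(* The restriction to [[0, T]] comes from the fields, which are known to be smooth in space only
   there. *)
have eY s w : 0 <= s <= T -> \sum_i pd i (fun y =>
      \sum_a Lt1 i a (fun b => z b s w y) * Q a (prolong z eta etat s w y)
      - Bt i (prolong z eta etat s w y)) x = \sum_a G a s w.
  move=> sT; have [sz se st] := smooth_at s w sT.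
  exact: (@noether_flux _ _ _ n m z eta etat s w sz se st false
    L0 Lt1 Ht Q PP PPt Bt x hL0 hLt1 hHt hQ hBt hsymt).
have eX s w : 0 <= s <= T -> \sum_i pd i (fun y =>
      \sum_a L1 i a (fun b => z b s w y) * Q a (prolong z eta etat s w y)
      - B i (prolong z eta etat s w y)) x = \sum_a F a s w.
  move=> sT; have [sz se st] := smooth_at s w sT.
  exact: (@noether_flux _ _ _ n m z eta etat s w sz se st true
    L0 L1 H Q PP PPt B x hL0 hL1 hH hQ hB hsym).
have pq a : path_process P W T (q a) by exact: pdf.
have plam a : path_process P W T (lam a) by exact: (smooth_path_process pz (hL0 a)).
have pL0 (v : 'I_m -> R -> Omega -> ('I_n -> R) -> R) a :
    (forall b, path_process P W T (fun s w => v b s w x)) -> path_process P W T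
      (fun s w => \sum_b pd a (L0 b) (fun b => z b s w x) * v b s w x).
  move=> pv; apply: path_process_sum => b; apply: path_processM (pv b).
  exact: (smooth_path_process pz (smooth_pd a (hL0 b))).
have pG a : path_process P W T (G a).
  apply: path_processN; apply: path_processD; last first.
    exact: path_processM (plam a) (pdf _ (hPPt a)).
  apply: path_processM => //; apply: path_processB.
    exact: path_processD (pL0 etat a pet) (pcurl _ a hLt1).
  exact: (smooth_path_process pz (smooth_pd a hHt)).
have pF a : path_process P W T (F a).
  apply: path_processN; apply: path_processD; last first.
    exact: path_processM (plam a) (pdf _ (hPP a)).
  apply: path_processM => //; apply: path_processB (ph a).
  exact: path_processD (pL0 eta a pe) (pcurl _ a hL1).
have eTI w : time_integral (fun s w => \sum_i pd i (fun y =>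
          \sum_a L1 i a (fun b => z b s w y) * Q a (prolong z eta etat s w y)
          - B i (prolong z eta etat s w y)) x) t w = \sum_a time_integral (F a) t w.
  rewrite -(time_integral_sum tT1 (index_enum _) w t0 pF).
  apply: eq_Rintegral => s; rewrite inE/= in_itv/= => /andP[s0 st]; apply: eX.
  by rewrite s0 (le_trans st).
pose C w := \sum_a lam a t w * q a t w - \sum_a lam a 0 w * q a 0 w.
(* The integral is taken to be what the conservation law demands, so the law holds for every
   outcome; what remains is that the trapezoidal sums converge to it, which is the sum of [vG] over
   the indices. *)
exists (fun w => - C w - \sum_a time_integral (F a) t w); last first.
  by apply: aeW => w; rewrite eTI /C /lam /q; ring.
apply: (vanish_stratonovich tT1).
- move=> s sT; rewrite [X in measurable_fun _ X](_ : _ = fun w => \sum_a G a s w).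
    by apply: measurable_sum => a; exact: (path_process_measurable (pG a) sT).
  by apply/funext => w; exact: eY.
- by move=> s sT; exact: (regular_measurable rW sT).
- apply: measurable_funB.
    apply: measurableT_comp => //; apply: measurable_funB; apply: measurable_sum => a.
      exact: (path_process_measurable (path_processM (plam a) (pq a)) tT).
    exact: (path_process_measurable (path_processM (plam a) (pq a)) T00).
  apply: measurable_sum => a; have [aF cF] := pF a.
  exact: (time_integral_measurable hT aF cF).
apply: vanish_eq (vanish_sum (index_enum 'I_m) vG) _ => N p w g.
rewrite !big_split sumrN /= -trap_suml /C; set Y := trap _ _ _ _ _.
suff -> : Y = trap (fun s w => \sum_a G a s w) W p N w by ring.
apply: eq_bigr => k _; have kN := ltn_ord k.
by rewrite !eY ?(grid_itvT g tT1)// ltnW.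
Qed.
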